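(* Let $v_0\in L_{\mathbf K}(\Omega;\mathbb R^n)$. Let $v$ be a strong solution to $\partial_tv=L(\mathbf F(v))$, $v(0,\cdot)=v_0$, on the interval $[0,T]$ with total entropy $K(t)=K(0)=\int_\Omega\mathbf K(v_0)\,dx$, and let $(u,M)$ be a subsolution (with the same initial datum $v_0$) on $[0,T]$ with total entropy $\tilde K(t)=\frac12(M(t,\cdot)-\mathbf F(0),I)$. Then for any $0\le t_0<t_1\le T$ it cannot simultaneously be that $\tilde K(t)\le K(t)$ for a.a. $t\in(0,t_1)$ and $\tilde K(t)<K(t)$ for a.a. $t\in(t_0,t_1)$. In particular, it is impossible that $\tilde K(t)<K(t)$ for a.a. $t\in(0,\epsilon)$, $\epsilon>0$.
   Context: **Spaces and matrices.** $\Omega=\mathbb T^d$ is the periodic box with Lebesgue measure, $(u,w)=\int_\Omega u\cdot w\,dx$ (for matrix fields, the Frobenius product $A:B$ is used). $\mathbb R^{N\times N}_s$ and $\mathbb R^{N\times N}_+$ are the symmetric and the nonnegative-definite matrices. $I$ is the identity matrix. A Young function is a convex even $\Phi:\mathbb R\to\mathbb R_+$ with $\Phi(s)=0$ iff $s=0$, $\Phi(s)/s\to0$ as $s\to0$ and $\Phi(s)/s\to+\infty$ as $s\to+\infty$. An $N$-function is a convex even $\mathbf K:\mathbb R^n\to\mathbb R_+$ such that $\Phi_-(|y|)\le\mathbf K(y)\le\Phi_+(|y|)$ for some Young functions $\Phi_\pm$. It satisfies the $\Delta_2$-condition if $\mathbf K(2y)\le C(\mathbf K(y)+1)$ for all $y$.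 $\mathbf K^*$ is the Legendre transform. $L_{\mathbf K}(Q;\mathbb R^n)$ is the anisotropic Orlicz space of measurable $f:Q\to\mathbb R^n$ with $\int_Q\mathbf K(f)\,dx<\infty$ (a Banach space with the Luxemburg norm; its dual is $L_{\mathbf K^*}$). **Data and standing assumptions.** $\mathbf F:\mathbb R^n\to\mathbb R^{N\times N}_s$ is $C^2$; $L$ is a linear differential operator with constant coefficients mapping $\mathbb R^{N\times N}_s$-valued functions on $\Omega$ to $\mathbb R^n$-valued functions, and $L^*$ is its adjoint, with values in $\mathbb R^{N\times N}_s$. It is assumed that: 1. (Entropy) $\mathbf K(v):=\frac12\operatorname{Tr}(\mathbf F(v)-\mathbf F(0))$ is strictly convex, is an $N$-function, and $\mathbf K,\mathbf K^*$ satisfy $\Delta_2$. Write $v^{\#}:=\nabla\mathbf K(v)$, so that $v=\nabla\mathbf K^*(v^{\#})$. 2. ($\Lambda$-convexity) Let $\Lambda\subset\mathbb R^{N\times N}_s$ be the smallest linear subspace containing $I$ and all values $L^*u(x)$, $u:\Omega\to\mathbb R^n$ smooth, $x\in\Omega$. For every $P\in\Lambda\cap\mathbb R^{N\times N}_+$ the function $\mathbf F:P$ is convex. 3. ($\Lambda$-order) Let $\mathbb R^{N\times N}_\Lambda=\{\Xi\in\mathbb R^{N\times N}_s:\ \Xi:P\ge0\ \forall P\in\Lambda\cap\mathbb R^{N\times N}_+\}$ and write $B\le A$ when $A-B\in\mathbb R^{N\times N}_\Lambda$. Then $\mathbf F(\mathbb R^n)\subset\mathbb R^{N\times N}_\Lambda$,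 and, with $\pi_\Lambda$ the orthogonal projection onto $\Lambda$, $|\pi_\Lambda\partial_l\mathbf F(v)|\le C(|\nabla\mathbf K(v)|+1)$ for all $v\in\mathbb R^n$, $l=1,\dots,n$. 4. (Conservativity) $(\mathbf F(v),L^*(v^{\#}))=0$ whenever $v^{\#}:\Omega\to\mathbb R^n$ is smooth and $v=\nabla\mathbf K^*(v^{\#})$. **Weight.** $\mathfrak h$ is a fixed positive scalar function on $[0,T]$ bounded away from $0$ and $\infty$; $\mathfrak H(t)=\int_t^T\mathfrak h(s)\,ds$. (The notion of strong solution below does not depend on the choice of $\mathfrak h$; one may take $\mathfrak h\equiv1$.) **Constraint (C)** on $(E,B)\in L_{\mathbf K^*}((0,T)\times\Omega;\mathbb R^n)\times L^\infty((0,T)\times\Omega;\mathbb R^{N\times N}_s)$: $\int_0^T[(B,\partial_t\Psi)+(E,L\Psi)]\,dt=0$ for all smooth $\Psi:[0,T]\times\Omega\to\mathbb R^{N\times N}_s$ with $\Psi(0)=0$. **Weak solution:** $v\in L_{\mathbf K}((0,T)\times\Omega;\mathbb R^n)$ with $\int_0^T[(v-v_0,E)+(\mathbf F(v),B)]\,dt=0$ for all $(E,B)\in L_{\mathbf K^*}((0,T)\times\Omega;\mathbb R^n)\times L^\infty((0,T)\times\Omega;\mathbb R^{N\times N}_s)$ satisfying (C). **Subsolution:** a pair $(v,M)\in L_{\mathbf K}((0,T)\times\Omega;\mathbb R^n)\times L^1((0,T)\times\Omega;\mathbb R^{N\times N}_s)$ with $\mathbf F(v)\le M$ a.e. in $(0,T)\times\Omega$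 (in the $\Lambda$-order) and $\int_0^T[(v-v_0,E)+(M,B)]\,dt=0$ for all $(E,B)\in L_{\mathbf K^*}((0,T)\times\Omega;\mathbb R^n)\times L^\infty((0,T)\times\Omega;\mathbb R^{N\times N}_s)$ satisfying (C). **Strong solution:** a weak solution $v$ such that $\partial_t(\mathfrak Hv^{\#})\in L_{\mathbf K^*}((0,T)\times\Omega;\mathbb R^n)$, $\mathfrak HL^*(v^{\#})\in L^\infty((0,T)\times\Omega;\mathbb R^{N\times N}_s)$, and $\partial_t(v^{\#})_l+L^*(v^{\#}):\partial_l\mathbf F(\nabla\mathbf K^*(v^{\#}))=0$ a.e. in $(0,T)\times\Omega$ for $l=1,\dots,n$, $v^{\#}(0,\cdot)=(v_0)^{\#}$ a.e. in $\Omega$. (Then $v^{\#}\in C([0,T);L_{\mathbf K^*}(\Omega;\mathbb R^n))$.) **Total entropies.** For a strong solution, $K(t)=\int_\Omega\mathbf K(v(t,x))\,dx$, which is constant in time on $[0,T)$ and equal to $\int_\Omega\mathbf K(v_0)\,dx$. For a subsolution $(u,M)$, $\tilde K(t)=\frac12\operatorname{Tr}\int_\Omega[M(t,x)-\mathbf F(0)]\,dx=\frac12(M(t,\cdot)-\mathbf F(0),I)$, which is in $L^1(0,T)$. *)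

(* Defs.v *)
From HB Require Import structures.
From mathcomp Require Import all_boot all_order all_algebra.
From mathcomp Require Import all_classical all_reals all_analysis.
Set Implicit Arguments.
Unset Strict Implicit.
Unset Printing Implicit Defensive.
Import Order.TTheory GRing.Theory Num.Theory.
Import numFieldNormedType.Exports.
Local Open Scope classical_set_scope.
Local Open Scope ring_scope.

Definition rV_display : measure_display -> measure_display. Proof. exact. Qed.

Section rV_measurable.
Context (R : realType) (d : nat).

Let coord (i : 'I_d) (x : 'rV[R]_d) : measurableTypeR R := x ord0 i.

Let rV_set0 : g_sigma_preimage coord set0.
Proof. exact: sigma_algebra0. Qed.

Let rV_setC A : g_sigma_preimage coord A -> g_sigma_preimage coord (~` A).
Proof. exact: sigma_algebraC. Qed.

Let rV_bigcup (F : _^nat) : (forall i, g_sigma_preimage coord (F i)) ->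
  g_sigma_preimage coord (\bigcup_i (F i)).
Proof. exact: sigma_algebra_bigcup. Qed.

HB.instance Definition _ := @isMeasurable.Build (rV_display default_measure_display)
  'rV[R]_d (g_sigma_preimage coord) rV_set0 rV_setC rV_bigcup.

Lemma measurable_rV_coord (i : 'I_d) :
  measurable_fun setT (fun x : 'rV[R]_d => x ord0 i : measurableTypeR R).
Proof.
move=> _ Y mY; rewrite setTI; apply: sub_sigma_algebra => /=.
rewrite -bigcup_seq/=; exists i => /=; first by rewrite mem_index_enum.
by exists Y => //; rewrite setTI.
Qed.

Lemma measurable_fun_rVP d1 (T : measurableType d1) (f : T -> 'rV[R]_d) :
  (forall i, measurable_fun setT (fun t => f t ord0 i : measurableTypeR R)) ->
  measurable_fun setT f.
Proof.
move=> mf.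
have sub : g_sigma_preimage (fun i => coord i \o f) `<=` measurable.
  apply: smallest_sub; first exact: sigma_algebra_measurable.
  by move=> A; rewrite -bigcup_seq => -[i _ [B mB <-]]; exact: (mf i).
move=> _ A mA; apply: sub; rewrite g_sigma_preimage_comp.
by exists A.
Qed.

End rV_measurable.

Lemma sigma_finite_product d1 d2 (T1 : measurableType d1)
    (T2 : measurableType d2) (R : realType)
    (m1 : {sigma_finite_measure set T1 -> \bar R})
    (m2 : {sigma_finite_measure set T2 -> \bar R}) :
  sigma_finite setT (m1 \x m2)%E.
Proof.
have /sigma_finiteP[F [TF ndF Foo]] := sigma_finiteT m1.
have /sigma_finiteP[G [TG ndG Goo]] := sigma_finiteT m2.
exists (fun n => F n `*` G n).
  rewrite -setXTT TF TG predeqE => -[x y]; split.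
    move=> [/= [n _ Fnx] [k _ Gky]]; exists (maxn n k) => //; split.
    - by move: x Fnx; exact/subsetPset/ndF/leq_maxl.
    - by move: y Gky; exact/subsetPset/ndG/leq_maxr.
  by move=> [n _ []/= ? ?]; split; exists n.
move=> k; have [? ?] := Foo k; have [? ?] := Goo k.
split; first exact: measurableX.
by rewrite product_measure1E// lte_mul_pinfty// ge0_fin_numE.
Qed.

Section lebesgue_rV.
Context (R : realType).

Let cons_rV d (p : measurableTypeR R * 'rV[R]_d) : 'rV[R]_d.+1 :=
  row_mx (const_mx p.1 : 'rV_1) p.2.

Let measurable_cons_rV d : measurable_fun setT (@cons_rV d).
Proof.
apply: measurable_fun_rVP => i; rewrite /cons_rV.
case: (split_ordP (i : 'I_(1 + d))) => j ->.
  have -> : (fun t : measurableTypeR R * 'rV[R]_d =>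
      row_mx (const_mx t.1 : 'rV_1) t.2 ord0 (lshift d j)) = fst.
    by apply/funext => t; rewrite row_mxEl mxE.
  exact: measurable_fst.
have -> : (fun t : measurableTypeR R * 'rV[R]_d =>
    row_mx (const_mx t.1 : 'rV_1) t.2 ord0 (rshift 1 j)) =
    (fun x : 'rV[R]_d => x ord0 j : measurableTypeR R) \o snd.
  by apply/funext => t; rewrite row_mxEr.
by apply: measurableT_comp => //; exact: measurable_rV_coord.
Qed.

Let uncons_rV d (x : 'rV[R]_d.+1) : measurableTypeR R * 'rV[R]_d :=
  (x ord0 ord0, \row_i x ord0 (lift ord0 i)).

Let measurable_uncons_rV d : measurable_fun setT (@uncons_rV d).
Proof.
apply: measurable_fun_pair => /=; first exact: measurable_rV_coord.
apply: measurable_fun_rVP => i.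
under eq_fun do rewrite mxE.
exact: measurable_rV_coord.
Qed.

Let cons_rV0 d t (x : 'rV[R]_d) : cons_rV (t, x) ord0 ord0 = t.
Proof.
rewrite /cons_rV /=.
have /(congr1 (fun i => row_mx (const_mx t : 'rV_1) x ord0 i)) -> :
  ord0 = lshift d ord0 :> 'I_(1 + d) by apply: val_inj.
by rewrite row_mxEl mxE.
Qed.

Let cons_rVS d t (x : 'rV[R]_d) i : cons_rV (t, x) ord0 (lift ord0 i) = x ord0 i.
Proof.
rewrite /cons_rV /=.
have /(congr1 (fun i => row_mx (const_mx t : 'rV_1) x ord0 i)) -> :
  lift ord0 i = rshift 1 i :> 'I_(1 + d) by apply: val_inj.
by rewrite row_mxEr.
Qed.

Let consK d : cancel (@cons_rV d) (@uncons_rV d).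
Proof.
move=> [t x]; rewrite /uncons_rV cons_rV0; congr (_, _).
by apply/rowP => i; rewrite mxE cons_rVS.
Qed.

Section step.
Context (d : nat) (mu : {sigma_finite_measure set 'rV[R]_d -> \bar R}).

Definition rV_step : set 'rV[R]_d.+1 -> \bar R :=
  pushforward (lebesgue_measure \x mu)%E (@cons_rV d).

Let rV_step0 : rV_step set0 = 0%E.
Proof. by rewrite /rV_step /pushforward preimage_set0 measure0. Qed.

Let rV_step_ge0 A : (0 <= rV_step A)%E.
Proof.
rewrite /rV_step /pushforward /product_measure1.
by apply: integral_ge0 => x _; exact: measure_ge0.
Qed.

Let rV_step_sigma_additive : semi_sigma_additive rV_step.
Proof.
move=> F mF tF mUF; rewrite /rV_step /pushforward preimage_bigcup.
apply: measure_semi_sigma_additive.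
- by move=> n; rewrite -[X in measurable X]setTI; exact: measurable_cons_rV.
- apply/trivIsetP => /= i j _ _ ij; rewrite -preimage_setI.
  by move/trivIsetP : tF => /(_ _ _ _ _ ij) ->//; rewrite preimage_set0.
- by rewrite -preimage_bigcup -[X in measurable X]setTI; exact: measurable_cons_rV.
Qed.

HB.instance Definition _ := isMeasure.Build _ _ _ rV_step
  rV_step0 rV_step_ge0 rV_step_sigma_additive.

Let rV_step_sigma_finite : sigma_finite setT rV_step.
Proof.
have [F UF mF] := sigma_finite_product (@lebesgue_measure R :
  {sigma_finite_measure set (measurableTypeR R) -> \bar R}) mu.
exists (fun k => @uncons_rV d @^-1` F k); first by rewrite -preimage_bigcup -UF.
move=> k; have [mFk Fk] := mF k; split.
  by rewrite -[X in measurable X]setTI; exact: measurable_uncons_rV.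
rewrite /rV_step /pushforward -comp_preimage.
by rewrite (_ : _ \o _ = id) //; apply/funext => p /=; exact: consK.
Qed.

HB.instance Definition _ :=
  @Measure_isSigmaFinite.Build _ _ _ rV_step rV_step_sigma_finite.

End step.

Fixpoint lebesgue_rV d : {sigma_finite_measure set 'rV[R]_d -> \bar R} :=
  if d is d'.+1 then rV_step (lebesgue_rV d') else \d_(0 : 'rV[R]_0).

Lemma measurable_rV_prod d (A : 'I_d -> set (measurableTypeR R)) :
  (forall i, measurable (A i)) ->
  measurable [set x : 'rV[R]_d | forall i, A i (x ord0 i)].
Proof.
move=> mA; rewrite (_ : mkset _ =
    \big[setI/setT]_(i < d) ((fun x : 'rV[R]_d => x ord0 i) @^-1` A i)).
  apply: bigsetI_measurable => i _.
  by rewrite -[X in measurable X]setTI;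
    exact: (@measurable_rV_coord R d i measurableT _ (mA i)).
rewrite -bigcap_seq; apply/seteqP; split => x /= Ax i; first by move=> _; exact: Ax.
by apply: (Ax i); rewrite /= mem_index_enum.
Qed.

Lemma lebesgue_rV_prod d (A : 'I_d -> set (measurableTypeR R)) :
  (forall i, measurable (A i)) ->
  lebesgue_rV d [set x | forall i, A i (x ord0 i)] =
  (\prod_(i < d) lebesgue_measure (A i))%E.
Proof.
elim: d A => [|d IH] A mA.
  rewrite big_ord0 /= diracE mem_set//= => -[].
  by case.
have mA' : forall i, measurable (A (lift ord0 i)) by [].
rewrite big_ord_recl -(IH _ mA') -product_measure1E//; last first.
  exact: (measurable_rV_prod mA').
rewrite /= /rV_step /pushforward.
congr (_ _); apply/seteqP; split => -[t x] /=.
  move=> Atx; split; first by have := Atx ord0; rewrite cons_rV0.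
  by move=> i; have := Atx (lift ord0 i); rewrite cons_rVS.
by move=> [At Ax] i; case: (unliftP ord0 i) => [j ->|->];
  rewrite ?cons_rV0 ?cons_rVS.
Qed.

End lebesgue_rV.

Section linear_algebra.
Context (R : realType).

Definition mxdot m n (A B : 'M[R]_(m, n)) : R :=
  \sum_i \sum_j A i j * B i j.

(* The Euclidean (Frobenius) norm; the library norm `|A| is the maximum norm. *)
Definition enorm m n (A : 'M[R]_(m, n)) : R := Num.sqrt (mxdot A A).

Definition symm N (A : 'M[R]_N) : Prop := A^T = A.

Definition nonneg_definite N (A : 'M[R]_N) : Prop :=
  symm A /\ forall x : 'rV[R]_N, 0 <= mxdot (x *m A) x.

Definition evec n (i : 'I_n) : 'rV[R]_n := delta_mx ord0 i.

End linear_algebra.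
Arguments evec {R n}.

Section calculus.
Context (R : realType).

Definition iterD (V W : normedModType R) (s : seq V) (f : V -> W) : V -> W :=
  foldr (fun v g => 'D_v g) f s.

(* On a finite-dimensional V this is C^k: all iterated directional derivatives
   of order at most k exist and are continuous. *)
Definition Ck (V W : normedModType R) (k : nat) (f : V -> W) : Prop :=
  forall s : seq V,
    ((size s < k)%N -> forall x v, derivable (iterD s f) x v) /\
    ((size s <= k)%N -> continuous (iterD s f)).

Definition smooth (V W : normedModType R) (f : V -> W) : Prop :=
  forall k, Ck k f.

Definition grad n (f : 'rV[R]_n -> R) (v : 'rV[R]_n) : 'rV[R]_n :=
  \row_l 'D_(evec l) f v.

Definition multi_deriv d m (W : normedModType R) (a : {ffun 'I_d -> 'I_m})
    (f : 'rV[R]_d -> W) : 'rV[R]_d -> W :=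
  foldr (fun i g => iter (a i) (fun g' => 'D_(evec i) g') g) f (enum 'I_d).

Definition strictly_convex n (f : 'rV[R]_n -> R) : Prop :=
  forall (x y : 'rV[R]_n) (t : R), x != y -> 0 < t < 1 ->
    f (t *: x + (1 - t) *: y) < t * f x + (1 - t) * f y.

Definition legendre n (K : 'rV[R]_n -> R) (y : 'rV[R]_n) : R :=
  sup (range (fun x => mxdot x y - K x)).

End calculus.

Section orlicz.
Context (R : realType).

Record young_function (Phi : R -> R) : Prop := {
  young_convex : convex_function (E := R^o) setT Phi ;
  young_even : forall s, Phi (- s) = Phi s ;
  young_ge0 : forall s, 0 <= Phi s ;
  young_eq0 : forall s, Phi s = 0 <-> s = 0 ;
  young_at0 : Phi s / s @[s --> 0^'] --> (0 : R) ;
  young_aty : Phi s / s @[s --> +oo] --> +oo }.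

Record N_function n (K : 'rV[R]_n -> R) : Prop := {
  Nfun_convex : convex_function (E := 'rV[R]_n) setT K ;
  Nfun_even : forall y, K (- y) = K y ;
  Nfun_ge0 : forall y, 0 <= K y ;
  Nfun_young : exists Phi1 Phi2 : R -> R,
    [/\ young_function Phi1, young_function Phi2 &
        forall y, Phi1 (enorm y) <= K y <= Phi2 (enorm y)] }.

Definition Delta2 n (K : 'rV[R]_n -> R) : Prop :=
  exists C : R, forall y, K (2 *: y) <= C * (K y + 1).

Context {dS : measure_display} {S : measurableType dS}.
Implicit Types (mu : set S -> \bar R) (D : set S).

Definition mx_measurable m n D (f : S -> 'M[R]_(m, n)) : Prop :=
  forall i j, measurable_fun D (fun z => f z i j).

Definition orlicz n mu D (K : 'rV[R]_n -> R) (f : S -> 'rV[R]_n) : Prop :=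
  mx_measurable D f /\ (\int[mu]_(z in D) (K (f z))%:E < +oo)%E.

Definition luxemburg n mu D (K : 'rV[R]_n -> R) (f : S -> 'rV[R]_n) : \bar R :=
  ereal_inf [set k%:E | k in [set k : R | 0 < k /\
    (\int[mu]_(z in D) (K (k^-1 *: f z))%:E <= 1)%E]].

Definition mx_integrable m n mu D (f : S -> 'M[R]_(m, n)) : Prop :=
  forall i j, mu.-integrable D (fun z => (f z i j)%:E).

Definition L1_symm N mu D (M : S -> 'M[R]_N) : Prop :=
  (forall z, D z -> symm (M z)) /\ mx_integrable mu D M.

Definition Linfty_symm N mu D (B : S -> 'M[R]_N) : Prop :=
  [/\ forall z, D z -> symm (B z), mx_measurable D B &
      exists C : R, {ae mu, forall z, D z -> enorm (B z) <= C}].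

End orlicz.

(* (L P)_k = \sum_a op_coef a k : \partial^a P, where the multi-indices a range
   over {0, ..., op_order}^d.  A linear form on symmetric matrices is P |-> A : P
   for exactly one symmetric A, so symmetry of the coefficients loses nothing and
   makes [adjoint] below symmetric-valued. *)
Record diffop (R : realType) (d n N : nat) := Diffop {
  op_order : nat ;
  op_coef : {ffun 'I_d -> 'I_op_order.+1} -> 'I_n -> 'M[R]_N ;
  op_coef_symm : forall a k, symm (op_coef a k) }.

Arguments op_order {R d n N} L : rename.
Arguments op_coef {R d n N} L a k : rename.

Section torus.
Context (R : realType) (d : nat).

(* Functions on the torus are functions on R^d restricted to this fundamental
   cell; smooth functions on the torus are smooth periodic functions on R^d. *)
Definition torus : set 'rV[R]_d := [set x | forall i, 0 <= x ord0 i < 1].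

Definition cylinder (T : R) : set (measurableTypeR R * 'rV[R]_d) :=
  `]0, T[ `*` torus.

Definition st_measure : set (measurableTypeR R * 'rV[R]_d) -> \bar R :=
  (lebesgue_measure \x lebesgue_rV R d)%E.

Definition smooth_torus (W : normedModType R) (f : 'rV[R]_d -> W) : Prop :=
  smooth f /\ forall x i, f (x + evec i) = f x.

(* Smooth functions on [0, T] x torus are the restrictions of these. *)
Definition smooth_st (W : normedModType R) (f : R * 'rV[R]_d -> W) : Prop :=
  smooth f /\ forall t x i, f (t, x + evec i) = f (t, x).

Definition test_st (W : normedModType R) (T : R) (f : R * 'rV[R]_d -> W) : Prop :=
  smooth_st f /\ exists a b : R, [/\ 0 < a, b < T &
    forall t x, t < a \/ b < t -> f (t, x) = 0].

Definition dt (W : normedModType R) (f : R * 'rV[R]_d -> W) :=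
  'D_((1, 0) : R * 'rV[R]_d) f.

Definition loc_integrable m n (T : R) (f : R * 'rV[R]_d -> 'M[R]_(m, n)) : Prop :=
  forall a b : R, 0 < a -> b < T ->
    mx_integrable st_measure (`[a, b] `*` torus) f.

Definition weak_dt n (T : R) (w g : R * 'rV[R]_d -> 'rV[R]_n) : Prop :=
  [/\ loc_integrable T w, loc_integrable T g &
    forall phi : R * 'rV[R]_d -> 'rV[R]_n, test_st T phi ->
    (\int[st_measure]_(z in cylinder T)
      (mxdot (w z) (dt phi z) + mxdot (g z) (phi z))%:E = 0)%E].

End torus.
Arguments torus {R} d.
Arguments cylinder {R} d T.
Arguments st_measure {R} d.

Section operator.
Context (R : realType) (d n N : nat) (L : diffop R d n N).

Definition op_apply (P : 'rV[R]_d -> 'M[R]_N) (x : 'rV[R]_d) : 'rV[R]_n :=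
  \row_k \sum_a mxdot (op_coef L a k) (multi_deriv a P x).

Definition adjoint (u : 'rV[R]_d -> 'rV[R]_n) (x : 'rV[R]_d) : 'M[R]_N :=
  \sum_(a : {ffun 'I_d -> 'I_(op_order L).+1}) \sum_k
    ((-1) ^+ (\sum_i (a i : nat))%N * multi_deriv a u x ord0 k) *: op_coef L a k.

Definition weak_adjoint (T : R) (w : R * 'rV[R]_d -> 'rV[R]_n)
    (G : R * 'rV[R]_d -> 'M[R]_N) : Prop :=
  [/\ loc_integrable T w, loc_integrable T G,
      forall z, cylinder d T z -> symm (G z) &
    forall Psi : R * 'rV[R]_d -> 'M[R]_N,
      test_st T Psi -> (forall z, symm (Psi z)) ->
    (\int[st_measure d]_(z in cylinder d T)
      (mxdot (w z) (op_apply (fun x => Psi (z.1, x)) z.2)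
       - mxdot (G z) (Psi z))%:E = 0)%E].

Definition Lambda : set 'M[R]_N :=
  [set A | forall U : {vspace 'M[R]_N}, 1%:M \in U ->
    (forall u, smooth_torus u -> forall x, adjoint u x \in U) -> A \in U].

Definition Lambda_proj (A : 'M[R]_N) : 'M[R]_N :=
  xget 0 [set P | Lambda P /\ forall B, Lambda B -> mxdot (A - P) B = 0].

Definition Lambda_cone : set 'M[R]_N :=
  [set X | symm X /\
    forall P, Lambda P -> nonneg_definite P -> 0 <= mxdot X P].

Definition Lambda_le (B A : 'M[R]_N) : Prop := Lambda_cone (A - B).

(* The weak form of \partial_t B = L^* E, B(T) = 0. *)
Definition constraint (T : R) (E : R * 'rV[R]_d -> 'rV[R]_n)
    (B : R * 'rV[R]_d -> 'M[R]_N) : Prop :=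
  forall Psi : R * 'rV[R]_d -> 'M[R]_N,
    smooth_st Psi -> (forall z, symm (Psi z)) -> (forall x, Psi (0, x) = 0) ->
  (\int[st_measure d]_(z in cylinder d T)
    (mxdot (B z) (dt Psi z)
     + mxdot (E z) (op_apply (fun x => Psi (z.1, x)) z.2))%:E = 0)%E.

End operator.

Section equation.
Context (R : realType) (d n N : nat).
Context (F : 'rV[R]_n -> 'M[R]_N) (L : diffop R d n N).

Definition entropy (v : 'rV[R]_n) : R := 2^-1 * \tr (F v - F 0).

Record standing_assumptions : Prop := {
  F_symm : forall v, symm (F v) ;
  F_C2 : Ck 2 F ;
  entropy_strictly_convex : strictly_convex entropy ;
  entropy_Nfun : N_function entropy ;
  entropy_Delta2 : Delta2 entropy ;
  entropy_legendre_Delta2 : Delta2 (legendre entropy) ;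
  F_Lambda_convex : forall P, Lambda L P -> nonneg_definite P ->
    convex_function (E := 'rV[R]_n) setT (fun v => mxdot (F v) P) ;
  F_Lambda_cone : forall v, Lambda_cone L (F v) ;
  F_deriv_bound : exists C : R, forall v l,
    enorm (Lambda_proj L ('D_(evec l) F v)) <= C * (enorm (grad entropy v) + 1) ;
  F_conservative : forall w : 'rV[R]_d -> 'rV[R]_n, smooth_torus w ->
    (\int[lebesgue_rV R d]_(x in torus d)
      (mxdot (F (grad (legendre entropy) (w x))) (adjoint L w x))%:E = 0)%E }.

(* v |-> v^#, and likewise for fields. *)
Definition sharp (v : 'rV[R]_n) : 'rV[R]_n := grad entropy v.

Context (T : R) (v0 : 'rV[R]_d -> 'rV[R]_n).

Let LK (v : R * 'rV[R]_d -> 'rV[R]_n) : Prop :=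
  orlicz (st_measure d) (cylinder d T) entropy v.
Let LKstar (v : R * 'rV[R]_d -> 'rV[R]_n) : Prop :=
  orlicz (st_measure d) (cylinder d T) (legendre entropy) v.

(* The integral identity shared by weak solutions (M = F v) and subsolutions. *)
Definition weak_identity (v : R * 'rV[R]_d -> 'rV[R]_n)
    (M : R * 'rV[R]_d -> 'M[R]_N) : Prop :=
  forall (E : R * 'rV[R]_d -> 'rV[R]_n) (B : R * 'rV[R]_d -> 'M[R]_N),
    LKstar E -> Linfty_symm (st_measure d) (cylinder d T) B ->
    constraint L T E B ->
  (\int[st_measure d]_(z in cylinder d T)
    (mxdot (v z - v0 z.2) (E z) + mxdot (M z) (B z))%:E = 0)%E.

Definition weak_solution (v : R * 'rV[R]_d -> 'rV[R]_n) : Prop :=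
  LK v /\ weak_identity v (F \o v).

Definition subsolution (v : R * 'rV[R]_d -> 'rV[R]_n)
    (M : R * 'rV[R]_d -> 'M[R]_N) : Prop :=
  [/\ LK v, L1_symm (st_measure d) (cylinder d T) M,
      {ae (st_measure d), forall z, cylinder d T z -> Lambda_le L (F (v z)) (M z)} &
      weak_identity v M].

Definition is_weight (h : R -> R) : Prop :=
  measurable_fun `[0, T] h /\
  exists c C : R, 0 < c /\ forall t, 0 <= t <= T -> c <= h t <= C.

Definition weight_primitive (h : R -> R) (t : R) : R :=
  \int[lebesgue_measure]_(s in `[t, T]) h s.

(* w(0, .) = w0, where w(0, .) is read off the representative of w in
   C([0, T); L_{K^*}(torus)). *)
Definition initial_value (w : R * 'rV[R]_d -> 'rV[R]_n)
    (w0 : 'rV[R]_d -> 'rV[R]_n) : Prop :=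
  exists wc : R -> 'rV[R]_d -> 'rV[R]_n,
  [/\ {ae (st_measure d), forall z, cylinder d T z -> wc z.1 z.2 = w z},
      forall t, 0 <= t < T ->
        orlicz (lebesgue_rV R d) (torus d) (legendre entropy) (wc t),
      forall t, 0 <= t < T ->
        luxemburg (lebesgue_rV R d) (torus d) (legendre entropy)
          (fun x => wc s x - wc t x) @[s --> within `[0, T[ (nbhs t)] --> 0%E &
      {ae (lebesgue_rV R d), forall x, torus d x -> wc 0 x = w0 x}].

Record strong_solution (h : R -> R) (v : R * 'rV[R]_d -> 'rV[R]_n) : Prop := {
  strong_weak : weak_solution v ;
  strong_dt : exists2 g, LKstar g &
    weak_dt T (fun z => weight_primitive h z.1 *: sharp (v z)) g ;
  strong_eq : exists (wt : R * 'rV[R]_d -> 'rV[R]_n)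
                     (Lw : R * 'rV[R]_d -> 'M[R]_N),
    [/\ weak_dt T (sharp \o v) wt,
        weak_adjoint L T (sharp \o v) Lw,
        Linfty_symm (st_measure d) (cylinder d T)
          (fun z => weight_primitive h z.1 *: Lw z) &
        {ae (st_measure d), forall z, cylinder d T z -> forall l,
          wt z ord0 l
          + mxdot (Lw z) ('D_(evec l) F (grad (legendre entropy) (sharp (v z))))
          = 0}] ;
  strong_init : initial_value (sharp \o v) (sharp \o v0) }.

Definition total_entropy (v : R * 'rV[R]_d -> 'rV[R]_n) (t : R) : \bar R :=
  \int[lebesgue_rV R d]_(x in torus d) (entropy (v (t, x)))%:E.

Definition sub_total_entropy (M : R * 'rV[R]_d -> 'M[R]_N) (t : R) : \bar R :=
  \int[lebesgue_rV R d]_(x in torus d)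
    (2^-1 * mxdot (M (t, x) - F 0) 1%:M)%:E.

End equation.

(* Main.v *)
Require Import Defs.
From HB Require Import structures.
From mathcomp Require Import all_boot all_order all_algebra.
From mathcomp Require Import all_classical all_reals all_analysis.
From mathcomp Require Import measurable_realfun.
From mathcomp Require Import ring lra.
Set Implicit Arguments.
Unset Strict Implicit.
Unset Printing Implicit Defensive.
Import Order.TTheory GRing.Theory Num.Theory.
Import numFieldNormedType.Exports.
Local Open Scope classical_set_scope.
Local Open Scope ring_scope.

(* [iterD] is also the name of a lemma on iterated functions. *)
Local Notation iterD := Defs.iterD.

(** Write [K] for the entropy, [w = grad K (v)] for the dual field of the strong
solution and [G] for the value of [L^*] at [w].  For a weight [H] of time that
vanishes near [T], the pair [E = d_t (H w)], [B = H G] satisfies the constraint,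
so it can be inserted in the weak identities of [v] and of the subsolution
[(u, M)].  Subtracting them gives
  [int (u - v) . E + (M - F v) : B = 0].
Put [rho = - H'] and [P = (rho / 2) I + B].  As [w_l = I : d_l F(v) / 2], the
equation of the strong solution says exactly that [E_l = - P : d_l F(v)].  If [P]
is nonnegative, convexity of [F : P] and the order relation [F u <= M] give
[(M - F v) : P >= - (u - v) . E] almost everywhere, and after integration
  [int rho(t) (K~(t) - K(t)) dt >= 0].
When [K~ <= K] on [(0, t1)] with strict inequality on [(t0, t1)], this is
impossible for a weight with [rho > 0] on [(0, t1)] and [rho = 0] afterwards.

Such a weight exists because [G] is bounded on [(0, t1)] when [t1 < T]: a weight
that decays fast enough has [|B| <= rho / 2], hence [P >= 0].  The case [t1 = T]
follows by shrinking the interval.  The weight is [decay], a flat function times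
an exponential.

The steps that need work are the following.
- The pair satisfies the constraint ([weighted_constraint]).  The weak
  derivative and the weak adjoint are tested with [L (theta Psi)] and
  [d_t (theta Psi)], where [theta] is [H] cut off near [t = 0].  Removing the cutoff
  costs nothing, since [Psi] vanishes linearly at [t = 0] and [B] is bounded.
- [P] takes values in [Lambda] ([weak_adjoint_Lambda]).  A symmetric matrix [A]
  orthogonal to [Lambda] satisfies [L (phi A) = 0] for all [phi], so [G : A]
  integrates to zero against all test functions ([fundamental_lemma]).
- [E] lies in the dual Orlicz space ([legendre_multiplier]).  The gradient
  inequality for [F : P] together with [P <= 2^k I] bounds the conjugate of [K]
  at [E] by a multiple of [K v + 1].
- The gradient of the conjugate of [K] inverts the gradient of [K]
  ([grad_legendre_grad]), so the coefficients in the equation are [d_l F(v)]. *)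

(** * The Frobenius product *)

Section frobenius.
Context (R : realType).

Section bilinear.
Context (m n : nat).
Implicit Types (A B C : 'M[R]_(m, n)).

Lemma mxdotC A B : mxdot A B = mxdot B A.
Proof. by apply: eq_bigr => i _; apply: eq_bigr => j _; rewrite mulrC. Qed.

Lemma mxdotDl A B C : mxdot (A + B) C = mxdot A C + mxdot B C.
Proof.
rewrite /mxdot -big_split; apply: eq_bigr => i _ /=.
by rewrite -big_split; apply: eq_bigr => j _; rewrite mxE mulrDl.
Qed.

Lemma mxdotZl (a : R) A B : mxdot (a *: A) B = a * mxdot A B.
Proof.
rewrite /mxdot mulr_sumr; apply: eq_bigr => i _.
by rewrite mulr_sumr; apply: eq_bigr => j _; rewrite mxE mulrA.
Qed.

Lemma mxdotNl A B : mxdot (- A) B = - mxdot A B.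
Proof. by rewrite -scaleN1r mxdotZl mulN1r. Qed.

Lemma mxdotBl A B C : mxdot (A - B) C = mxdot A C - mxdot B C.
Proof. by rewrite mxdotDl mxdotNl. Qed.

Lemma mxdotDr A B C : mxdot C (A + B) = mxdot C A + mxdot C B.
Proof. by rewrite mxdotC mxdotDl !(mxdotC C). Qed.

Lemma mxdotZr (a : R) A B : mxdot A (a *: B) = a * mxdot A B.
Proof. by rewrite mxdotC mxdotZl mxdotC. Qed.

Lemma mxdotNr A B : mxdot A (- B) = - mxdot A B.
Proof. by rewrite mxdotC mxdotNl mxdotC. Qed.

Lemma mxdotBr A B C : mxdot C (A - B) = mxdot C A - mxdot C B.
Proof. by rewrite mxdotDr mxdotNr. Qed.

Lemma mxdot0l A : mxdot 0 A = 0.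
Proof. by rewrite -(scale0r (0 : 'M[R]_(m, n))) mxdotZl mul0r. Qed.

Lemma mxdot0r A : mxdot A 0 = 0.
Proof. by rewrite mxdotC mxdot0l. Qed.

Lemma mxdot_sumr (I : Type) (r : seq I) (P : pred I) (f : I -> 'M[R]_(m, n)) A :
  mxdot A (\sum_(i <- r | P i) f i) = \sum_(i <- r | P i) mxdot A (f i).
Proof.
by apply: (big_morph (mxdot A)) => [B C|]; [exact: mxdotDr|exact: mxdot0r].
Qed.

Lemma mxdot_delta A i j : mxdot A (delta_mx i j) = A i j.
Proof.
rewrite /mxdot (bigD1 i) //= (bigD1 j) //= mxE !eqxx mulr1.
rewrite big1 ?addr0 => [|k kj]; last by rewrite mxE (negPf kj) andbF mulr0.
rewrite big1 ?addr0 // => k ki; apply: big1 => l _.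
by rewrite mxE (negPf ki) mulr0.
Qed.

Lemma mxdot_ge0 A : 0 <= mxdot A A.
Proof. by apply: sumr_ge0 => i _; apply: sumr_ge0 => j _; rewrite -expr2 sqr_ge0. Qed.

Lemma entry_sqr_le A i j : A i j ^+ 2 <= mxdot A A.
Proof.
rewrite /mxdot (bigD1 i) //= (bigD1 j) //= -expr2 -addrA lerDl addr_ge0 //.
  by apply: sumr_ge0 => k _; rewrite -expr2 sqr_ge0.
by apply: sumr_ge0 => k _; apply: sumr_ge0 => l _; rewrite -expr2 sqr_ge0.
Qed.

Lemma mxdot_eq0 A : mxdot A A = 0 -> A = 0.
Proof.
move=> A0; apply/matrixP => i j; rewrite mxE; apply/eqP.
by rewrite -sqrf_eq0 eq_le sqr_ge0 andbT -A0 entry_sqr_le.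
Qed.

Lemma enorm_ge0 A : 0 <= enorm A.
Proof. exact: sqrtr_ge0. Qed.

Lemma entry_le_enorm A i j : `|A i j| <= enorm A.
Proof. by rewrite -sqrtr_sqr ler_wsqrtr // entry_sqr_le. Qed.

Lemma mxdot_enorm A B : `|mxdot A B| <= enorm A * enorm B.
Proof.
rewrite -sqrtrM ?mxdot_ge0 // -sqrtr_sqr ler_wsqrtr //.
have := mxdot_ge0 (mxdot B B *: A - mxdot A B *: B).
rewrite mxdotBl !mxdotBr !mxdotZl !mxdotZr (mxdotC B A).
have [B0 _|B0 H] := eqVneq (mxdot B B) 0.
  by rewrite (mxdot_eq0 B0) !mxdot0r expr2 !mulr0.
have B_gt0 : 0 < mxdot B B by rewrite lt_def B0 mxdot_ge0.
by rewrite -subr_ge0 -(pmulr_rge0 _ B_gt0); move: H; congr (is_true (0 <= _)); ring.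
Qed.

End bilinear.

Lemma mxdot1r n (A : 'M[R]_n) : mxdot A 1%:M = \tr A.
Proof.
rewrite /mxdot /mxtrace; apply: eq_bigr => i _; rewrite (bigD1 i) //= big1 ?addr0.
  by rewrite mxE eqxx mulr1.
by move=> j ji; rewrite mxE eq_sym (negPf ji) mulr0.
Qed.

Lemma mxdot_tr m n (A B : 'M[R]_(m, n)) : mxdot A^T B^T = mxdot A B.
Proof.
rewrite /mxdot exchange_big; apply: eq_bigr => i _; apply: eq_bigr => j _.
by rewrite !mxE.
Qed.

Lemma rv_mxdotE n (x y : 'rV[R]_n) : mxdot x y = \sum_l x ord0 l * y ord0 l.
Proof. by rewrite /mxdot big_ord1. Qed.

Lemma symmD n (A B : 'M[R]_n) : symm A -> symm B -> symm (A + B).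
Proof. by rewrite /symm linearD /= => -> ->. Qed.

Lemma symmZ n (a : R) (A : 'M[R]_n) : symm A -> symm (a *: A).
Proof. by rewrite /symm linearZ /= => ->. Qed.

Lemma symm1 n : symm (1%:M : 'M[R]_n).
Proof. exact: trmx1. Qed.

(** The quadratic form of [B] is the Frobenius product of [B] with the rank one
matrix [x^T x], whose norm is [|x|^2]. *)
Lemma nonneg_definite_shift n (B : 'M[R]_n) (c : R) :
  symm B -> enorm B <= c -> nonneg_definite (c *: 1%:M + B).
Proof.
move=> sB Bc; split; first by apply: symmD => //; apply: symmZ; exact: symm1.
move=> x; rewrite mulmxDr -scalemxAr mulmx1 mxdotDl mxdotZl.
have -> : mxdot (x *m B) x = mxdot B (x^T *m x).
  rewrite rv_mxdotE /mxdot exchange_big /=; apply: eq_bigr => j _.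
  rewrite mxE mulr_suml; apply: eq_bigr => i _.
  by rewrite !mxE big_ord1 !mxE; ring.
have xx : enorm (x^T *m x) = mxdot x x.
  rewrite -[RHS]ger0_norm ?mxdot_ge0 // -sqrtr_sqr; congr Num.sqrt.
  rewrite rv_mxdotE expr2 mulr_suml; apply: eq_bigr => i _.
  rewrite mulr_sumr; apply: eq_bigr => j _.
  by rewrite !mxE big_ord1 !mxE; ring.
have := le_trans (ler_norm _) (mxdot_enorm (- B) (x^T *m x)).
rewrite mxdotNl xx => H; rewrite -subr_ge0 in H.
have : enorm (- B) = enorm B by rewrite /enorm mxdotNl mxdotNr opprK.
move=> eB; rewrite eB in H.
have := ler_wpM2r (mxdot_ge0 x) Bc; lra.
Qed.

End frobenius.

(** * Smooth functions *)

Section smooth_closure.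
Context (R : realType) (V W : normedModType R).

(** Smoothness is proved coinductively: a class of functions stable under
directional derivatives consists of smooth functions. *)
Lemma smooth_closed (C : set (V -> W)) :
  (forall f, C f -> continuous f /\
     forall v, (forall x, derivable f x v) /\ C ('D_v f)) ->
  forall f, C f -> smooth f.
Proof.
move=> HC f Cf k s; have Cs : C (iterD s f).
  by elim: s => //= v s Cs; have [_ /(_ v)[]] := HC _ Cs.
by have [cs ds] := HC _ Cs; split=> // _ x v; have [+ _] := ds v; apply.
Qed.

Lemma smooth_continuous (f : V -> W) : smooth f -> continuous f.
Proof. by move=> /(_ 0%N [::])[_ /(_ isT)]. Qed.

Lemma smooth_derivable (f : V -> W) x v : smooth f -> derivable f x v.
Proof. by move=> /(_ 1%N [::])[/(_ isT) + _]; exact. Qed.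

Lemma smooth_iterD (f : V -> W) s : smooth f -> smooth (iterD s f).
Proof.
move=> sf k s'; have -> : iterD s' (iterD s f) = iterD (s' ++ s) f.
  by rewrite /Defs.iterD foldr_cat.
have [h1 h2] := sf (size (s' ++ s)).+1 (s' ++ s).
by split=> _; [apply: h1|apply: h2; exact: leqnSn].
Qed.

Lemma smooth_derive (f : V -> W) v : smooth f -> smooth ('D_v f).
Proof. exact: (@smooth_iterD f [:: v]). Qed.

Lemma derive_translate (f : V -> W) v c x :
  'D_v (fun y => f (y + c)) x = 'D_v f (x + c).
Proof.
rewrite /derive; set g1 := fun h => h^-1 *: _; set g2 := fun h => h^-1 *: _.
by have -> : g1 = g2 by apply/funext => h; rewrite /g1 /g2 /= addrA.
Qed.

Lemma iterD_translate (f : V -> W) s c :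
  iterD s (fun y => f (y + c)) = fun x => iterD s f (x + c).
Proof.
by elim: s => //= v s ->; apply/funext => x; rewrite derive_translate.
Qed.

Lemma smooth_eq (f g : V -> W) : f =1 g -> smooth f -> smooth g.
Proof. by move=> /funext ->. Qed.

End smooth_closure.
Arguments smooth_derivable {R V W f} x v sf.
Arguments smooth_derive {R V W f} v sf.

Section smooth_algebra.
Context (R : realType) (V : normedModType R).
Implicit Types (f g : V -> R) (v : V).

(** The algebra generated by [S], through which Leibniz' rule is proved at all
orders at once: a derivation mapping [S] into the algebra preserves it. *)
Inductive algebra_span (S : set (V -> R)) : (V -> R) -> Prop :=
| span_gen f : S f -> algebra_span S f
| span_add f g : algebra_span S f -> algebra_span S g ->
    algebra_span S (fun x => f x + g x)
| span_mul f g : algebra_span S f -> algebra_span S g ->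
    algebra_span S (fun x => f x * g x).

Lemma smooth_span (S : set (V -> R)) :
  (forall f, S f -> continuous f /\
     forall v, (forall x, derivable f x v) /\ algebra_span S ('D_v f)) ->
  forall f, algebra_span S f -> smooth f.
Proof.
move=> HS; apply: smooth_closed => f; elim=> {f} [f /HS[cf df]|f g|f g].
- by split=> // v; have [] := df v.
- move=> Sf [cf df] Sg [cg dg]; split=> [x|v]; first by apply: continuousD; [exact: cf|exact: cg].
  have [df1 df2] := df v; have [dg1 dg2] := dg v.
  split=> [x|]; first exact: derivableD.
  rewrite (_ : 'D_v _ = fun x => 'D_v f x + 'D_v g x); first exact: span_add.
  by apply/funext => x; rewrite (deriveD (df1 x) (dg1 x)).
- move=> Sf [cf df] Sg [cg dg]; split=> [x|v]; first by apply: continuousM; [exact: cf|exact: cg].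
  have [df1 df2] := df v; have [dg1 dg2] := dg v.
  split=> [x|]; first exact: derivableM.
  rewrite (_ : 'D_v _ = fun x => f x * 'D_v g x + g x * 'D_v f x).
    by apply: span_add; apply: span_mul.
  by apply/funext => x; rewrite (deriveM (df1 x) (dg1 x)).
Qed.

Lemma smooth_span_smooth f : algebra_span (@smooth R V R) f -> smooth f.
Proof.
apply: smooth_span => g sg; split; first exact: smooth_continuous.
by move=> v; split=> [x|]; [exact: smooth_derivable|
  apply: span_gen; exact: smooth_derive].
Qed.

Lemma smoothD f g : smooth f -> smooth g -> smooth (fun x => f x + g x).
Proof. by move=> sf sg; apply: smooth_span_smooth; apply: span_add; apply: span_gen. Qed.

Lemma smoothM f g : smooth f -> smooth g -> smooth (fun x => f x * g x).
Proof. by move=> sf sg; apply: smooth_span_smooth; apply: span_mul; apply: span_gen. Qed.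

Lemma smooth_cst (c : R) : smooth (fun _ : V => c).
Proof.
apply: (@smooth_closed _ _ _ (range (fun c : R => cst c))); last by exists c.
move=> _ [a _ <-]; split; first exact: cst_continuous.
move=> v; split=> [x|]; first exact: derivable_cst.
by exists 0 => //; apply/funext => x; rewrite derive_cst.
Qed.

Lemma smooth_sum (I : Type) (r : seq I) (P : pred I) (F : I -> V -> R) :
  (forall i, P i -> smooth (F i)) -> smooth (fun x => \sum_(i <- r | P i) F i x).
Proof.
move=> sF; elim: r => [|i r IH].
  by apply: (@smooth_eq _ _ _ (fun=> 0)) (smooth_cst 0) => x; rewrite big_nil.
case Pi : (P i).
  apply: smooth_eq (smoothD (sF i Pi) IH) => x.
  by rewrite big_cons Pi.
by apply: smooth_eq IH => x; rewrite big_cons Pi.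
Qed.

Lemma smooth_prod (I : Type) (r : seq I) (P : pred I) (F : I -> V -> R) :
  (forall i, P i -> smooth (F i)) -> smooth (fun x => \prod_(i <- r | P i) F i x).
Proof.
move=> sF; elim: r => [|i r IH].
  by apply: (@smooth_eq R V R (fun=> 1 : R)) (smooth_cst 1) => x; rewrite big_nil.
case Pi : (P i).
  apply: smooth_eq (smoothM (sF i Pi) IH) => x.
  by rewrite big_cons Pi.
by apply: smooth_eq IH => x; rewrite big_cons Pi.
Qed.

Lemma derive_linear (f : V -> R) (fD : forall x y, f (x + y) = f x + f y)
  (fZ : forall a x, f (a *: x) = a * f x) v x : is_derive x v f (f v).
Proof.
have E : (fun h => h^-1 *: ((f \o shift x) (h *: v) - f x)) @ 0^' --> f v.
  apply: cvg_near_cst; near=> h.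
  rewrite /= fD fZ addrK [_ *: _]mulrA mulVf ?mul1r //.
  by near: h; exact: nbhs_dnbhs_neq.
by split; [apply/cvg_ex; exists (f v)|exact: cvg_lim].
Unshelve. all: by end_near. Qed.

Lemma smooth_linear (f : V -> R) (fD : forall x y, f (x + y) = f x + f y)
  (fZ : forall a x, f (a *: x) = a * f x) : continuous f -> smooth f.
Proof.
move=> cf.
apply: (@smooth_span [set g | g = f \/ smooth g]); last by apply: span_gen; left.
move=> g [->|sg].
  split=> // v; split=> [x|]; first by have [] := derive_linear fD fZ v x.
  apply: span_gen; right; apply: smooth_eq (smooth_cst (f v)) => x.
  by have [_ ->] := derive_linear fD fZ v x.
split; first exact: smooth_continuous.
by move=> v; split=> [x|]; [exact: smooth_derivable|
  apply: span_gen; right; exact: smooth_derive].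
Qed.

Lemma derive_comp (g : R -> R) f v x : derivable f x v -> derivable g (f x) 1 ->
  is_derive x v (fun y => g (f y)) ('D_1 g (f x) * 'D_v f x).
Proof.
move=> /derivable1P df dg.
have fx : (fun h : R => f (h *: v + x)) 0 = f x by rewrite /= scale0r add0r.
have dg' : derivable g ((fun h : R => f (h *: v + x)) 0) 1 by rewrite fx.
have E (k : V -> R) : 'D_v k x = 'D_1 (fun h : R => k (h *: v + x)) 0.
  rewrite /derive; set g1 := fun h => h^-1 *: _; set g2 := fun h => h^-1 *: _.
  suff -> : g1 = g2 by [].
  by apply/funext => h; rewrite /g1 /g2 /= addr0 scale0r add0r [_%:A]mulr1.
split.
  apply/derivable1P.
  by have /derivable1_diffP := differentiable_comp (proj1 (derivable1_diffP _ _) df)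
    (proj1 (derivable1_diffP _ _) dg').
by rewrite (E (fun y => g (f y))) -!derive1E (derive1_comp df dg') !derive1E fx -E.
Qed.

Lemma smooth_comp (g : R -> R) f : smooth g -> smooth f -> smooth (fun x => g (f x)).
Proof.
move=> sg sf.
set S : set (V -> R) := [set k | smooth k \/
  exists2 g0 : R -> R, smooth g0 & k = fun x => g0 (f x)].
apply: (@smooth_span S); last by apply: span_gen; right; exists g.
move=> k [sk|[g0 sg0 ->]].
  split; first exact: smooth_continuous.
  by move=> v; split=> [x|]; [exact: smooth_derivable|
    apply: span_gen; left; exact: smooth_derive].
split=> [x|v].
  by apply: (@continuous_comp _ _ _ f g0); exact: smooth_continuous.
have H x := derive_comp (smooth_derivable x v sf) (smooth_derivable (f x) 1 sg0).
split=> [x|]; first by have [] := H x.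
rewrite (_ : 'D_v _ = fun x => 'D_1 g0 (f x) * 'D_v f x).
  apply: span_mul; apply: span_gen; [right|left].
    by exists ('D_1 g0) => //; exact: smooth_derive.
  exact: smooth_derive.
by apply/funext => x; have [_ ->] := H x.
Qed.

End smooth_algebra.

Section schwarz.
Context (R : realType) (V : normedModType R).
Implicit Types (f : V -> R) (u v x : V).

Lemma derive_along f x v (t : R) : derivable f (x + t *: v) v ->
  is_derive t 1 (fun s : R => f (x + s *: v)) ('D_v f (x + t *: v)).
Proof.
move=> df.
have E : (fun h : R => h^-1 *: (((fun s => f (x + s *: v)) \o shift t) (h *: 1)
    - f (x + t *: v))) =
  (fun h => h^-1 *: ((f \o shift (x + t *: v)) (h *: v) - f (x + t *: v))).
  apply/funext => h /=; congr (_ *: (f _ - _)).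
  by rewrite [_%:A]mulr1 scalerDl addrCA.
by split; rewrite /derivable /derive E.
Qed.

Lemma increment_along f x v (s : R) : 0 < s -> (forall y, derivable f y v) ->
  exists2 t, 0 < t < s & f (x + s *: v) - f x = s * 'D_v f (x + t *: v).
Proof.
move=> s0 df.
have H (t : R) : is_derive t 1 (fun s : R => f (x + s *: v)) ('D_v f (x + t *: v)).
  exact: derive_along.
have cts : {within `[0, s], continuous (fun s : R => f (x + s *: v))}.
  apply: derivable_within_continuous => y _; apply: ex_derive.
have [t ts E] := MVT s0 (fun t _ => H t) cts.
exists t; first by move: ts; rewrite in_itv.
by move: E; rewrite scale0r addr0 subr0 mulrC.
Qed.

(** The left hand side is symmetric under exchange of [u] and [v], so the same
number is a value of either mixed derivative at some point near [x]. *)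
Lemma second_difference f x u v (s : R) : 0 < s -> smooth f ->
  exists a b : R, [/\ 0 < a < s, 0 < b < s &
   f (x + s *: u + s *: v) - f (x + s *: u) - (f (x + s *: v) - f x) =
   s ^+ 2 * 'D_v ('D_u f) (x + a *: u + b *: v)].
Proof.
move=> s0 sf; pose g y := f (y + s *: v) - f y.
have dg y : is_derive y u g ('D_u f (y + s *: v) - 'D_u f y).
  have df1 : derivable (fun y => f (y + s *: v)) y u.
    rewrite /derivable (_ : (fun h => _) =
      (fun h => h^-1 *: ((f \o shift (y + s *: v)) (h *: u) - f (y + s *: v)))).
      exact: smooth_derivable.
    by apply/funext => h /=; rewrite addrA.
  have df2 := smooth_derivable y u sf.
  split; first exact: (derivableB df1 df2).
  by rewrite -(derive_translate f u (s *: v)) -(deriveB df1 df2).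
have [a as0 Ea] := @increment_along g x u s s0 (fun y => @ex_derive _ _ _ _ _ _ _ (dg y)).
have sDf := smooth_derive u sf.
have [b bs Eb] := @increment_along ('D_u f) (x + a *: u) v s s0
  (fun y => smooth_derivable y v sDf).
exists a, b; split=> //.
have := Ea; rewrite /g (@derive_val _ _ _ _ _ _ _ (dg _)) Eb => ->.
by rewrite expr2 mulrA.
Qed.

Lemma schwarz f x u v : smooth f -> 'D_u ('D_v f) x = 'D_v ('D_u f) x.
Proof.
move=> sf; apply/eqP; rewrite -subr_eq0 -normr_le0; apply/ler_addgt0Pl => e e0.
have cA : continuous ('D_u ('D_v f)).
  exact/smooth_continuous/smooth_derive/smooth_derive.
have cB : continuous ('D_v ('D_u f)).
  exact/smooth_continuous/smooth_derive/smooth_derive.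
have e2 : 0 < e / 2 by rewrite divr_gt0.
have [r r0 Hr] : exists2 r : R, 0 < r & forall y, `|x - y| < r ->
   `|'D_u ('D_v f) x - 'D_u ('D_v f) y| < e / 2 /\
   `|'D_v ('D_u f) x - 'D_v ('D_u f) y| < e / 2.
  have /cvgrPdist_lt /(_ _ e2) /nbhs_ballP[r1 r10 H1] := cA x.
  have /cvgrPdist_lt /(_ _ e2) /nbhs_ballP[r2 r20 H2] := cB x.
  exists (Num.min r1 r2); first by rewrite lt_min r10.
  move=> y; rewrite lt_min => /andP[y1 y2]; split.
    by apply: H1; rewrite -ball_normE.
  by apply: H2; rewrite -ball_normE.
pose s := r / (1 + `|u| + `|v|).
have D0 : 0 < 1 + `|u| + `|v| by rewrite ltr_wpDr // ltr_wpDr.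
have s0 : 0 < s by rewrite divr_gt0.
have close a b : 0 < a < s -> 0 < b < s -> `|x - (x + a *: u + b *: v)| < r.
  move=> /andP[a0 a1] /andP[b0 b1].
  rewrite -addrA opprD addrA subrr sub0r normrN.
  rewrite (le_lt_trans (ler_normD _ _)) // !normrZ !gtr0_norm //.
  have Es : s * (1 + `|u| + `|v|) = r by rewrite divfK // gt_eqF.
  have := ler_wpM2r (normr_ge0 u) (ltW a1); have := ler_wpM2r (normr_ge0 v) (ltW b1).
  by rewrite -Es !mulrDr mulr1; lra.
have [a [b [aP bP E1]]] := @second_difference f x u v s s0 sf.
have [c [d [cP dP E2]]] := @second_difference f x v u s s0 sf.
have := close _ _ aP bP => /Hr[_ H1].
have := close _ _ dP cP; rewrite [x + _ + _]addrAC => /Hr[H2 _].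
have D12 : f (x + s *: u + s *: v) - f (x + s *: u) - (f (x + s *: v) - f x) =
    f (x + s *: v + s *: u) - f (x + s *: v) - (f (x + s *: u) - f x).
  by rewrite (addrAC x (s *: v)); ring.
have s2 : s ^+ 2 != 0 by rewrite expf_neq0 // gt_eqF.
rewrite E1 E2 in D12; have {D12}E := mulfI s2 D12.
rewrite E in H1; rewrite addr0; move: H1 H2 {E E1 E2 s2}.
move: ('D_u ('D_v f) x) ('D_v ('D_u f) x) ('D_u ('D_v f) _) => p q m H1 H2.
have := ler_distD m p q; rewrite (distrC m q); lra.
Qed.

Lemma iterD_derive f s v : smooth f -> iterD s ('D_v f) = 'D_v (iterD s f).
Proof.
move=> sf; elim: s => //= u s ->; apply/funext => x.
by rewrite schwarz //; exact: smooth_iterD.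
Qed.

End schwarz.

Section smooth_matrix.
Context (R : realType) (V : normedModType R) (m n : nat).
Implicit Types (M : V -> 'M[R]_(m, n)).

Lemma continuous_mx (T : topologicalType) (M : T -> 'M[R]_(m, n)) :
  (forall i j, continuous (fun x => M x i j)) -> continuous M.
Proof.
move=> cM x; apply/cvgrPdist_le => /= e e0; near=> y.
rewrite /Num.Def.normr/= mx_normrE (bigmax_le _ (ltW e0))//= => i _.
rewrite !mxE/=; move: i; near: y; apply: filter_forall => /= i.
by have /cvgrPdist_le := cM i.1 i.2 x; exact.
Unshelve. all: by end_near. Qed.

Lemma continuous_entry (T : topologicalType) (M : T -> 'M[R]_(m, n)) i j :
  continuous M -> continuous (fun x => M x i j).
Proof.
move=> cM x; apply: (@continuous_comp _ _ _ M (fun A : 'M[R]_(m, n) => A i j)).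
  exact: cM.
exact: coord_continuous.
Qed.

Lemma smooth_entry M i j : smooth M -> smooth (fun x => M x i j).
Proof.
move=> sM; apply: (@smooth_closed _ _ _
  [set g | exists2 M : V -> 'M[R]_(m, n), smooth M & g = (fun x => M x i j)]).
  move=> _ [M' sM' ->]; split.
    exact/continuous_entry/smooth_continuous.
  have dM' x v := smooth_derivable x v sM'.
  move=> v; split=> [x|]; first by have /derivable_mxP := dM' x v; exact.
  exists ('D_v M'); first exact: smooth_derive.
  by apply/funext => x; rewrite derive_mx // mxE.
by exists M.
Qed.

Lemma smooth_mx M : (forall i j, smooth (fun x => M x i j)) -> smooth M.
Proof.
move=> sM; apply: (@smooth_closed _ _ _
  [set M : V -> 'M[R]_(m, n) | forall i j, smooth (fun x => M x i j)]) => //.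
move=> {sM}M sM; have dM x v : derivable M x v.
  by apply/derivable_mxP => i j; exact: smooth_derivable.
split; first by apply: continuous_mx => i j; exact: smooth_continuous.
move=> v; split=> [x|i j]; first exact: dM.
apply: smooth_eq (smooth_derive v (sM i j)) => x.
by rewrite derive_mx // mxE.
Qed.

Lemma derive_entry M v x i j : smooth M ->
  ('D_v M x) i j = 'D_v (fun x => M x i j) x.
Proof. by move=> sM; rewrite derive_mx ?mxE //; exact: smooth_derivable. Qed.

Lemma iterD_entry M s x i j : smooth M ->
  (iterD s M x) i j = iterD s (fun x => M x i j) x.
Proof.
move=> sM; elim: s x => //= v s IH x.
rewrite derive_entry; last exact: smooth_iterD.
by congr ('D_v _ x); apply/funext => y; exact: IH.
Qed.

Lemma smooth_scale (f : V -> R) M : smooth f -> smooth M ->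
  smooth (fun x => f x *: M x).
Proof.
move=> sf sM; apply: smooth_mx => i j.
by apply: smooth_eq (smoothM sf (smooth_entry i j sM)) => x; rewrite mxE.
Qed.

Lemma smooth_cst_mx (A : 'M[R]_(m, n)) : smooth (fun _ : V => A).
Proof. by apply: smooth_mx => i j; exact: smooth_cst. Qed.

Lemma is_derive_fsum (I : Type) (r : seq I) (F : I -> V -> R) (dF : I -> R) x v :
  (forall i, is_derive x v (F i) (dF i)) ->
  is_derive x v (fun y => \sum_(i <- r) F i y) (\sum_(i <- r) dF i).
Proof.
move=> HF; elim: r => [|i r IH].
  rewrite big_nil (_ : (fun y => _) = cst 0).
    exact: is_derive_cst.
  by apply/funext => y; rewrite big_nil.
rewrite big_cons (_ : (fun y => _) = (fun y => F i y + \sum_(j <- r) F j y)).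
  have [d1 e1] := HF i; have [d2 e2] := IH.
  by split; [exact: derivableD|rewrite (deriveD d1 d2) e1 e2].
by apply/funext => y; rewrite big_cons.
Qed.

Lemma smooth_mxdot (A : 'M[R]_(m, n)) M : smooth M -> smooth (fun x => mxdot A (M x)).
Proof.
move=> sM; apply: smooth_sum => i _; apply: smooth_sum => j _.
by apply: smoothM; [exact: smooth_cst|exact: smooth_entry].
Qed.

Lemma derive_mxdotr (A : 'M[R]_(m, n)) M x v : derivable M x v ->
  is_derive x v (fun y => mxdot A (M y)) (mxdot A ('D_v M x)).
Proof.
move=> dM; apply: is_derive_fsum => i; apply: is_derive_fsum => j.
have d : derivable (fun y => M y i j) x v by move/derivable_mxP : dM => /(_ i j).
split; first exact: (derivableM (derivable_cst _ _ _) d).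
by rewrite (deriveMl (A i j) d) derive_mx // mxE.
Qed.

End smooth_matrix.
Arguments continuous_entry {R m n T M} i j cM.

(** * A smooth cutoff on the line *)

Section real_smooth.
Context (R : realType).
Implicit Types (f g : R -> R).

Lemma is_derive_dir f (x v df : R) : is_derive x 1 f df -> is_derive x v f (v * df).
Proof.
move=> [d1 <-].
have di : derivable (id : R -> R) x v by exact: derivable_id.
have := derive_comp di d1.
by rewrite derive_id mulrC.
Qed.

Lemma smooth_real (S : set (R -> R)) :
  (forall f, S f -> exists2 f', algebra_span (S `|` @smooth R R R) f' &
     forall x : R, is_derive x 1 f (f' x)) ->
  forall f, S f -> smooth f.
Proof.
move=> HS f Sf; apply: (@smooth_span R R (S `|` @smooth R R R)); last first.
  by apply: span_gen; left.
move=> g [Sg|sg]; last first.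
  split; first exact: smooth_continuous.
  by move=> v; split=> [x|]; [exact: smooth_derivable|
    apply: span_gen; right; exact: smooth_derive].
have [g' Sg' Hg] := HS _ Sg; split=> [x|v].
  apply: differentiable_continuous; apply/derivable1_diffP.
  exact: (@ex_derive _ _ _ _ _ _ _ (Hg x)).
have H x := is_derive_dir v (Hg x).
split=> [x|]; first exact: (@ex_derive _ _ _ _ _ _ _ (H x)).
rewrite (_ : 'D_v g = fun x => v * g' x).
  by apply: span_mul => //; apply: span_gen; right; exact: smooth_cst.
by apply/funext => x; rewrite (@derive_val _ _ _ _ _ _ _ (H x)).
Qed.

Lemma smooth_id : smooth (fun x : R => x).
Proof. by apply: smooth_linear => // x; exact: cvg_id. Qed.

Lemma smooth_expR : smooth (@expR R).
Proof.
apply: (@smooth_real [set expR]) => // _ ->.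
by exists expR => [|x]; [apply: span_gen; left|exact: is_derive_expR].
Qed.

Lemma smooth_sin : smooth (@sin R).
Proof.
apply: (@smooth_real [set sin; cos]); last by left.
move=> _ [|] ->.
  by exists cos => [|x]; [apply: span_gen; left; right|exact: is_derive_sin].
exists (fun x => -1 * sin x) => [|x]; last by rewrite mulN1r; exact: is_derive_cos.
apply: span_mul; apply: span_gen; [right|by left; left].
exact: smooth_cst.
Qed.

(** From [y / k <= expR (y / k)], raised to the power [k]. *)
Lemma pow_le_expR (k : nat) (y : R) : 0 <= y -> y ^+ k <= k%:R ^+ k * expR y.
Proof.
case: k => [|k] y0; first by rewrite !expr0 mul1r -expR0 ler_expR.
set K := k.+1%:R : R; have K0 : 0 < K by rewrite ltr0n.
have -> : y = K * (y / K) by rewrite mulrC divfK // gt_eqF.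
rewrite exprMn ler_pM2l ?exprn_gt0 // expRM_natl lerXn2r // ?nnegrE ?expR_ge0 //.
  by rewrite divr_ge0 // ltW.
by rewrite (le_trans _ (expR_ge1Dx _)) // lerDr.
Qed.

(** The functions [p(1/x) exp(-1/x)], extended by [0] to [x <= 0]; the family is
closed under differentiation, hence consists of smooth functions. *)
Definition flat (p : {poly R}) (x : R) : R :=
  if 0 < x then p.[x^-1] * expR (- x^-1) else 0.

(** The exponential beats every power: [y ^+ i.+1] is at most a multiple of
[expR y], applied at [y = 1/x] to each monomial. *)
Lemma flat_le (p : {poly R}) : exists2 C, 0 <= C & forall x, `|flat p x| <= C * `|x|.
Proof.
exists (\sum_(i < size p) `|p`_i| * (i.+1)%:R ^+ i.+1).
  by apply: sumr_ge0 => i _; rewrite mulr_ge0 // exprn_ge0.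
move=> x; rewrite /flat; case: ifPn => [x0|_]; last first.
  by rewrite normr0 mulr_ge0 // sumr_ge0 // => i _; rewrite mulr_ge0 // exprn_ge0.
have y0 : 0 < x^-1 by rewrite invr_gt0.
rewrite -(ler_pM2r y0) (gtr0_norm x0) mulfK ?gt_eqF //.
rewrite normrM (ger0_norm (expR_ge0 _)) mulrAC expRN ler_pdivrMr ?expR_gt0 //.
rewrite horner_coef (le_trans (ler_wpM2r (ltW y0) (ler_norm_sum _ _ _))) //.
rewrite !mulr_suml; apply: ler_sum => i _.
rewrite normrM normrX (gtr0_norm y0) -!mulrA ler_wpM2l // -exprSr.
exact/pow_le_expR/ltW.
Qed.

Lemma flat_cvg0 (p : {poly R}) : flat p x @[x --> (0 : R)] --> (0 : R).
Proof.
have [C C0 HC] := flat_le p.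
have C1 : 0 < C + 1 by rewrite ltr_wpDl.
apply/cvgrPdist_le => e e0; have r0 : 0 < e / (C + 1) by rewrite divr_gt0.
near=> x; rewrite sub0r normrN; apply: (le_trans (HC x)).
have : `|x| <= e / (C + 1).
  near: x; exists (e / (C + 1)) => //= x.
  by rewrite /ball_ /= sub0r normrN => /ltW.
rewrite ler_pdivlMr // mulrC => /(le_trans _); apply.
by rewrite ler_wpM2r // lerDl.
Unshelve. all: by end_near. Qed.

(** For [x > 0] the polynomial is what the chain rule yields; at [0] the
difference quotient of [flat p] is [flat (p * 'X)], which tends to [0]. *)
Lemma is_derive_flat (p : {poly R}) (x : R) :
  is_derive x 1 (flat p) (flat ('X^2 * (p - p^`())) x).
Proof.
have [x0|x0|->] := ltgtP x 0.
- rewrite {2}/flat ltNge (ltW x0) /=.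
  apply: (@near_eq_is_derive _ _ _ (cst 0)).
  by near=> y; rewrite /flat ltNge ltW //=; near: y; exact: lt_nbhsl.
- rewrite {2}/flat x0.
  suff H : is_derive x 1 (fun y => p.[y^-1] * expR (- y^-1))
      (('X^2 * (p - p^`())).[x^-1] * expR (- x^-1)).
    apply: near_eq_is_derive H; near=> y; rewrite /flat ifT //.
    by near: y; exact: lt_nbhsr.
  have xn0 : x != 0 by rewrite gt_eqF.
  have dV : is_derive x 1 (fun y : R => y^-1) (- x ^- 2).
    have di : derivable (id : R -> R) x 1 by exact: derivable_id.
    split; first exact: (derivableV xn0 di).
    rewrite (deriveV xn0 di) derive_id.
    by rewrite [_ *: _]mulr1.
  have [dV1 dV2] := dV.
  have dN : is_derive x 1 (fun y : R => - y^-1) (x ^- 2).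
    by split; [exact: derivableN|rewrite (deriveN dV1) dV2 opprK].
  have dH : derivable (horner p) x^-1 1 by exact: derivable_horner.
  have eH : 'D_1 (horner p) x^-1 = p^`().[x^-1] by rewrite -derive1E -derivE.
  have dp := derive_comp dV1 dH.
  have [dN1 dN2] := dN.
  have dE : derivable (@expR R) (- x^-1) 1 by exact: derivable_expR.
  have de := derive_comp dN1 dE.
  have [dp1 dp2] := dp; have [de1 de2] := de.
  split; first exact: (derivableM dp1 de1).
  rewrite (deriveM dp1 de1) dp2 de2 dV2 dN2 eH.
  rewrite (@derive_val _ _ _ _ _ _ _ (is_derive_expR _)).
  rewrite hornerM hornerXn hornerD hornerN exprVn.
  by rewrite /GRing.scale /=; ring.
- rewrite {2}/flat ltxx.
  have E : (fun h : R => h^-1 *: ((flat p \o shift 0) (h *: 1) - flat p 0)) =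
      flat (p * 'X).
    apply/funext => h; rewrite /= addr0 [_%:A]mulr1 [flat p 0]/flat ltxx subr0.
    rewrite /flat; case: ifP => h0; last by rewrite scaler0.
    by rewrite hornerM hornerX /GRing.scale /=; ring.
  have H : flat (p * 'X) h @[h --> (0 : R)^'] --> (0 : R).
    exact: (cvg_trans (cvg_app _ (@nbhs_dnbhs _ _)) (flat_cvg0 _)).
  split; rewrite /derivable /derive E; last exact: cvg_lim.
  by apply/cvg_ex; exists 0.
Unshelve. all: by end_near. Qed.

Lemma smooth_flat p : smooth (flat p).
Proof.
apply: (@smooth_real (range flat)); last by exists p.
move=> _ [q _ <-]; exists (flat ('X^2 * (q - q^`()))).
  by apply: span_gen; left; exists ('X^2 * (q - q^`())).
by move=> x; exact: is_derive_flat.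
Qed.

Definition cutoff : R -> R := flat 1.
Definition cutoff' : R -> R := flat 'X^2.

Lemma smooth_cutoff : smooth cutoff. Proof. exact: smooth_flat. Qed.

Lemma is_derive_cutoff (x : R) : is_derive x 1 cutoff (cutoff' x).
Proof.
by have := is_derive_flat 1 x; rewrite derivC subr0 mulr1.
Qed.

Lemma cutoff_le0 x : x <= 0 -> cutoff x = 0.
Proof. by rewrite /cutoff /flat ltNge => ->. Qed.

Lemma cutoffE x : 0 < x -> cutoff x = expR (- x^-1).
Proof. by rewrite /cutoff /flat => ->; rewrite hornerC mul1r. Qed.

Lemma cutoff_gt0 x : 0 < x -> 0 < cutoff x.
Proof. by move=> x0; rewrite cutoffE // expR_gt0. Qed.

Lemma cutoff_ge0 x : 0 <= cutoff x.
Proof. by case: (ltP 0 x) => [/cutoff_gt0/ltW//|/cutoff_le0 ->]. Qed.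

Lemma cutoff_le1 x : cutoff x <= 1.
Proof.
case: (ltP 0 x) => [x0|/cutoff_le0 -> //].
by rewrite cutoffE // -expR0 ler_expR oppr_le0 invr_ge0 ltW.
Qed.

Lemma cutoff'_le0 x : x <= 0 -> cutoff' x = 0.
Proof. by rewrite /cutoff' /flat ltNge => ->. Qed.

Lemma cutoff'_ge0 x : 0 <= cutoff' x.
Proof.
rewrite /cutoff' /flat; case: ifP => // x0.
by rewrite hornerXn mulr_ge0 ?expR_ge0 // exprn_ge0 // invr_ge0 ltW.
Qed.

Lemma cutoff'_le x : 0 < x -> cutoff' x <= x ^- 2.
Proof.
move=> x0; rewrite /cutoff' /flat x0 hornerXn exprVn; apply: ler_piMr.
  by rewrite invr_ge0 exprn_ge0 // ltW.
by rewrite -expR0 ler_expR oppr_le0 invr_ge0 ltW.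
Qed.

Lemma cutoff'_bounded x : cutoff' x <= 4.
Proof.
rewrite /cutoff' /flat; case: ifP => // x0; rewrite hornerXn expRN.
rewrite ler_pdivrMr ?expR_gt0 //.
have := @pow_le_expR 2 x^-1; rewrite invr_ge0 ltW // => /(_ isT).
by rewrite -natrX.
Qed.

(** With [s = t / e] this is [t] times the derivative of the time cutoff
[t |-> cutoff (t / e - 1)]; the bound is uniform in [e]. *)
Lemma cutoff'_shift_bounded (s : R) : 0 <= s * cutoff' (s - 1) <= 8.
Proof.
have [s1|s1] := leP s 1; first by rewrite cutoff'_le0 ?subr_le0 // mulr0 lexx ler0n.
rewrite mulr_ge0 ?cutoff'_ge0 ?(le_trans _ (ltW s1)) //=.
have [s2|s2] := leP s 2.
  have := cutoff'_bounded (s - 1); have := cutoff'_ge0 (s - 1); nra.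
have H := @cutoff'_le (s - 1); rewrite subr_gt0 s1 in H.
have s10 : 0 < s - 1 by rewrite subr_gt0.
apply: (le_trans (ler_wpM2l _ (H isT))); first lra.
by rewrite ler_pdivrMr ?exprn_gt0 //; nra.
Qed.

End real_smooth.

(** * The operator on space-time fields *)

Section space_derivatives.
Context (R : realType) (d : nat).

(** A multi-index derivative is an iterated derivative along a list of
directions, so that its properties follow by induction on lists. *)
Definition multi_dirs m (a : {ffun 'I_d -> 'I_m}) : seq 'rV[R]_d :=
  flatten [seq nseq (a i) (evec i) | i <- enum 'I_d].

Lemma multi_derivE m (W : normedModType R) (a : {ffun 'I_d -> 'I_m})
  (f : 'rV[R]_d -> W) : multi_deriv a f = iterD (multi_dirs a) f.
Proof.
rewrite /multi_deriv /multi_dirs; elim: (enum 'I_d) => //= i s ->.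
rewrite /Defs.iterD foldr_cat; elim: (a i : nat) => //= k ->.
by [].
Qed.

Lemma size_multi_dirs m (a : {ffun 'I_d -> 'I_m}) :
  size (multi_dirs a) = (\sum_i (a i : nat))%N.
Proof.
rewrite /multi_dirs size_flatten /shape -map_comp sumnE big_map big_enum /=.
by apply: eq_bigr => i _; rewrite size_nseq.
Qed.

Lemma iterD_slice (W : normedModType R) (f : R * 'rV[R]_d -> W) s t x :
  iterD s (fun y => f (t, y)) x = iterD [seq (0, v) | v <- s] f (t, x).
Proof.
elim: s x => //= v s IH x.
have -> : iterD s (fun y => f (t, y)) =
  fun y => iterD [seq (0, v) | v <- s] f (t, y) by apply/funext.
rewrite /derive; set g1 := fun h => h^-1 *: _; set g2 := fun h => h^-1 *: _.
suff -> : g1 = g2 by [].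
apply/funext => h; rewrite /g1 /g2 /=; congr (_ *: (iterD _ f _ - _)).
by congr pair; rewrite /= scaler0 add0r.
Qed.

Lemma smooth_time (g : R -> R) : smooth g ->
  smooth (fun z : R * 'rV[R]_d => g z.1).
Proof.
move=> sg; apply: (smooth_comp sg).
by apply: smooth_linear => // z; exact: cvg_fst.
Qed.

Lemma smooth_coordinate (g : R -> R) (i : 'I_d) : smooth g ->
  smooth (fun z : R * 'rV[R]_d => g (z.2 ord0 i)).
Proof.
move=> sg; apply: (smooth_comp sg (f := fun z : R * 'rV[R]_d => z.2 ord0 i)).
apply: smooth_linear => [x y|a x|z]; rewrite ?mxE //.
apply: (@continuous_comp _ _ _ snd (fun x : 'rV[R]_d => x ord0 i)).
  exact: cvg_snd.
exact: coord_continuous.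
Qed.

Lemma is_dt_time (g g' : R -> R) (z : R * 'rV[R]_d) : (forall t : R, is_derive t 1 g (g' t)) ->
  is_derive z (1, 0) (fun z : R * 'rV[R]_d => g z.1) (g' z.1).
Proof.
move=> Hg; have [dg eg] := Hg z.1.
have lin := @derive_linear R (R * 'rV[R]_d)%type fst (fun _ _ => erefl)
  (fun _ _ => erefl) (1, 0) z.
have [d1 e1] := lin.
have [d2 e2] := derive_comp d1 dg.
by split=> //; rewrite e2 e1 eg mulr1.
Qed.

Lemma dt_scale m n (g g' : R -> R) (M : R * 'rV[R]_d -> 'M[R]_(m, n))
  (z : R * 'rV[R]_d) :
  smooth g -> (forall t : R, is_derive t 1 g (g' t)) -> smooth M ->
  dt (fun z => g z.1 *: M z) z = g' z.1 *: M z + g z.1 *: dt M z.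
Proof.
move=> sg Hg sM; rewrite /dt.
have sS := smooth_scale (smooth_time sg) sM.
apply/matrixP => i j; rewrite derive_entry // !mxE.
have [d1 e1] := is_dt_time z Hg.
have d2 := smooth_derivable z (1, 0) (smooth_entry i j sM).
rewrite (_ : (fun z => _) = fun z => g z.1 * M z i j); last first.
  by apply/funext => y; rewrite mxE.
by rewrite (deriveM d1 d2) e1 derive_entry // /GRing.scale /=; ring.
Qed.

Lemma iterD_scale (V : normedModType R) (c : R) (f : V -> R) s x : smooth f ->
  iterD s (fun y => c * f y) x = c * iterD s f x.
Proof.
move=> sf; elim: s x => //= v s IH x.
have -> : iterD s (fun y => c * f y) = fun y => c * iterD s f y by apply/funext.
by rewrite (deriveMl c (smooth_derivable x v (smooth_iterD s sf))).
Qed.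

Lemma smooth_slice (W : normedModType R) (f : R * 'rV[R]_d -> W) t :
  smooth f -> smooth (fun x => f (t, x)).
Proof.
move=> sf; apply: (@smooth_closed _ _ _
  [set g | exists2 f : R * 'rV[R]_d -> W, smooth f & g = (fun x => f (t, x))]).
  move=> _ [g sg ->]; split.
    move=> x; apply: (@continuous_comp _ _ _ (fun x => (t, x)) g).
      have c1 : (fun y : 'rV[R]_d => t) @ nbhs x --> nbhs t by exact: cvg_cst.
      have c2 : (fun y : 'rV[R]_d => y) @ nbhs x --> nbhs x by exact: cvg_id.
      exact: cvg_pair c1 c2.
    exact: smooth_continuous.
  move=> v; have E x : (fun h => h^-1 *: (((fun x => g (t, x)) \o shift x) (h *: v) - g (t, x)))
     = (fun h => h^-1 *: ((g \o shift (t, x)) (h *: ((0, v) : R * 'rV[R]_d)) - g (t, x))).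
    apply/funext => h /=; congr (_ *: (g _ - _)).
    by congr pair; rewrite /= scaler0 add0r.
  split=> [x|]; first by rewrite /derivable E; exact: smooth_derivable.
  exists ('D_((0, v) : R * 'rV[R]_d) g); first exact: smooth_derive.
  by apply/funext => x; rewrite /derive E.
by exists f.
Qed.

End space_derivatives.

Section operator_theory.
Context (R : realType) (d n N : nat) (L : diffop R d n N).
Implicit Types (Psi : R * 'rV[R]_d -> 'M[R]_N) (phi : R * 'rV[R]_d -> R).

Definition op_st Psi (z : R * 'rV[R]_d) : 'rV[R]_n :=
  op_apply L (fun x => Psi (z.1, x)) z.2.

Lemma op_stE Psi z k : op_st Psi z ord0 k =
  \sum_a mxdot (op_coef L a k) (iterD [seq (0, v) | v <- multi_dirs R a] Psi z).
Proof.
rewrite mxE; apply: eq_bigr => a _.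
by rewrite multi_derivE iterD_slice; case: z.
Qed.

Lemma smooth_op_st Psi : smooth Psi -> smooth (op_st Psi).
Proof.
move=> sPsi; apply: smooth_mx => i k; rewrite ord1.
apply: (smooth_eq (fun z => esym (op_stE Psi z k))).
by apply: smooth_sum => a _; apply: smooth_mxdot; exact: smooth_iterD.
Qed.

Lemma iterD_dt m p (M : R * 'rV[R]_d -> 'M[R]_(m, p)) s : smooth M ->
  iterD s (dt M) = dt (iterD s M).
Proof.
move=> sM; apply/funext => z; apply/matrixP => i j; rewrite /dt.
have sD := smooth_derive ((1, 0) : R * 'rV[R]_d) sM.
rewrite (iterD_entry s z i j sD) (derive_entry _ _ i j (smooth_iterD s sM)).
rewrite (_ : (fun x => ('D_(1, 0) M x) i j) = 'D_(1, 0) (fun x => M x i j)).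
  rewrite iterD_derive; last exact: smooth_entry.
  by congr ('D_(1, 0) _ z); apply/funext => y; rewrite (iterD_entry s y i j sM).
by apply/funext => y; rewrite (derive_entry _ _ i j sM).
Qed.

(** This rests on the equality of mixed derivatives, through [iterD_dt]. *)
Lemma dt_op_st Psi z : smooth Psi -> dt (op_st Psi) z = op_st (dt Psi) z.
Proof.
move=> sPsi; apply/rowP => k; rewrite /dt derive_entry; last exact: smooth_op_st.
rewrite op_stE (_ : (fun z => op_st Psi z ord0 k) = fun z =>
  \sum_a mxdot (op_coef L a k) (iterD [seq (0, v) | v <- multi_dirs R a] Psi z)).
  have H a := derive_mxdotr (op_coef L a k) (smooth_derivable z (1, 0)
    (smooth_iterD [seq (0, v) | v <- multi_dirs R a] sPsi)).
  have [_ ->] := is_derive_fsum (index_enum _) H.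
  by apply: eq_bigr => a _; rewrite iterD_dt.
by apply/funext => y; rewrite op_stE.
Qed.

Lemma op_st_scale (g : R -> R) Psi z : smooth Psi ->
  op_st (fun z => g z.1 *: Psi z) z = g z.1 *: op_st Psi z.
Proof.
move=> sPsi; apply/rowP => k; rewrite !mxE mulr_sumr; apply: eq_bigr => a _.
rewrite !multi_derivE -mxdotZr; congr mxdot; apply/matrixP => i j.
have sP := smooth_slice z.1 sPsi.
have sC : smooth (fun _ : 'rV[R]_d => g z.1) by exact: smooth_cst.
rewrite (iterD_entry _ z.2 i j (smooth_scale sC sP)) mxE.
rewrite (iterD_entry _ z.2 i j sP) -(iterD_scale _ _ _ (smooth_entry i j sP)).
by congr (iterD _ _ _); apply/funext => x; rewrite mxE.
Qed.

Lemma op_st_periodic Psi t x i : (forall t x i, Psi (t, x + evec i) = Psi (t, x)) ->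
  op_st Psi (t, x + evec i) = op_st Psi (t, x).
Proof.
move=> pPsi; apply/rowP => k; rewrite !mxE /=; apply: eq_bigr => a _.
rewrite !multi_derivE; congr mxdot.
have := iterD_translate (fun y => Psi (t, y)) (multi_dirs R a) (evec i).
move=> /(congr1 (fun f => f x)) <-; congr (iterD _ _ _).
by apply/funext => y; rewrite pPsi.
Qed.

Lemma dt_periodic (W : normedModType R) (f : R * 'rV[R]_d -> W) t x i :
  (forall t x i, f (t, x + evec i) = f (t, x)) ->
  dt f (t, x + evec i) = dt f (t, x).
Proof.
move=> pf; have -> : (t, x + evec i) = (t, x) + (0, evec i) :> R * 'rV[R]_d.
  by congr pair; rewrite addr0.
rewrite /dt -derive_translate (_ : (fun y => f (y + _)) = f) //.
apply/funext => -[s y].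
by rewrite -(pf s y i); congr (f (_, _)); rewrite /= addr0.
Qed.

Lemma smooth_st_op_st Psi : smooth_st Psi -> smooth_st (op_st Psi).
Proof.
by move=> [sPsi pPsi]; split=> [|t x i]; [exact: smooth_op_st|exact: op_st_periodic].
Qed.

Lemma smooth_st_dt m p (M : R * 'rV[R]_d -> 'M[R]_(m, p)) :
  smooth_st M -> smooth_st (dt M).
Proof.
by move=> [sM pM]; split=> [|t x i]; [exact: smooth_derive|exact: dt_periodic].
Qed.

Lemma smooth_st_scale m p (g : R -> R) (M : R * 'rV[R]_d -> 'M[R]_(m, p)) :
  smooth g -> smooth_st M -> smooth_st (fun z => g z.1 *: M z).
Proof.
move=> sg [sM pM]; split=> [|t x i]; last by rewrite pM.
exact: smooth_scale (smooth_time sg) sM.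
Qed.

Lemma dt_symm Psi z : smooth Psi -> (forall z, symm (Psi z)) -> symm (dt Psi z).
Proof.
move=> sPsi symP; apply/matrixP => i j; rewrite mxE /dt.
rewrite (derive_entry _ _ j i sPsi) (derive_entry _ _ i j sPsi).
by congr ('D_(1, 0) _ z); apply/funext => y; rewrite -[in LHS](symP y) mxE.
Qed.

Lemma derive_reflect (f : 'rV[R]_d -> R) v x : smooth f ->
  'D_v (fun y => f (- y)) x = - 'D_v f (- x).
Proof.
move=> sf; have d1 : derivable (fun h : R => - h) 0 1.
  exact/derivableN/derivable_id.
have di : derivable (id : R -> R) 0 1 by exact: derivable_id.
have e1 : 'D_1 (fun h : R => - h) 0 = -1 by rewrite (deriveN di) derive_id.
have d2 : derivable (fun h : R => f (- x + h *: v)) (- 0) 1.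
  by have [] := @derive_along R _ f (- x) v (- 0) (smooth_derivable _ v sf).
have [_ e2] := derive_comp d1 d2.
have e3 := @derive_val _ _ _ _ _ _ _
  (@derive_along R _ f (- x) v (- 0) (smooth_derivable _ v sf)).
rewrite e1 e3 oppr0 scale0r addr0 mulrN1 in e2; rewrite -e2.
rewrite /derive; set g1 := fun h => h^-1 *: _; set g2 := fun h => h^-1 *: _.
suff -> : g1 = g2 by [].
apply/funext => h; rewrite /g1 /g2 /= addr0 oppr0 scale0r addr0 [_%:A]mulr1.
by rewrite opprD scaleNr [- x + _]addrC.
Qed.

Lemma smooth_reflect (f : 'rV[R]_d -> R) : smooth f -> smooth (fun y => f (- y)).
Proof.
move=> sf; apply: (@smooth_closed _ _ _ [set h |
  exists2 g : 'rV[R]_d -> R, smooth g & h = (fun y => g (- y))]); last by exists f.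
move=> _ [g sg ->]; split.
  move=> y; apply: (@continuous_comp _ _ _ (fun y : 'rV[R]_d => - y) g).
    exact: opp_continuous.
  exact: smooth_continuous.
move=> w; split=> [y|].
  have dg := smooth_derivable (- y) (- w) sg.
  rewrite /derivable (_ : (fun h => _) =
    (fun h => h^-1 *: ((g \o shift (- y)) (h *: - w) - g (- y)))) //.
  by apply/funext => h /=; rewrite opprD scalerN.
exists (fun y => - 1 * 'D_w g y).
  by apply: smoothM; [exact: smooth_cst|exact: smooth_derive].
by apply/funext => y; rewrite derive_reflect // mulN1r.
Qed.

Lemma iterD_reflect (f : 'rV[R]_d -> R) s x : smooth f ->
  iterD s (fun y => f (- y)) x = (-1) ^+ size s * iterD s f (- x).
Proof.
move=> sf; elim: s x => [|v s IH] x /=; first by rewrite mul1r.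
have -> : iterD s (fun y => f (- y)) =
   fun y => (-1) ^+ size s * (iterD s f (- y)) by apply/funext.
have sR := smooth_reflect (smooth_iterD s sf).
rewrite (deriveMl _ (smooth_derivable x v sR)) derive_reflect ?exprS; last exact: smooth_iterD.
by rewrite /GRing.scale /=; ring.
Qed.

End operator_theory.

(** * The subspace of admissible multipliers *)

Section lambda.
Context (R : realType) (d n N : nat) (L : diffop R d n N).

Lemma LambdaD A B : Lambda L A -> Lambda L B -> Lambda L (A + B).
Proof. by move=> LA LB U U1 UL; rewrite memvD ?LA ?LB. Qed.

Lemma LambdaZ a A : Lambda L A -> Lambda L (a *: A).
Proof. by move=> LA U U1 UL; rewrite memvZ ?LA. Qed.

Lemma Lambda1 : Lambda L 1%:M.
Proof. by []. Qed.

Lemma adjoint_symm u x : symm (adjoint L u x).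
Proof.
have symm0 : symm (0 : 'M[R]_N) by exact: trmx0.
apply: (big_ind (@symm R N)) => // [A B|a _]; first exact: symmD.
apply: (big_ind (@symm R N)) => // [A B|k _]; first exact: symmD.
exact/symmZ/op_coef_symm.
Qed.

(** The intersection of all subspaces containing [I] and the values of [L^*] is
itself one of them, namely one of least dimension. *)
Lemma Lambda_vspace : exists U : {vspace 'M[R]_N},
  [/\ 1%:M \in U, forall u, smooth_torus u -> forall x, adjoint L u x \in U &
      forall X, X \in U -> Lambda L X].
Proof.
pose P (U : {vspace 'M[R]_N}) := 1%:M \in U /\
  forall u, smooth_torus u -> forall x, adjoint L u x \in U.
pose D (k : nat) := `[< exists2 U, P U & \dim U = k >].
have exD : exists k, D k.
  by exists (\dim {:'M[R]_N}); apply/asboolP; exists fullv => //; split=> *; rewrite memvf.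
case: (ex_minnP exD) => k /asboolP[U [U1 UL] dimU] kmin.
exists U; split=> // X XU V V1 VL.
have /kmin : D (\dim (U :&: V)).
  apply/asboolP; exists (U :&: V)%VS => //.
  by split=> [|u su x]; rewrite memv_cap ?U1 ?V1 ?UL ?VL.
rewrite -dimU => UV; have /eqP EU : (U :&: V == U)%VS by rewrite eqEdim capvSl.
by move: XU; rewrite -EU memv_cap => /andP[].
Qed.

(** [Lambda] is cut out, among symmetric matrices, by finitely many linear
equations, each with a symmetric coefficient matrix. *)
Lemma Lambda_equations : exists A : 'I_N -> 'I_N -> 'M[R]_N,
  [/\ forall i j, symm (A i j),
      forall i j u, smooth_torus u -> forall x, mxdot (A i j) (adjoint L u x) = 0 &
      forall X, symm X -> (forall i j, mxdot (A i j) X = 0) -> Lambda L X].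
Proof.
have [U [U1 UL UX]] := Lambda_vspace.
pose f X : 'M[R]_N := X - projv U X.
pose A0 i j : 'M[R]_N := \matrix_(p, q) f (delta_mx p q) i j.
have A0E i j X : mxdot (A0 i j) X = f X i j.
  rewrite [in RHS](matrix_sum_delta X) /f linear_sum -sumrB summxE.
  apply: eq_bigr => p _; rewrite linear_sum -sumrB summxE.
  apply: eq_bigr => q _; rewrite linearZ -scalerBr /= !mxE mulrC.
  by [].
have fU X : X \in U -> f X = 0 by move=> XU; rewrite /f projv_id // subrr.
pose A i j := 2^-1 *: (A0 i j + (A0 i j)^T).
have AE i j X : symm X -> mxdot (A i j) X = f X i j.
  move=> sX; rewrite mxdotZl mxdotDl -[X in _ + mxdot _ X]sX mxdot_tr A0E.
  by field.
exists A; split=> [i j|i j u su x|X sX AX].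
- by apply: symmZ; rewrite /symm linearD /= trmxK addrC.
- by rewrite AE ?fU ?mxE //; [exact: UL|exact: adjoint_symm].
- apply: UX; have : f X = 0 by apply/matrixP => i j; rewrite -AE // AX mxE.
  by move/eqP; rewrite subr_eq0 => /eqP ->; exact: memv_proj.
Qed.

(** The adjoint identity holds pointwise, because a test field can be reflected
about any point, which turns [L^*] into [L]. *)
Lemma op_st_orthogonal (A : 'M[R]_N) (phi : R * 'rV[R]_d -> R) z :
  (forall u, smooth_torus u -> forall x, mxdot A (adjoint L u x) = 0) ->
  smooth_st phi -> op_st L (fun z => phi z *: A) z = 0.
Proof.
move=> AL [sphi pphi]; apply/rowP => k; rewrite mxE [RHS]mxE.
case: z => t x /=; pose f y := phi (t, y).
have sf : smooth f by exact: smooth_slice.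
have sfr := smooth_reflect sf.
pose u y : 'rV[R]_n := f (- y) *: delta_mx ord0 k.
have su : smooth u by apply: smooth_scale => //; exact: smooth_cst_mx.
have pu y i : u (y + evec i) = u y.
  by rewrite /u /f opprD -(pphi t (- y - evec i) i) subrK.
have AL0 := AL u (conj su pu) (- x); rewrite /adjoint mxdot_sumr in AL0.
rewrite -[RHS]AL0 {AL0}.
apply: eq_bigr => a _; rewrite mxdot_sumr (bigD1 k) //=.
rewrite [X in _ + X]big1 ?addr0; last first.
  move=> k' kk'; rewrite mxdotZr multi_derivE (iterD_entry _ _ ord0 k' su).
  rewrite (_ : (fun y => u y ord0 k') = fun y => 0 * f y).
    by rewrite (iterD_scale _ _ _ sf) mul0r mulr0 mul0r.
  by apply/funext => y; rewrite !mxE (negPf kk') andbF mulr0 mul0r.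
rewrite mxdotZr !multi_derivE (iterD_entry _ _ ord0 k su) (mxdotC A).
have -> : (fun y => u y ord0 k) = (fun y => f (- y)).
  by apply/funext => y; rewrite !mxE !eqxx mulr1.
rewrite (iterD_reflect _ _ sf) size_multi_dirs opprK mulrA -expr2 sqrr_sign.
rewrite mul1r -mxdotZr; congr mxdot.
apply/matrixP => i j; rewrite mxE.
have sC : smooth (fun _ : 'rV[R]_d => A) by exact: smooth_cst_mx.
rewrite (iterD_entry _ _ i j (smooth_scale sf sC)) mulrC -(iterD_scale _ _ _ sf).
by congr (iterD _ _ _); apply/funext => y; rewrite mxE mulrC.
Qed.

End lambda.

(** * Convex functions and their conjugates *)

Section convexity.
Context (R : realType) (n : nat).
Implicit Types (f : 'rV[R]_n -> R) (x y z v : 'rV[R]_n).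

Lemma convexP f x y (t : R) : convex_function (E := 'rV[R]_n) setT f ->
  0 <= t <= 1 -> f (t *: x + (1 - t) *: y) <= t * f x + (1 - t) * f y.
Proof.
move=> cf /andP[t0 t1].
by have := cf (Itv01 t0 t1) x y; rewrite !in_setT => /(_ isT isT).
Qed.

Lemma convex_average f (k : nat) (z : nat -> 'rV[R]_n) :
  convex_function (E := 'rV[R]_n) setT f ->
  f (k.+1%:R^-1 *: \sum_(l < k.+1) z l) <= k.+1%:R^-1 * \sum_(l < k.+1) f (z l).
Proof.
move=> cf; elim: k => [|k IH].
  by rewrite !big_ord1 invr1 scale1r mul1r.
rewrite !(big_ord_recr k.+1) /=.
set a := k.+1%:R : R in IH *; set b := k.+2%:R : R.
have a0 : 0 < a by rewrite ltr0n.
have ba : b = a + 1 by rewrite /b /a [k.+2%:R]mulrSr.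
have b0 : 0 < b by rewrite ltr0n.
have t01 : 0 <= a / b <= 1.
  by rewrite (divr_ge0 (ltW a0) (ltW b0)) /= ler_pdivrMr // mul1r ba lerDl.
have := convexP (a^-1 *: \sum_(l < k.+1) z l) (z k.+1) cf t01.
have -> : 1 - a / b = b^-1 by rewrite ba; field; lra.
rewrite scalerA mulrAC mulfV ?gt_eqF // mul1r -scalerDr => /le_trans; apply.
rewrite mulrDr lerD2r (le_trans (ler_wpM2l _ IH)) //.
  exact: divr_ge0 (ltW a0) (ltW b0).
by rewrite mulrA (_ : a / b / a = b^-1) //; field; rewrite !gt_eqF.
Qed.

(** A one-sided bound on difference quotients passes to the derivative. *)
Lemma derive_ge_quotients (g : R -> R) (D c : R) : is_derive (0 : R) 1 g D ->
  (forall t : R, 0 < t -> c <= (g t - g 0) / t) -> c <= D.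
Proof.
move=> [dg eg] H; rewrite -subr_ge0; apply/ler_addgt0Pl => e e0.
have : (fun h : R => h^-1 *: ((g \o shift 0) (h *: 1) - g 0)) @ 0^' --> D.
  by rewrite -eg; exact: dg.
move=> /cvgrPdist_lt /(_ _ e0) /=.
rewrite near_withinE => -[r /= r0 Hr].
have [s s0 sr] : exists2 s, 0 < s & s < r by exists (r / 2); lra.
have := Hr s; rewrite /ball_ /= sub0r normrN gtr0_norm // => /(_ sr (lt0r_neq0 s0)).
rewrite addr0 [_%:A]mulr1 /GRing.scale /= mulrC => /ltr_normlP[+ _].
by have := H _ s0; lra.
Qed.

(** Only the partial derivatives are used: the average of the steps along the
axes is the full step, so convexity bounds the increment of [f] by the mean of
its increments along the axes. *)
Lemma convex_gradient f v z : convex_function (E := 'rV[R]_n) setT f ->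
  (forall l, derivable f v (evec l)) ->
  f v + \sum_l (z - v) ord0 l * 'D_(evec l) f v <= f z.
Proof.
move=> cf df; rewrite addrC -lerBrDr.
have [n0|n0] := posnP n.
  rewrite big1 => [|[i] li]; last by exfalso; move: li; rewrite n0.
  rewrite (_ : z = v) ?subrr //; apply/rowP => -[i li].
  by exfalso; move: li; rewrite n0.
pose w := z - v.
pose g (t : R) := n%:R^-1 * \sum_(l < n) f (v + (- (n%:R * w ord0 l) * t) *: evec l).
have n1 : n%:R != 0 :> R by rewrite pnatr_eq0 -lt0n.
have g0 : g 0 = f v.
  rewrite /g; under eq_bigr do rewrite mulr0 scale0r addr0.
  by rewrite sumr_const card_ord -[f v *+ n]mulr_natl mulrA mulVf // mul1r.
have dg : is_derive (0 : R) 1 g (- \sum_l w ord0 l * 'D_(evec l) f v).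
  have dterm l : is_derive (0 : R) 1
      (fun t : R => f (v + (- (n%:R * w ord0 l) * t) *: evec l))
      ('D_(evec l) f v * - (n%:R * w ord0 l)).
    set c := - (n%:R * w ord0 l).
    have di : derivable (id : R -> R) 0 1 by exact: derivable_id.
    have [d1 e1] : is_derive (0 : R) 1 (fun t : R => c * t) c.
      split; first exact: (derivableM (derivable_cst c (0 : R) 1) di).
      by rewrite (deriveMl c di) derive_id mulr1.
    have Ev : v + (c * 0) *: evec l = v by rewrite mulr0 scale0r addr0.
    have d2 := @derive_along R _ f v (evec l) (c * 0).
    rewrite Ev in d2; have [d3 e3] := d2 (df l).
    by have := derive_comp d1 d3; rewrite e3 e1.
  have [ds es] := is_derive_fsum (index_enum 'I_n) dterm.
  split; rewrite /g; first exact: (derivableM (derivable_cst _ _ _) ds).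
  rewrite (deriveMl n%:R^-1 ds) es /GRing.scale /= mulr_sumr -sumrN.
  by apply: eq_bigr => l _; field.
suff : f v - f z <= - \sum_l w ord0 l * 'D_(evec l) f v by rewrite -/w; lra.
apply: (derive_ge_quotients dg) => t t0; rewrite g0 ler_pdivlMr //.
have avg : f (v - t *: w) <= g t.
  pose s (l : nat) : 'rV[R]_n := if insub l is Some i then
     v + (- (n%:R * w ord0 i) * t) *: evec i else 0.
  have sE (i : 'I_n) : s i = v + (- (n%:R * w ord0 i) * t) *: evec i.
    by rewrite /s insubT //= => lt; congr (v + (- (_ * w _ _) * t) *: evec _);
      apply: val_inj.
  have := @convex_average f n.-1 s cf; rewrite prednK //.
  rewrite (eq_bigr _ (fun i _ => sE i)).
  rewrite [X in _ <= _ * X](eq_bigr _ (fun i _ => congr1 f (sE i))).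
  rewrite -/(g t); congr (is_true (f _ <= _)).
  rewrite big_split /= sumr_const card_ord scalerDr -[v *+ n]scaler_nat scalerA mulVf //.
  rewrite scale1r; congr (_ + _); rewrite scaler_sumr.
  rewrite -scaleNr [w in RHS]row_sum_delta scaler_sumr; apply: eq_bigr => i _.
  by rewrite !scalerA; congr (_ *: _); field.
have t1 : 0 < 1 + t by rewrite addr_gt0.
(* [v] is a convex combination of [v - t w] and [z = v + w]. *)
have t01 : 0 <= (1 + t)^-1 <= 1.
  by rewrite invr_ge0 (ltW t1) invf_le1 // lerDl ltW.
have := convexP (v - t *: w) z cf t01.
have -> : (1 + t)^-1 *: (v - t *: w) + (1 - (1 + t)^-1) *: z = v.
  have -> : 1 - (1 + t)^-1 = (1 + t)^-1 * t by field; rewrite gt_eqF.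
  rewrite -scalerA -scalerDr /w scalerBr opprB addrA subrK -{1}(scale1r v).
  by rewrite -scalerDl scalerA mulVf ?gt_eqF // scale1r.
have -> : 1 - (1 + t)^-1 = (1 + t)^-1 * t by field; rewrite gt_eqF.
rewrite -mulrA -mulrDr mulrC ler_pdivlMr //; lra.
Qed.

End convexity.

Lemma continuous_sub (R : realType) (T : topologicalType) (V : normedModType R)
  (f g : T -> V) : continuous f -> continuous g -> continuous (fun x => f x - g x).
Proof. by move=> cf cg x; apply: cvgB; [exact: cf|exact: cg]. Qed.

Section conjugate.
Context (R : realType) (n : nat) (K : 'rV[R]_n -> R).
Hypothesis KN : N_function K.
Implicit Types (x y z v : 'rV[R]_n).

Lemma enorm0 : enorm (0 : 'rV[R]_n) = 0.
Proof. by rewrite /enorm mxdot0l sqrtr0. Qed.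

Lemma Nfun0 : K 0 = 0.
Proof.
have [P1 [P2 [[_ _ _ e1 _ _] [_ _ _ e2 _ _] H]]] := Nfun_young KN.
have := H 0; rewrite enorm0.
by rewrite (proj2 (e1 0) erefl) (proj2 (e2 0) erefl) => /le_anti.
Qed.

(** The lower Young function beats any linear function away from a ball, on which
the linear function is bounded. *)
Lemma Nfun_superlinear (c : R) : exists2 a, 0 <= a &
  forall x, c * enorm x <= K x + a.
Proof.
have [P1 [P2 [[_ _ _ _ _ y1] _ H]]] := Nfun_young KN.
have [s0 [s0r Hs]] : exists s0 : R, 0 <= s0 /\ forall s, s0 < s -> c <= P1 s / s.
  move/cvgryPge : y1 => /(_ c) [s [sr Hs]].
  exists (Num.max s 0); split; first by rewrite le_max lexx orbT.
  by move=> t; rewrite gt_max => /andP[st _]; exact: Hs.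
exists (`|c| * s0) => [|x]; first by rewrite mulr_ge0.
have [xs|xs] := leP (enorm x) s0.
  rewrite (le_trans (ler_norm _)) // normrM (ger0_norm (enorm_ge0 x)).
  by rewrite (le_trans (ler_wpM2l (normr_ge0 c) xs)) // lerDr (Nfun_ge0 KN).
have x0 : 0 < enorm x by exact: le_lt_trans xs.
have := Hs _ xs; rewrite ler_pdivlMr // => /le_trans; apply.
have /andP[h _] := H x; rewrite (le_trans h) // lerDl mulr_ge0 //.
Qed.

Lemma legendre_has_sup y : has_sup (range (fun x => mxdot x y - K x)).
Proof.
split; first by exists (mxdot 0 y - K 0); exists 0.
have [a a0 Ha] := Nfun_superlinear (enorm y).
exists a => _ [x _ <-]; have := Ha x; have := mxdot_enorm x y.
by move=> /ler_normlW; rewrite mulrC; lra.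
Qed.

Lemma young_inequality x y : mxdot x y <= K x + legendre K y.
Proof.
by rewrite -lerBlDl; apply: (sup_upper_bound (legendre_has_sup y)); exists x.
Qed.

Lemma legendre_le y c : (forall x, mxdot x y - K x <= c) -> legendre K y <= c.
Proof.
move=> H; apply: ge_sup; first by have [] := legendre_has_sup y.
by move=> _ [x _ <-].
Qed.

Lemma legendre_ge0 y : 0 <= legendre K y.
Proof. by have := young_inequality 0 y; rewrite Nfun0 mxdot0l add0r. Qed.

Lemma legendreN y : legendre K (- y) = legendre K y.
Proof.
have H z : legendre K (- z) <= legendre K z.
  apply: legendre_le => x; have := young_inequality (- x) z.
  by rewrite (Nfun_even KN) mxdotNl mxdotNr; lra.
by apply/le_anti; rewrite H -{1}(opprK y) H.
Qed.

(** A supremum of continuous functions is lower semicontinuous; this is how the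
conjugate is seen to be measurable. *)
Lemma legendre_gt_open (a : R) : continuous K -> open [set y | a < legendre K y].
Proof.
move=> cK.
have -> : [set y | a < legendre K y] =
    \bigcup_(x in setT) [set y | a < mxdot x y - K x].
  apply/seteqP; split=> y /=.
    move=> /sup_gt [|_ [x _ <-] ax]; first by have [] := legendre_has_sup y.
    by exists x.
  by move=> [x _ /= ax]; have := young_inequality x y; lra.
apply: bigcup_open => x _.
have cx : continuous (fun y => mxdot x y - K x).
  apply: smooth_continuous; apply: smoothD; last exact: smooth_cst.
  apply: smooth_mxdot; apply: smooth_mx => i j; apply: smooth_linear.
  - by move=> *; rewrite mxE.
  - by move=> *; rewrite mxE.
  - exact: coord_continuous.
exact: (@open_comp _ _ (fun y => mxdot x y - K x) [set r | a < r] (fun y _ => cx y) (@open_gt R a)).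
Qed.

(** The hypothesis at [z = 2 v] bounds [mxdot v e]; inserted in the hypothesis at
an arbitrary [z] this leaves a bound for the supremum over [z]. *)
Lemma legendre_scaled_le (q a : R) v e : 0 < q ->
  (forall z, mxdot (z - v) e <= q * K z + a) ->
  legendre K (q^-1 *: e) <= K (2 *: v) + 2 * a / q.
Proof.
move=> q0 H; apply: legendre_le => x; rewrite mxdotZr -(ler_pM2l q0).
have -> : q * (q^-1 * mxdot x e - K x) = mxdot x e - q * K x by field; rewrite gt_eqF.
have -> : q * (K (2 *: v) + 2 * a / q) = q * K (2 *: v) + 2 * a by field; rewrite gt_eqF.
have := H x; have := H (2 *: v).
by rewrite !mxdotBl mxdotZl; lra.
Qed.

Lemma Delta2_iter (G : 'rV[R]_n -> R) (k : nat) : Delta2 G -> (forall y, 0 <= G y) ->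
  exists2 C, 0 <= C & forall y, G (2 ^+ k *: y) <= C * (G y + 1).
Proof.
move=> [C0 HC0] G0.
have [C C1 HC] : exists2 C, 0 <= C & forall y, G (2 *: y) <= C * (G y + 1).
  exists `|C0| => // y; apply: (le_trans (HC0 y)); apply: ler_wpM2r (ler_norm _).
  by rewrite addr_ge0.
elim: k => [|k [D D0 HD]].
  by exists 1 => // y; rewrite expr0 scale1r mul1r lerDl.
exists (C * (D + 1)) => [|y]; first by rewrite mulr_ge0 // addr_ge0.
rewrite exprS -scalerA (le_trans (HC _)) // -mulrA ler_wpM2l //.
by have := HD y; have := G0 y; lra.
Qed.

Hypothesis Kstrict : strictly_convex K.
Hypothesis Kcont : continuous K.
Hypothesis Kder : forall x v, derivable K x v.

Lemma grad_inequality v x : K v + mxdot (x - v) (grad K v) <= K x.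
Proof.
have dK l : derivable K v (evec l) by exact: Kder.
have := convex_gradient x (Nfun_convex KN) dK; rewrite rv_mxdotE.
rewrite (eq_bigr (fun l => (x - v) ord0 l * grad K v ord0 l)) // => l _.
by congr (_ * _); rewrite mxE.
Qed.

Lemma grad_inequality_strict v x : x != v ->
  K v + mxdot (x - v) (grad K v) < K x.
Proof.
move=> xv; have h : 0 < (2^-1 : R) < 1 by lra.
have := Kstrict xv h.
have := grad_inequality v (2^-1 *: x + (1 - 2^-1) *: v).
have -> : 2^-1 *: x + (1 - 2^-1) *: v - v = 2^-1 *: (x - v).
  by rewrite scalerBl scale1r scalerBr addrA addrAC addrK.
rewrite mxdotZl; lra.
Qed.

Lemma entry_le_mxnorm x l : `|x ord0 l| <= `|x|.
Proof. by rewrite [leRHS]/Num.Def.normr/= mx_normrE (le_bigmax _ _ (ord0, l)). Qed.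

(** The Bregman distance to [v] is positive on the sphere of radius [r] by strict
convexity, so it has a positive minimum there by compactness; outside the sphere
convexity along the rays from [v] makes it grow at least linearly. *)
Lemma bregman_lower v (r : R) : 0 < r -> exists2 m, 0 < m &
  forall x, r <= `|x - v| ->
    m * `|x - v| <= K x - K v - mxdot (x - v) (grad K v).
Proof.
move=> r0; pose psi x := K x - K v - mxdot (x - v) (grad K v).
pose S := [set x : 'rV[R]_n | `|x - v| = r].
have [m m0 Hm] : exists2 m, 0 < m & forall x, S x -> m <= psi x.
  have [[x0 Sx0]|S0] := pselect (S !=set0); last first.
    by exists 1 => // x Sx; exfalso; apply: S0; exists x.
  have cS : compact S.
    apply: bounded_closed_compact.
      exists (r + `|v|); split; first exact: num_real.
      move=> b rb x Sx; apply/ltW; apply: le_lt_trans rb.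
      by rewrite -{1}(subrK v x) (le_trans (ler_normD _ _)) // lerD2r Sx.
    have cn : continuous (fun x => `|x - v|).
      move=> x; apply: (@continuous_comp _ _ _ (fun x => x - v) Num.Def.normr).
        by apply: (@continuous_sub _ _ _ id (cst v)) => y; [exact: cvg_id|exact: cst_continuous].
      exact: norm_continuous.
    exact: (@preimage_closed _ _ (fun x => `|x - v|) [set y | y = r] (fun x _ => cn x)
      (@closed_eq R r)).
  have cl : continuous (fun x => mxdot (grad K v) (x - v)).
    apply: smooth_continuous; apply: smooth_mxdot; apply: smooth_mx => i j.
    apply: (@smooth_eq _ _ _ (fun x => x i j + - v i j)) => [y|].
      by rewrite !mxE.
    apply: smoothD; last exact: smooth_cst.
    apply: smooth_linear.
    - by move=> *; rewrite mxE.
    - by move=> *; rewrite mxE.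
    - exact: coord_continuous.
  have cpsi : continuous psi.
    have -> : psi = (fun x => K x - (K v) - mxdot (grad K v) (x - v)).
      by apply/funext => x; rewrite /psi mxdotC.
    apply: continuous_sub cl; apply: continuous_sub Kcont _.
    exact: cst_continuous.
  have [c + Hc] := EVT_min_rV (ex_intro _ x0 Sx0) cS (continuous_subspaceT cpsi).
  rewrite inE => Sc; exists (psi c).
    have cv : c != v.
      by apply/eqP => cv; move: Sc; rewrite /S /= cv subrr normr0 => /eqP;
        rewrite lt_eqF.
    by rewrite /psi; have := grad_inequality_strict cv; lra.
  by move=> x Sx; apply: Hc; rewrite inE.
exists (m / r) => [|x rx]; first exact: divr_gt0.
set s := `|x - v| in rx *; have s0 : 0 < s by exact: lt_le_trans rx.
have t01 : 0 <= r / s <= 1.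
  by rewrite (divr_ge0 (ltW r0) (ltW s0)) /= ler_pdivrMr // mul1r.
have := convexP x v (Nfun_convex KN) t01; set y := _ + _.
have yv : y - v = (r / s) *: (x - v).
  by rewrite /y scalerBl scale1r scalerBr addrA addrAC addrK.
have Sy : S y.
  rewrite /S /= yv normrZ -/s normrM normfV (gtr0_norm r0) (gtr0_norm s0) divfK //.
  by rewrite gt_eqF.
have := Hm _ Sy; rewrite /psi yv mxdotZl => h1 h2.
have h3 : m <= (r / s) * psi x by rewrite /psi; lra.
have := ler_wpM2l (divr_ge0 (ltW s0) (ltW r0)) h3; rewrite mulrA.
have -> : s / r * (r / s) = 1 by field; rewrite !gt_eqF.
by rewrite mul1r /psi => h4; apply: le_trans h4; rewrite mulrC mulrA mulrAC.
Qed.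

(** By the Bregman bound a maximiser for a slope near [grad K v] lies near [v],
which makes the conjugate differentiable at [grad K v]. *)
Lemma grad_legendre_grad v : grad (legendre K) (grad K v) = v.
Proof.
apply/rowP => l; rewrite mxE; set p := grad K v.
have lo s : mxdot v (p + s *: evec l) - K v <= legendre K (p + s *: evec l).
  by have := young_inequality v (p + s *: evec l); lra.
have p0 : legendre K p = mxdot v p - K v.
  apply/le_anti/andP; split; last by have := lo 0; rewrite scale0r addr0.
  by apply: legendre_le => x; have := grad_inequality v x; rewrite mxdotBl; lra.
have dote x s : mxdot x (p + s *: evec l) = mxdot x p + s * x ord0 l.
  by rewrite mxdotDr mxdotZr /evec mxdot_delta.
apply: cvg_lim => //; apply/cvgrPdist_le => e e0.
have [m m0 Hm] := bregman_lower v e0.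
near=> s.
have sn0 : s != 0 by near: s; exact: nbhs_dnbhs_neq.
have sm : `|s| <= m by near: s; exact: dnbhs0_le.
have s0 : 0 < `|s| by rewrite normr_gt0.
have hi : legendre K (p + s *: evec l) <=
    mxdot v (p + s *: evec l) - K v + `|s| * e.
  apply: legendre_le => x; rewrite !dote.
  have E : s * x ord0 l - s * v ord0 l <= `|s| * `|x - v|.
    rewrite -mulrBr (le_trans (ler_norm _)) // normrM ler_wpM2l //.
    by have := entry_le_mxnorm (x - v) l; rewrite !mxE.
  have [xe|xe] := leP e `|x - v|.
    have := Hm x xe; have := ler_wpM2r (normr_ge0 (x - v)) sm.
    have : 0 <= `|s| * e by rewrite mulr_ge0 // ltW.
    by rewrite mxdotBl; lra.
  have := ler_wpM2l (normr_ge0 s) (ltW xe).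
  by have := grad_inequality v x; rewrite mxdotBl; lra.
rewrite /= [s *: _ + p]addrC p0.
have := lo s; move: hi; rewrite !dote; set k := legendre K _ => hi lo'.
rewrite -(ler_pM2l s0) -normrM mulrBr.
have -> : s * (s^-1 *: (k - (mxdot v p - K v))) = k - (mxdot v p - K v).
  by rewrite /GRing.scale /= mulrA mulfV // mul1r.
by rewrite ler_norml; apply/andP; split; lra.
Unshelve. all: by end_near. Qed.

End conjugate.

(** * Measurability of continuous functions of vectors *)

Section borel.
Context (R : realType) (dS : measure_display) (S : measurableType dS).

(** Every open set of row vectors is a countable union of boxes with rational
centres. *)
Lemma measurable_preimage_open n (D : set S) (f : S -> 'rV[R]_n) (U : set 'rV[R]_n) :
  measurable D -> mx_measurable D f -> open U -> measurable (D `&` f @^-1` U).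
Proof.
move=> mD mf oU.
pose B (p : 'rV[rat]_n * nat) := [set y : 'rV[R]_n |
  forall i, `|y ord0 i - ratr (p.1 ord0 i)| < p.2.+1%:R^-1].
pose A p := if `[< B p `<=` U >] then D `&` f @^-1` B p else set0.
have -> : D `&` f @^-1` U = \bigcup_p A p.
  apply/seteqP; split=> [z [Dz Uz]|z [p _]]; last first.
    by rewrite /A; case: asboolP => // BU [Dz Bz]; split=> //; exact: BU.
  have [e e0 eU] : exists2 e : R, 0 < e & forall y : 'rV[R]_n,
      (forall i, `|f z ord0 i - y ord0 i| < e) -> U y.
    have /nbhs_ballP[e e0 eU] := open_nbhs_nbhs (conj oU Uz).
    by exists e => // y fy; apply: eU; split=> // i j; rewrite ord1; exact: fy.
  have [k ke] : exists k : nat, k.+1%:R^-1 < e / 2.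
    have e2 : 0 < e / 2 by rewrite divr_gt0.
    have [k _ /(_ k (leqnn k))] := near_infty_natSinv_lt (PosNum e2).
    by exists k.
  have q i : {q : rat | `|f z ord0 i - ratr q| < k.+1%:R^-1}.
    have : f z ord0 i - k.+1%:R^-1 < f z ord0 i + k.+1%:R^-1.
      by rewrite ltrD2l gt0_cp // invr_gt0.
    move=> /rat_in_itvoo/cid[q]; rewrite in_itv /= => /andP[h1 h2].
    by exists q; rewrite ltr_distlC h1 h2.
  exists (\row_i sval (q i), k) => //; rewrite /A.
  case: asboolP => [_|[]]; first by split=> // i /=; rewrite mxE; exact: svalP (q i).
  move=> y /= By; apply: eU => i; have := By i; rewrite mxE => h1.
  have h2 := svalP (q i); apply: (le_lt_trans (ler_distD (ratr (sval (q i))) _ _)).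
  rewrite (splitr e) ltrD //; first exact: lt_trans ke.
  by rewrite distrC; exact: lt_trans ke.
apply: countable_bigcupT_measurable => // p; rewrite /A; case: asboolP => // _.
have -> : D `&` f @^-1` B p = D `&` \bigcap_(i in [set: 'I_n])
    (D `&` (fun z => f z ord0 i) @^-1`
       `]ratr (p.1 ord0 i) - p.2.+1%:R^-1, ratr (p.1 ord0 i) + p.2.+1%:R^-1[).
  apply/seteqP; split=> z [Dz Bz]; split=> //.
    move=> i _; split=> //=; have := Bz i; rewrite in_itv /= ltr_distl; exact.
  move=> i; have [_] := Bz i I; rewrite /= in_itv /= ltr_distl; exact.
apply: measurableI => //.
apply: fin_bigcap_measurable => // i _.
exact: (mf ord0 i mD).
Qed.

Lemma measurable_lower_semicontinuous n (D : set S) (f : S -> 'rV[R]_n)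
  (g : 'rV[R]_n -> R) : measurable D -> mx_measurable D f ->
  (forall a, open [set y | a < g y]) -> measurable_fun D (fun z => g (f z)).
Proof.
move=> mD mf og; apply: (measurability _ (RGenOInfty.measurableE R)).
move=> _ [_ [a ->] <-].
have -> : (fun z => g (f z)) @^-1` `]a, +oo[ = f @^-1` [set y | a < g y].
  by apply/seteqP; split=> z /=; rewrite in_itv /= andbT.
exact: measurable_preimage_open.
Qed.

Lemma measurable_continuous n (D : set S) (f : S -> 'rV[R]_n)
  (g : 'rV[R]_n -> R) : measurable D -> mx_measurable D f ->
  continuous g -> measurable_fun D (fun z => g (f z)).
Proof.
move=> mD mf cg; apply: measurable_lower_semicontinuous => // a.
exact: (@open_comp _ _ g [set r | a < r] (fun y _ => cg y) (@open_gt R a)).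
Qed.

Lemma measurable_mxdot m n (D : set S) (A B : S -> 'M[R]_(m, n)) :
  mx_measurable D A -> mx_measurable D B ->
  measurable_fun D (fun z => mxdot (A z) (B z)).
Proof.
move=> mA mB; apply: measurable_sum => i; apply: measurable_sum => j.
exact: measurable_funM.
Qed.

End borel.

(** Space-time points are read as row vectors with one more entry. *)
Lemma measurable_continuous_st (R : realType) d
  (D : set (measurableTypeR R * 'rV[R]_d)) (f : R * 'rV[R]_d -> R) :
  measurable D -> continuous f -> measurable_fun D f.
Proof.
move=> mD cf.
pose u (y : 'rV[R]_d.+1) : R * 'rV[R]_d := (y ord0 ord0, \row_i y ord0 (lift ord0 i)).
pose c (z : measurableTypeR R * 'rV[R]_d) : 'rV[R]_d.+1 :=
  \row_i (if unlift ord0 i is Some j then z.2 ord0 j else z.1).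
have cK z : u (c z) = z.
  case: z => t x; rewrite /u /c mxE unlift_none; congr pair.
  by apply/rowP => i; rewrite !mxE liftK.
have -> : f = fun z => f (u (c z)) by apply/funext => z; rewrite cK.
apply: (@measurable_continuous _ _ _ _ _ c (f \o u)) => //.
  move=> i0 i; rewrite /c; under eq_fun do rewrite mxE.
  case: (unlift ord0 i) => [j|]; last exact: measurable_funTS measurable_fst.
  apply: (@measurable_funTS _ _ _ _ _ (fun z : measurableTypeR R * 'rV[R]_d => z.2 ord0 j)).
  exact: measurableT_comp (@measurable_rV_coord R d j) measurable_snd.
move=> y; apply: (@continuous_comp _ _ _ u f); last exact: cf.
have c1 : (fun y : 'rV[R]_d.+1 => y ord0 ord0) @ nbhs y --> nbhs (y ord0 ord0).
  exact: coord_continuous.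
have c2 : (fun y : 'rV[R]_d.+1 => \row_(i < d) y ord0 (lift ord0 i)) @ nbhs y -->
    nbhs (\row_(i < d) y ord0 (lift ord0 i)).
  have : continuous (fun y : 'rV[R]_d.+1 => \row_(i < d) y ord0 (lift ord0 i)).
    apply: continuous_mx => i j; under eq_fun do rewrite mxE.
    exact: coord_continuous.
  exact.
exact: cvg_pair c1 c2.
Qed.

(** * Integrable real functions *)

Section integrable_real.
Context (R : realType) (dS : measure_display) (S : measurableType dS).
Context (mu : {measure set S -> \bar R}) (D : set S) (mD : measurable D).
Implicit Types (f g : S -> R).

Definition rintegrable f := mu.-integrable D (EFin \o f).

Lemma rintegrable_measurable f : rintegrable f -> measurable_fun D f.
Proof. by move=> /measurable_int /measurable_EFinP. Qed.

Lemma rintegrableD f g : rintegrable f -> rintegrable g ->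
  rintegrable (fun x => f x + g x).
Proof. by move=> fi gi; have := integrableD mD fi gi. Qed.

Lemma rintegrableB f g : rintegrable f -> rintegrable g ->
  rintegrable (fun x => f x - g x).
Proof. by move=> fi gi; have := integrableB mD fi gi. Qed.

Lemma rintegrableZ (c : R) f : rintegrable f -> rintegrable (fun x => c * f x).
Proof. by move=> fi; have := integrableZl mD c fi. Qed.

Lemma rintegrable_eq f g : (forall x, D x -> f x = g x) ->
  rintegrable f -> rintegrable g.
Proof.
move=> fg; apply: eq_integrable => // x; rewrite inE => Dx.
by rewrite /= fg.
Qed.

Lemma rintegrable_support (A : set S) f : measurable A -> A `<=` D ->
  (forall x, D x -> ~ A x -> f x = 0) -> mu.-integrable A (EFin \o f) ->
  rintegrable f.
Proof.
move=> mA AD f0 fi; apply/(integrable_mkcond _ mD).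
have := fi; rewrite (integrable_mkcond _ mA); apply: eq_integrable => // x _.
rewrite !patchE; case: ifPn => [|]; case: ifPn => //.
- by rewrite notin_setE inE => nD /AD.
- by rewrite inE notin_setE => Dx Ax; rewrite /= f0.
Qed.

Lemma rintegrable_sum (I : Type) (r : seq I) (F : I -> S -> R) :
  (forall i, rintegrable (F i)) -> rintegrable (fun x => \sum_(i <- r) F i x).
Proof.
move=> Fi; have := @integrable_sum _ _ _ mu D mD I r xpredT (fun i => EFin \o F i)
  (fun i _ => Fi i).
by apply: eq_integrable => // x _; rewrite /= sumEFin.
Qed.

Lemma rintegrable_abs f : rintegrable f -> rintegrable (fun x => `|f x|).
Proof.
by move=> fi; have := integrable_abse fi.
Qed.

Lemma rintegrable_le f g : measurable_fun D f -> rintegrable g ->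
  (forall x, D x -> `|f x| <= g x) -> rintegrable f.
Proof.
move=> mf gi fg; apply: (@le_integrable _ _ _ mu D mD _ (EFin \o g)) => //.
  exact/measurable_EFinP.
by move=> x Dx /=; rewrite lee_fin (le_trans (fg x Dx)) // ler_norm.
Qed.

Lemma rintegrable_bounded_mul (C : R) f g : measurable_fun D f ->
  (forall x, D x -> `|f x| <= C) -> rintegrable g ->
  rintegrable (fun x => f x * g x).
Proof.
move=> mf fC gi.
apply: (@rintegrable_le _ (fun x => C * `|g x|)).
- exact: measurable_funM mf (rintegrable_measurable gi).
- exact/rintegrableZ/rintegrable_abs.
- by move=> x Dx; rewrite normrM ler_wpM2r // fC.
Qed.

Lemma rintegrable_ae_eq f g : measurable_fun D g -> rintegrable f ->
  {ae mu, forall x, D x -> f x = g x} -> rintegrable g.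
Proof.
move=> mg fi fg; apply/integrableP; split; first exact/measurable_EFinP.
have [_] := integrableP _ _ _ fi; congr (is_true (_ < _)%E).
apply: ge0_ae_eq_integral => //.
- by apply: measurableT_comp => //; exact: measurable_int fi.
- by apply: measurableT_comp => //; exact/measurable_EFinP.
- by apply: filterS fg => x fgx Dx /=; rewrite fgx.
Qed.

(** The truncation of [f] between [- g] and [g] is dominated everywhere and agrees
with [f] almost everywhere. *)
Lemma rintegrable_ae_le f g : measurable_fun D f -> rintegrable g ->
  {ae mu, forall x, D x -> `|f x| <= g x} -> rintegrable f.
Proof.
move=> mf gi fg; have mg := rintegrable_measurable gi.
pose h x := Num.min (Num.max (f x) (- g x)) (g x).
have ng : measurable_fun D (fun x => - g x) by exact: measurableT_comp.
apply: (@rintegrable_ae_eq h) => //.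
  apply: (@rintegrable_le h (fun x => `|g x|)) => //.
  - by apply: measurable_minr => //; exact: measurable_maxr.
  - exact: rintegrable_abs.
  - move=> x _; rewrite /h ler_norml le_min ge_min ler_norm orbT andbT.
    rewrite le_max [_ <= - g x]lerN2 ler_norm orbT /=.
    by rewrite lerNl -normrN ler_norm.
apply: filterS fg => x fgx Dx; have /ler_normlP[h1 h2] := fgx Dx.
by rewrite /h (max_l _) 1?(min_l _) // lerNl.
Qed.

Lemma rintegrable_finite (C : R) f : (mu D < +oo)%E -> measurable_fun D f ->
  (forall x, D x -> `|f x| <= C) -> rintegrable f.
Proof.
move=> muD mf fC; apply: measurable_bounded_integrable => //.
exists C; split; first exact: num_real.
by move=> M CM x Dx; exact: le_trans (fC x Dx) (ltW CM).
Qed.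

Lemma integral_ae_eq0 f g : measurable_fun D f -> measurable_fun D g ->
  {ae mu, forall x, D x -> f x = g x} ->
  (\int[mu]_(x in D) (f x)%:E = \int[mu]_(x in D) (g x)%:E)%E.
Proof.
move=> mf mg fg; apply: ae_eq_integral => //; try exact/measurable_EFinP.
by apply: filterS fg => x fgx Dx /=; rewrite fgx.
Qed.

Lemma integral_addr f g : rintegrable f -> rintegrable g ->
  (\int[mu]_(x in D) (f x + g x)%:E =
   \int[mu]_(x in D) (f x)%:E + \int[mu]_(x in D) (g x)%:E)%E.
Proof.
move=> fi gi; rewrite -(@integralD _ _ _ mu D mD _ _ fi gi).
by apply: eq_integral => x _; rewrite EFinD.
Qed.

Lemma integral_subr f g : rintegrable f -> rintegrable g ->
  (\int[mu]_(x in D) (f x - g x)%:E =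
   \int[mu]_(x in D) (f x)%:E - \int[mu]_(x in D) (g x)%:E)%E.
Proof. by move=> fi gi; rewrite -(integralB_EFin mD fi gi). Qed.

Lemma dominated_limit (f_ : nat -> S -> R) f g : rintegrable g ->
  (forall k, measurable_fun D (f_ k)) -> measurable_fun D f ->
  {ae mu, forall x, D x -> forall k, `|f_ k x| <= g x} ->
  (forall x, D x -> f_ k x @[k --> \oo] --> f x) ->
  (forall k, \int[mu]_(x in D) (f_ k x)%:E = 0)%E ->
  (\int[mu]_(x in D) (f x)%:E = 0)%E.
Proof.
move=> gi mf_ mf f_g f_f H.
have mf_E k : measurable_fun D (EFin \o f_ k) by exact/measurable_EFinP.
have mfE : measurable_fun D (EFin \o f) by exact/measurable_EFinP.
have lim : {ae mu, forall x, D x -> (EFin \o f_ k) x @[k --> \oo] --> (EFin \o f) x}.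
  apply: aeW => x Dx; apply: cvg_EFin; last exact: f_f.
  exact: nearW.
have dom : {ae mu, forall x k, D x -> (`|(EFin \o f_ k) x| <= (EFin \o g) x)%E}.
  by apply: filterS f_g => x f_g k Dx /=; rewrite lee_fin f_g.
have [_ _] := dominated_convergence mD mf_E mfE lim gi dom.
have -> : [sequence (\int[mu]_(x in D) (EFin \o f_ k) x)%E]_k = cst 0%E.
  by apply/funext => k; exact: H.
move=> lim0; apply: (cvg_unique _ lim0); first exact: ereal_hausdorff.
exact: cvg_cst.
Qed.

End integrable_real.

(** * The space-time cylinder *)

Section cylinder.
Context (R : realType) (d : nat).
Local Notation mu := ((@lebesgue_measure R) \x (lebesgue_rV R d))%E.
Local Notation ST := (measurableTypeR R * 'rV[R]_d)%type.

Definition slab (a b : R) : set ST := `[a, b] `*` torus d.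

Lemma measurable_torus : measurable (torus d : set 'rV[R]_d).
Proof.
have -> : torus d = [set x : 'rV[R]_d | forall i, `[0, 1[%classic (x ord0 i)].
  by apply/seteqP; split=> x H i; have := H i; rewrite /= in_itv.
exact: (@measurable_rV_prod R d (fun=> `[0, 1[%classic) (fun=> measurable_itv _)).
Qed.

Lemma measurable_cylinder T : measurable (cylinder d T : set ST).
Proof. by apply: measurableX; [exact: measurable_itv|exact: measurable_torus]. Qed.

Lemma measurable_slab a b : measurable (slab a b).
Proof. by apply: measurableX; [exact: measurable_itv|exact: measurable_torus]. Qed.

Lemma lebesgue_torus : lebesgue_rV R d (torus d) = 1%E.
Proof.
have -> : torus d = [set x : 'rV[R]_d | forall i, `[0, 1[%classic (x ord0 i)].
  by apply/seteqP; split=> x H i; have := H i; rewrite /= in_itv.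
rewrite (@lebesgue_rV_prod R d (fun=> `[0, 1[%classic) (fun=> measurable_itv _)).
by apply: big1 => i _; rewrite lebesgue_measure_itv /= lte01 oppr0 adde0.
Qed.

Lemma cylinder_finite T : (mu (cylinder d T) < +oo)%E.
Proof.
rewrite product_measure1E; [|exact: measurable_itv|exact: measurable_torus].
rewrite lebesgue_torus mule1.
suff : (lebesgue_measure (`]0%R, T[%classic : set R) < +oo)%E by [].
rewrite lebesgue_measure_itv /=.
by case: ifP => // _; rewrite -EFinB ltry.
Qed.

Lemma slab_cylinder a b T : 0 < a -> b < T -> slab a b `<=` cylinder d T.
Proof.
move=> a0 bT [t x] [/= + tx]; rewrite in_itv /= => /andP[at_ tb]; split=> //=.
by rewrite in_itv /= (lt_le_trans a0 at_) (le_lt_trans tb bT).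
Qed.

Lemma continuous_bounded (f : R * 'rV[R]_d -> R) a b : continuous f ->
  exists2 C, 0 <= C & forall z, slab a b z -> `|f z| <= C.
Proof.
move=> cf.
pose K : set (R * 'rV[R]_d) :=
  `[a, b] `*` [set x : 'rV[R]_d | forall i, `[0, 1]%classic (x ord0 i)].
have sK : slab a b `<=` K.
  move=> [t x] [/= tab tx]; split=> //= i.
  by have /andP[h1 h2] := tx i; rewrite in_itv /= h1 ltW.
have cK : compact K.
  by apply: compact_setX; [exact: segment_compact|
    exact: (@rV_compact R d (fun=> `[0, 1]%classic) (fun=> @segment_compact R 0 1))].
have cfn : {within K, continuous (fun z => `|f z|)}.
  apply: continuous_subspaceT => z.
  by apply: (@continuous_comp _ _ _ f Num.Def.normr); [exact: cf|exact: norm_continuous].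
have [[z0 Kz0]|K0] := pselect (K !=set0); last first.
  by exists 0 => // z /sK Kz; exfalso; apply: K0; exists z.
have [c _ Hc] := compact_EVT_max (ex_intro _ z0 Kz0) cK cfn.
by exists `|f c| => // z /sK Kz; apply: Hc; rewrite inE.
Qed.

Lemma integral_support (D A : set ST) (f : ST -> R) : A `<=` D ->
  (forall z, D z -> ~ A z -> f z = 0) ->
  (\int[mu]_(z in D) (f z)%:E = \int[mu]_(z in A) (f z)%:E)%E.
Proof.
move=> AD f0; rewrite integral_mkcond [RHS]integral_mkcond; congr integral.
apply/funext => z; rewrite !patchE; case: ifPn => [|]; case: ifPn => //.
- by rewrite notin_setE inE => Az Dz; rewrite f0.
- by rewrite inE => Az; rewrite notin_setE => /(_ (AD _ Az)).
Qed.

End cylinder.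

(** * The fundamental lemma of the calculus of variations *)

Section gate.
Context (R : realType).
Implicit Types (a b s : R).

(** Each factor changes sign under a unit translation, so the product has period
one; on the unit interval it is positive exactly between [a] and [b]. *)
Definition gate a b s := sin (pi * (s - a)) * sin (pi * (b - s)).

Lemma gate_gt0 a b s : 0 <= a -> b <= 1 -> a < b -> 0 <= s < 1 ->
  (0 < gate a b s) = (a < s < b).
Proof.
move=> a0 b1 ab /andP[s0 s1]; rewrite /gate.
have p0 := pi_gt0 R.
have ge0 (y : R) : 0 <= y <= 1 -> 0 <= sin (pi * y).
  by move=> /andP[y0 y1]; apply: sin_ge0_pi; rewrite (mulr_ge0 (ltW p0) y0) /=
    (ler_piMr (ltW p0) y1).
have gt0 (y : R) : 0 < y < 1 -> 0 < sin (pi * y).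
  by move=> /andP[y0 y1]; apply: sin_gt0_pi; rewrite (mulr_gt0 p0 y0) /= gtr_pMr.
have le0 (y : R) : -1 <= y <= 0 -> sin (pi * y) <= 0.
  move=> y1; rewrite -oppr_ge0 -sinN -mulrN; apply: ge0; lra.
have [as_|sa] := ltP a s => /=.
  have [sb|bs] := ltP s b.
    by rewrite mulr_gt0 // gt0 //; lra.
  by apply/negbTE; rewrite -leNgt mulr_ge0_le0 ?ge0 ?le0 //; lra.
by apply/negbTE; rewrite -leNgt mulr_le0_ge0 ?ge0 ?le0 //; lra.
Qed.

Lemma gate_periodic a b s : gate a b (s + 1) = gate a b s.
Proof.
rewrite /gate.
have -> : pi * (s + 1 - a) = pi * (s - a) + pi :> R by ring.
have -> : pi * (b - s) = pi * (b - (s + 1)) + pi :> R by ring.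
by rewrite !sinDpi; ring.
Qed.

Lemma smooth_affine (p q : R) : smooth (fun s : R => p * s + q).
Proof.
apply: smoothD; last exact: smooth_cst.
by apply: smoothM; [exact: smooth_cst|exact: smooth_id].
Qed.

Lemma smooth_gate a b : smooth (gate a b).
Proof.
have s1 : smooth (fun s : R => pi * (s - a)).
  by apply: smooth_eq (smooth_affine pi (- (pi * a))) => s; ring.
have s2 : smooth (fun s : R => pi * (b - s)).
  by apply: smooth_eq (smooth_affine (- pi) (pi * b)) => s; ring.
have s3 := smooth_comp (@smooth_sin R) s1; have s4 := smooth_comp (@smooth_sin R) s2.
by apply: smooth_eq (smoothM s3 s4) => s.
Qed.

Lemma cutoff_limit (q : R) : cutoff (k%:R * q) @[k --> \oo] --> ((0 < q)%R%:R : R).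
Proof.
have [q0|q0] := ltP 0 q => /=; last first.
  by apply: cvg_near_cst; near=> k; rewrite cutoff_le0 // mulr_ge0_le0.
have H : (- (k.+1%:R * q)^-1) @[k --> \oo] --> (0 : R).
  have -> : (fun k => - (k.+1%:R * q)^-1) = (fun k => (- q^-1) * k.+1%:R^-1).
    by apply/funext => k; rewrite invfM; ring.
  rewrite -(mulr0 (- q^-1)); apply: cvgM; first exact: cvg_cst.
  exact: cvg_harmonic.
have := cvg_comp _ _ H (@continuous_expR R 0); rewrite expR0 => H1.
rewrite -(cvg_shiftS (fun k => cutoff (k%:R * q))).
rewrite (_ : (fun k => _) = (expR \o (fun k : nat => - (k.+1%:R * q)^-1))) //.
by apply/funext => k /=; rewrite cutoffE // mulr_gt0.
Unshelve. all: by end_near. Qed.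

End gate.

Section open_boxes.
Context (R : realType) (d : nat).
Local Notation ST := (measurableTypeR R * 'rV[R]_d)%type.

Definition open_box (a b : R) (A B : 'I_d -> R) : set ST :=
  [set z : ST | a < z.1 < b /\ forall i, A i < z.2 ord0 i < B i].

Definition open_boxes : set (set ST) :=
  [set X | exists a b A B, X = open_box a b A B].

Lemma measurable_open_box a b A B : measurable (open_box a b A B).
Proof.
have -> : open_box a b A B =
    `]a, b[ `*` [set x : 'rV[R]_d | forall i, `]A i, B i[%classic (x ord0 i)].
  apply/seteqP; split=> -[t x] [/=].
    by move=> h1 h2; split=> [|i]; rewrite /= in_itv /=.
  by rewrite in_itv /= => h1 h2; split=> // i; have := h2 i; rewrite /= in_itv.
apply: measurableX; first exact: measurable_itv.
exact: (@measurable_rV_prod R d (fun i => `]A i, B i[%classic) (fun=> measurable_itv _)).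
Qed.

Lemma open_boxI a b A B a' b' A' B' : open_box a b A B `&` open_box a' b' A' B' =
  open_box (Num.max a a') (Num.min b b') (fun i => Num.max (A i) (A' i))
    (fun i => Num.min (B i) (B' i)).
Proof.
apply/seteqP; split=> z.
  move=> [[/andP[h1 h2] h3] [/andP[h1' h2'] h3']]; split=> [|i].
    by rewrite gt_max lt_min h1 h2 h1' h2'.
  have /andP[k1 k2] := h3 i; have /andP[k1' k2'] := h3' i.
  by rewrite gt_max lt_min k1 k2 k1' k2'.
move=> [h1 h2]; move: h1; rewrite gt_max lt_min => /andP[/andP[l1 l2] /andP[l3 l4]].
split; split=> [|i]; rewrite ?l1 ?l2 ?l3 ?l4 //.
  by have := h2 i; rewrite gt_max lt_min => /andP[/andP[-> _] /andP[-> _]].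
by have := h2 i; rewrite gt_max lt_min => /andP[/andP[_ ->] /andP[_ ->]].
Qed.

Lemma open_boxes_setI : setI_closed open_boxes.
Proof.
move=> _ _ [a [b [A [B ->]]]] [a' [b' [A' [B' ->]]]].
by rewrite open_boxI; do 4 eexists.
Qed.

Lemma nat_bounds_finite (r : 'I_d -> R) (t : R) : exists k : nat,
  t < k%:R /\ forall i, `|r i| < k%:R.
Proof.
pose M : R := `|t| + \sum_i `|r i|.
have M0 : 0 <= M by rewrite addr_ge0 // sumr_ge0.
exists (Num.bound M); have HM := archi_boundP M0; split.
  apply: le_lt_trans HM; rewrite (le_trans (ler_norm t)) // lerDl sumr_ge0 //.
move=> i; apply: le_lt_trans HM; rewrite /M (bigD1 i) //= addrCA lerDl.
by rewrite addr_ge0 // sumr_ge0.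
Qed.

(** Half-spaces are countable unions of open boxes, and half-spaces already
make all coordinates measurable. *)
Lemma measurable_open_boxes : @measurable _ ST = <<s open_boxes >>.
Proof.
apply/seteqP; split=> [X mX|]; last first.
  apply: smallest_sub; first exact: sigma_algebra_measurable.
  by move=> _ [a [b [A [B ->]]]]; exact: measurable_open_box.
pose T' := g_sigma_algebraType open_boxes.
have mbox a b A B : measurable (open_box a b A B : set T').
  by apply: sub_sigma_algebra; exists a, b, A, B.
have m1 : measurable_fun setT (fun z : T' => z.1 : measurableTypeR R).
  apply: (measurability _ (RGenOInfty.measurableE R)) => _ [_ [a ->] <-].
  rewrite setTI.
  have -> : (fun z : T' => z.1 : measurableTypeR R) @^-1` `]a, +oo[ =
     \bigcup_(k : nat) open_box a k%:R (fun=> - k%:R) (fun=> k%:R).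
    apply/seteqP; split=> [z /=|z [k _ [/andP[h _] _]] /=]; rewrite in_itv /= andbT //.
    move=> az; have [k [h1 h2]] := nat_bounds_finite (fun i => z.2 ord0 i) z.1.
    exists k => //; split; first by rewrite az.
    by move=> i; have /ltr_normlP[h3 h4] := h2 i; rewrite h4 andbT ltrNl.
  by apply: bigcupT_measurable => k; exact: mbox.
have m2 : measurable_fun setT (fun z : T' => z.2 : 'rV[R]_d).
  apply: measurable_fun_rVP => i.
  apply: (measurability _ (RGenOInfty.measurableE R)) => _ [_ [a ->] <-].
  rewrite setTI.
  have -> : (fun z : T' => z.2 ord0 i : measurableTypeR R) @^-1` `]a, +oo[ =
     \bigcup_(k : nat) open_box (- k%:R) k%:R (fun j => if j == i then a else - k%:R)
       (fun=> k%:R).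
    apply/seteqP; split=> [z /=|z [k _ [_ h]] /=]; last first.
      by have := h i; rewrite eqxx in_itv /= andbT => /andP[].
    rewrite in_itv /= andbT => az.
    have [k [h1 h2]] := nat_bounds_finite (fun i => z.2 ord0 i) `|z.1|.
    exists k => //; split; first by have /ltr_normlP[h3 h4] := h1; rewrite h4 andbT ltrNl.
    move=> j; have /ltr_normlP[h3 h4] := h2 j; rewrite h4 andbT.
    by case: eqP => [->//|_]; rewrite ltrNl.
  by apply: bigcupT_measurable => k; exact: mbox.
have mid : measurable_fun setT (fun z : T' => (z.1, z.2) : ST).
  exact: measurable_fun_pair.
have := mid measurableT X mX; rewrite setTI.
by rewrite (_ : _ @^-1` X = X) //; apply/seteqP; split=> -[].
Qed.

End open_boxes.

Section fundamental_lemma.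
Context (R : realType) (d : nat) (T : R).
Local Notation mu := ((@lebesgue_measure R) \x (lebesgue_rV R d))%E.
Local Notation ST := (measurableTypeR R * 'rV[R]_d)%type.
Variable f : R * 'rV[R]_d -> R.
Hypothesis f_int : forall a b, 0 < a -> b < T -> rintegrable mu (slab a b) f.
Hypothesis f_test : forall phi : R * 'rV[R]_d -> R, test_st T phi ->
  (\int[mu]_(z in cylinder d T) (f z * phi z)%:E = 0)%E.

Section box_test.
Variables (a b : R) (A B : 'I_d -> R).
Hypothesis a0 : 0 < a.
Hypothesis bT : b < T.
Hypothesis AB : forall i, [/\ 0 <= A i, B i <= 1 & A i < B i].

(** Smooth, periodic in space, and converging to the indicator function of an
open box as [k] grows ([box_bump_limit]). *)
Definition box_bump (k : nat) (z : R * 'rV[R]_d) : R :=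
  cutoff (k%:R * (z.1 - a)) * cutoff (k%:R * (b - z.1)) *
  \prod_i cutoff (k%:R * gate (A i) (B i) (z.2 ord0 i)).

Lemma box_bump_ge0 k z : 0 <= box_bump k z.
Proof.
rewrite /box_bump mulr_ge0 ?mulr_ge0 ?cutoff_ge0 // prodr_ge0 // => i _.
exact: cutoff_ge0.
Qed.

Lemma box_bump_le1 k z : box_bump k z <= 1.
Proof.
rewrite /box_bump mulr_ile1 ?mulr_ge0 ?cutoff_ge0 //.
- by apply: prodr_ge0 => i _; exact: cutoff_ge0.
- by rewrite mulr_ile1 ?cutoff_ge0 ?cutoff_le1.
- by apply: prodr_ile1 => i _; rewrite cutoff_ge0 cutoff_le1.
Qed.

Lemma box_bump_support k t x : t <= a \/ b <= t -> box_bump k (t, x) = 0.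
Proof.
rewrite /box_bump => -[h|h].
  by rewrite cutoff_le0 ?mul0r // mulr_ge0_le0 // subr_le0.
by rewrite [cutoff (_ * (b - _))]cutoff_le0 ?mulr0 ?mul0r // mulr_ge0_le0 // subr_le0.
Qed.

Lemma test_box_bump k : test_st T (box_bump k).
Proof.
split; last first.
  by exists a, b; split=> // t x [h|h]; apply: box_bump_support; [left|right]; exact: ltW.
split=> [|t x i]; last first.
  rewrite /box_bump /=; congr (_ * _); apply: eq_bigr => j _; congr cutoff.
  rewrite !mxE /= eq_sym; case: eqP => [_|_]; last by rewrite addr0.
  by rewrite gate_periodic.
have s1 : smooth (fun s : R => cutoff (k%:R * (s - a))).
  apply: (smooth_comp (@smooth_cutoff R)).
  by apply: smooth_eq (smooth_affine k%:R (- (k%:R * a))) => s; ring.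
have s2 : smooth (fun s : R => cutoff (k%:R * (b - s))).
  apply: (smooth_comp (@smooth_cutoff R)).
  by apply: smooth_eq (smooth_affine (- k%:R) (k%:R * b)) => s; ring.
have s3 i : smooth (fun s : R => cutoff (k%:R * gate (A i) (B i) s)).
  apply: (smooth_comp (@smooth_cutoff R)).
  by apply: smoothM; [exact: smooth_cst|exact: smooth_gate].
have s4 := smoothM (@smooth_time R d _ s1) (@smooth_time R d _ s2).
have s5 : smooth (fun z : R * 'rV[R]_d =>
    \prod_i cutoff (k%:R * gate (A i) (B i) (z.2 ord0 i))).
  by apply: smooth_prod => i _; exact: (smooth_coordinate i (s3 i)).
by apply: smooth_eq (smoothM s4 s5) => z.
Qed.

Lemma box_bump_limit z : torus d z.2 ->
  box_bump k z @[k --> \oo] --> (\1_(open_box a b A B) z : R).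
Proof.
move=> tz.
have -> : \1_(open_box a b A B) z = (0 < z.1 - a)%R%:R * (0 < b - z.1)%R%:R *
    \prod_i (0 < gate (A i) (B i) (z.2 ord0 i))%R%:R :> R.
  rewrite indicE !subr_gt0.
  have gE i : (0 < gate (A i) (B i) (z.2 ord0 i)) = (A i < z.2 ord0 i < B i).
    by have [h1 h2 h3] := AB i; rewrite gate_gt0.
  have [[/andP[h1 h2] h3]|nz] := pselect (open_box a b A B z).
    rewrite mem_set; last by split=> //; rewrite h1 h2.
    by rewrite h1 h2 !mul1r big1 // => i _; rewrite gE h3.
  rewrite memNset //; have [h1|] := boolP (a < z.1); last by rewrite !mul0r.
  have [h2|] := boolP (z.1 < b); last by rewrite mulr0 mul0r.
  have [i hi] : exists i, ~~ (A i < z.2 ord0 i < B i).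
    apply: contrapT => /forallNP H; apply: nz; split; first by rewrite h1 h2.
    by move=> i; apply: contrapT => /negP; exact: H.
  by rewrite (bigD1 i) //= gE (negPf hi) mul0r mulr0.
rewrite /box_bump; apply: cvgM.
  by apply: cvgM; exact: cutoff_limit.
elim: (index_enum _) => [|i s IH].
  rewrite big_nil (_ : (fun k => _) = cst 1); first exact: cvg_cst.
  by apply/funext => k; rewrite big_nil.
rewrite big_cons (_ : (fun k => _) = (fun k : nat =>
  cutoff (k%:R * gate (A i) (B i) (z.2 ord0 i)) *
  \prod_(j <- s) cutoff (k%:R * gate (A j) (B j) (z.2 ord0 j)))).
  by apply: cvgM => //; exact: cutoff_limit.
by apply/funext => k; rewrite big_cons.
Qed.

Lemma open_box_slab : open_box a b A B `<=` @slab R d a b.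
Proof.
move=> [t x] [/= /andP[h1 h2] h3]; split=> /=; first by rewrite in_itv /= !ltW.
move=> i; have [k1 k2 _] := AB i; have /andP[l1 l2] := h3 i.
by rewrite (le_trans k1 (ltW l1)) (lt_le_trans l2 k2).
Qed.

Lemma integral_open_box : (\int[mu]_(z in open_box a b A B) (f z)%:E = 0)%E.
Proof.
have mS := @measurable_slab R d a b.
have fi := f_int a0 bT.
have mf := rintegrable_measurable fi.
have mb : measurable_fun (@slab R d a b) (\1_(open_box a b A B) : ST -> R).
  by apply: measurable_indic; exact: measurable_open_box.
have <- : (\int[mu]_(z in @slab R d a b) (f z * \1_(open_box a b A B) z)%:E = 0)%E.
  apply: (@dominated_limit _ _ _ mu _ mS (fun k z => f z * box_bump k z) _ (fun z => `|f z|)).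
  - exact: rintegrable_abs.
  - move=> k; apply: measurable_funM => //; apply: measurable_continuous_st => //.
    by apply: smooth_continuous; have [[]] := test_box_bump k.
  - exact: measurable_funM.
  - apply: aeW => z _ k; rewrite normrM ler_piMr // ger0_norm ?box_bump_ge0 //.
    exact: box_bump_le1.
  - move=> z [_ tz]; apply: cvgM; first exact: cvg_cst.
    exact: box_bump_limit.
  - move=> k; rewrite -(f_test (test_box_bump k)); apply/esym.
    apply: integral_support; first exact: slab_cylinder.
    move=> [t x] [/= _ tx] nS; rewrite box_bump_support ?mulr0 //.
    apply: contrapT => /not_orP[/negP h1 /negP h2]; apply: nS; split=> //=.
    by rewrite in_itv /= !ltW // ltNge.
rewrite (integral_support open_box_slab); last first.
  by move=> z _ nz; rewrite indicE memNset // mulr0.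
by apply: eq_integral => z zB; rewrite indicE zB mulr1.
Qed.

End box_test.

Section inner_box.
Variables (a b : R).
Hypothesis a0 : 0 < a.
Hypothesis bT : b < T.
Let D0 : set ST := open_box a b (fun=> 0) (fun=> 1).

(** Open boxes form a generating family stable under intersection, so that
vanishing integrals over boxes extend to all measurable sets by Dynkin's lemma. *)
Lemma integral_inner_box X : measurable X ->
  (\int[mu]_(z in X `&` D0) (f z)%:E = 0)%E.
Proof.
have mD0 : measurable D0 by exact: measurable_open_box.
have D0s : D0 `<=` @slab R d a b.
  by apply: open_box_slab => i; split=> //; exact: ltr01.
have fi : mu.-integrable D0 (EFin \o f).
  by apply: (integrableS _ _ D0s) => //; [exact: measurable_slab|exact: f_int].
have iD0 : (\int[mu]_(z in D0) (f z)%:E = 0)%E.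
  by apply: integral_open_box => // i; split=> //; exact: ltr01.
rewrite (measurable_open_boxes R d).
apply: (@dynkin_induction _ ST _
  (fun X => \int[mu]_(z in X `&` D0) (f z)%:E = 0)%E
  (measurable_open_boxes R d) (@open_boxes_setI R d)).
- by rewrite setTI.
- move=> _ [a' [b' [A' [B' ->]]]]; rewrite open_boxI.
  have [H|/existsNP[i Hi]] := pselect (forall i, Num.max (A' i) 0 < Num.min (B' i) 1).
    apply: integral_open_box => //.
    - by rewrite lt_max a0 orbT.
    - by rewrite gt_min bT orbT.
    - by move=> i; split=> //; [rewrite le_max lexx orbT|rewrite ge_min lexx orbT].
  rewrite (_ : open_box _ _ _ _ = set0) ?integral_set0 //.
  apply/seteqP; split=> // z [_ /(_ i)/andP[h1 h2]].
  by apply: Hi; exact: lt_trans h2.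
- move=> S mS PS.
  have mSD : measurable (S `&` D0) by exact: measurableI.
  have mCD : measurable (~` S `&` D0) by apply: measurableI => //; exact: measurableC.
  have E : S `&` D0 `|` ~` S `&` D0 = D0 by rewrite -setIUl setUCr setTI.
  have := @integral_setU _ _ _ mu _ _ (EFin \o f) mSD mCD.
  rewrite E iD0 PS add0e => <- //; first exact: measurable_int fi.
  by apply/disj_setPS => z [[Sz _] [nSz _]]; exact: nSz.
- move=> F mF tF PF; rewrite setI_bigcupl.
  rewrite integral_bigcup.
  + by rewrite eseries0 // => k _ _; exact: PF.
  + exact: trivIset_setIr.
  + by move=> k; exact: measurableI.
  + rewrite -setI_bigcupl; apply: (integrableS mD0) => //.
    by apply: measurableI => //; exact: bigcupT_measurable.
Qed.

Lemma inner_box_eq0 : {ae mu, forall z, D0 z -> f z = 0}.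
Proof.
have mD0 : measurable D0 by exact: measurable_open_box.
have D0s : D0 `<=` @slab R d a b.
  by apply: open_box_slab => i; split=> //; exact: ltr01.
have fi : mu.-integrable D0 (EFin \o f).
  by apply: (integrableS _ _ D0s) => //; [exact: measurable_slab|exact: f_int].
have H : ae_eq mu D0 (EFin \o f) (cst 0%E).
  apply: (integral_ae_eq mD0 fi) => [|E ED mE]; first exact: measurable_cst.
  by rewrite integral0 -(setIidl ED); exact: integral_inner_box.
by apply: filterS H => z + Dz => /(_ Dz) [].
Qed.

End inner_box.

Lemma torus_face_negligible (i : 'I_d) :
  mu.-negligible (cylinder d T `&` [set z : ST | z.2 ord0 i = 0]).
Proof.
pose A (j : 'I_d) : set (measurableTypeR R) := if j == i then [set 0] else `[0, 1[%classic.
have mA j : measurable (A j) by rewrite /A; case: ifP => _ //; exact: measurable_itv.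
exists (`]0, T[ `*` [set x : 'rV[R]_d | forall j, A j (x ord0 j)]); split.
- by apply: measurableX; [exact: measurable_itv|exact: measurable_rV_prod].
- rewrite product_measure1E; [|exact: measurable_itv|exact: measurable_rV_prod].
  rewrite (lebesgue_rV_prod mA) (bigD1 i) //= {1}/A eqxx.
  by rewrite lebesgue_measure_set1 mul0e mule0.
- move=> [t x] [[/= tT tx] xi]; split=> //= j; rewrite /A; case: eqP => [->//|_].
  by have := tx j; rewrite /= in_itv.
Qed.

(** Open boxes inside the cylinder miss the faces of the unit cell, but these
are null. *)
Theorem fundamental_lemma : {ae mu, forall z, cylinder d T z -> f z = 0}.
Proof.
have H1 : {ae mu, forall z, forall k : nat,
    open_box k.+1%:R^-1 (T - k.+1%:R^-1) (fun=> 0) (fun=> 1) z -> f z = 0}.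
  apply: ae_foralln => k; apply: inner_box_eq0; first by rewrite invr_gt0.
  by rewrite gtrBl invr_gt0.
have H2 : {ae mu, forall z, cylinder d T z -> forall i, z.2 ord0 i != 0}.
  have : mu.-negligible (\big[setU/set0]_(i : 'I_d)
      (cylinder d T `&` [set z : ST | z.2 ord0 i = 0])).
    elim/big_ind : _ => [|X Y|i _]; [exact: negligible_set0|exact: negligibleU|].
    exact: torus_face_negligible.
  apply: negligibleS => z /not_implyP[cz /existsNP[i /negP/negPn/eqP zi]].
  by rewrite -bigcup_seq; exists i => //=; rewrite mem_index_enum.
apply: filterS2 H1 H2 => -[t x] H1 H2 cz; have [/= + tx] := cz.
rewrite in_itv /= => /andP[t0 tT].
have m0 : 0 < Num.min t (T - t) by rewrite lt_min t0 subr_gt0.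
have [k _ /(_ k (leqnn k)) /= hk] := near_infty_natSinv_lt (PosNum m0).
apply: (H1 k); split=> [|i] /=.
  by move: hk; rewrite lt_min => /andP[-> hk] /=; rewrite ltrBrDr -ltrBrDl.
have /andP[x0 ->] := tx i; rewrite andbT lt_neqAle x0 andbT eq_sym.
exact: H2 cz i.
Qed.

End fundamental_lemma.

(** * Integration by parts in time and the constraint *)

Section parts.
Context (R : realType) (d n N : nat) (L : diffop R d n N) (T : R).
Local Notation mu := ((@lebesgue_measure R) \x (lebesgue_rV R d))%E.
Local Notation ST := (measurableTypeR R * 'rV[R]_d)%type.

Definition window (a b : R) (V : nmodType) (X : R -> V) : Prop :=
  forall t, t < a \/ b < t -> X t = 0.

(** A field integrable away from the end times may be tested with continuous
fields supported away from the end times. *)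
Lemma loc_integrable_dot m p (g X : R * 'rV[R]_d -> 'M[R]_(m, p)) a b :
  loc_integrable T g -> 0 < a -> b < T -> continuous X ->
  (forall z, z.1 < a \/ b < z.1 -> X z = 0) ->
  rintegrable mu (cylinder d T) (fun z => mxdot (g z) (X z)).
Proof.
move=> gl a0 bT cX X0.
have mS := @measurable_slab R d a b.
have mC : measurable (cylinder d T : set ST) by exact: measurable_cylinder.
apply: (@rintegrable_support _ _ _ mu _ mC (slab a b)) => //.
- exact: slab_cylinder.
- move=> [t x] [/= _ tx] nS; rewrite X0 ?mxdot0r //=.
  apply: contrapT => /not_orP[/negP h1 /negP h2]; apply: nS; split=> //=.
  by rewrite in_itv /= leNgt h1 leNgt h2.
apply: rintegrable_sum => // i; apply: rintegrable_sum => // j.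
have cXij := continuous_entry i j cX.
have [C _ HC] := continuous_bounded a b cXij.
apply: (@rintegrable_eq _ _ _ mu _ mS (fun z => X z i j * g z i j)).
  by move=> z _; rewrite mulrC.
apply: (@rintegrable_bounded_mul _ _ _ mu _ mS C) => //.
  exact: measurable_continuous_st.
exact: gl.
Qed.

Variables (w wt : R * 'rV[R]_d -> 'rV[R]_n) (G : R * 'rV[R]_d -> 'M[R]_N).
Hypothesis w_dt : weak_dt T w wt.
Hypothesis w_adj : weak_adjoint L T w G.

Section test_field.
Variable Psi : R * 'rV[R]_d -> 'M[R]_N.
Hypothesis Psi_st : smooth_st Psi.
Hypothesis Psi_symm : forall z, symm (Psi z).
Variables (a b : R) (g g' : R -> R).
Hypothesis a0 : 0 < a.
Hypothesis bT : b < T.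
Hypothesis g_smooth : smooth g.
Hypothesis g_derive : forall t : R, is_derive t 1 g (g' t).
Hypothesis g_window : window a b g.
Hypothesis g'_window : window a b g'.

Lemma test_scaled m p (M : R * 'rV[R]_d -> 'M[R]_(m, p)) : smooth_st M ->
  test_st T (fun z => g z.1 *: M z).
Proof.
move=> sM; split; first exact: smooth_st_scale.
by exists a, b; split=> // t x h; rewrite /= g_window // scale0r.
Qed.

Lemma test_adjoint : (\int[mu]_(z in cylinder d T)
  (g z.1 * (mxdot (w z) (op_st L Psi z) - mxdot (G z) (Psi z)))%:E = 0)%E.
Proof.
have [_ _ _ H] := w_adj.
have sg z : symm (g z.1 *: Psi z) by exact: symmZ.
rewrite -[RHS](H _ (test_scaled Psi_st) sg); apply: eq_integral => z _.
congr EFin; rewrite -/(op_st L (fun z => g z.1 *: Psi z) z).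
by rewrite op_st_scale ?mxdotZr ?mulrBr //; have [] := Psi_st.
Qed.

(** The field [w] tested against the time derivative of [L Psi] is removed by
testing its adjoint with the time derivative of [Psi]; this needs the equality
of mixed derivatives. *)
Lemma test_dt : (\int[mu]_(z in cylinder d T)
  (g z.1 * (mxdot (G z) (dt Psi z) + mxdot (wt z) (op_st L Psi z))
   + g' z.1 * mxdot (G z) (Psi z))%:E = 0)%E.
Proof.
have [lw lwt Hdt] := w_dt; have [_ lG _ Hadj] := w_adj.
have [sPsi pPsi] := Psi_st.
pose P z := g z.1 *: Psi z.
have stP : smooth_st P by exact: smooth_st_scale.
have [sP _] := stP.
have dtPE z : dt P z = g' z.1 *: Psi z + g z.1 *: dt Psi z by exact: dt_scale.
have dtP0 z : z.1 < a \/ b < z.1 -> dt P z = 0.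
  by move=> h; rewrite dtPE g_window // g'_window // !scale0r addr0.
have P0 z : z.1 < a \/ b < z.1 -> P z = 0.
  by move=> h; rewrite /P g_window // scale0r.
have opP z : op_st L P z = g z.1 *: op_st L Psi z by exact: op_st_scale.
have sdtP : smooth (dt P) by exact: smooth_derive.
have op0 Q z : (forall z, z.1 < a \/ b < z.1 -> Q z = 0) -> smooth Q ->
    z.1 < a \/ b < z.1 -> op_st L Q z = 0.
  move=> Q0 sQ h; apply/rowP => k; rewrite op_stE mxE big1 // => c _.
  rewrite [X in mxdot _ X](_ : _ = 0) ?mxdot0r //; apply/matrixP => i j.
  case: z h => t x h; rewrite -iterD_slice (iterD_entry _ _ i j (smooth_slice t sQ)).
  rewrite (_ : (fun y => Q (t, y) i j) = fun y => 0 * Q (t, y) i j).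
    by rewrite (iterD_scale _ _ _ (smooth_entry i j (smooth_slice t sQ))) mul0r mxE.
  by apply/funext => y; rewrite Q0 // mxE mul0r.
have tdt : test_st T (dt P).
  by split; [exact: smooth_st_dt|exists a, b; split=> // t x h; exact: dtP0].
have top : test_st T (op_st L P).
  split; first exact: smooth_st_op_st.
  by exists a, b; split=> // t x h; exact: op0.
have symP z : symm (P z) by exact: symmZ.
have H1 := Hdt _ top; have H2 := Hadj _ tdt (fun z => dt_symm z sP symP).
have i1 : rintegrable mu (cylinder d T) (fun z => mxdot (w z) (dt (op_st L P) z)).
  apply: (loc_integrable_dot lw a0 bT).
    exact/smooth_continuous/smooth_derive/smooth_op_st.
  by move=> z h; rewrite dt_op_st //; exact: op0.
have i2 : rintegrable mu (cylinder d T) (fun z => mxdot (wt z) (op_st L P z)).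
  apply: (loc_integrable_dot lwt a0 bT); first exact/smooth_continuous/smooth_op_st.
  by move=> z h; exact: op0.
have i3 : rintegrable mu (cylinder d T) (fun z => mxdot (G z) (dt P z)).
  by apply: (loc_integrable_dot lG a0 bT) => //; exact: smooth_continuous.
have mC : measurable (cylinder d T : set ST) by exact: measurable_cylinder.
have := integral_subr mC (rintegrableD mC i1 i2) (rintegrableB mC i1 i3).
have -> : (\int[mu]_(z in cylinder d T) (mxdot (w z) (dt (op_st L P) z) +
   mxdot (wt z) (op_st L P z))%:E = 0)%E by exact: H1.
have -> : (\int[mu]_(z in cylinder d T) (mxdot (w z) (dt (op_st L P) z) -
   mxdot (G z) (dt P z))%:E = 0)%E.
  rewrite -[RHS]H2; apply: eq_integral => z _; congr (_ - _)%:E.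
  by rewrite dt_op_st.
rewrite sube0 => <-; apply: eq_integral => z _; congr EFin.
rewrite opP dtPE mxdotDr !mxdotZr; ring.
Qed.

End test_field.

(** Multiplying by a time weight [H] that vanishes near [T] produces admissible
pairs: the weight is first cut off near [0], where [Psi] vanishes linearly. *)
Lemma weighted_constraint (t1 C : R) (H H' : R -> R) :
  t1 < T -> smooth H -> smooth H' ->
  (forall t : R, is_derive t 1 H (H' t)) ->
  (forall t, t1 < t -> H t = 0) -> (forall t, t1 < t -> H' t = 0) ->
  mx_measurable (cylinder d T) G ->
  {ae mu, forall z, cylinder d T z -> enorm (H z.1 *: G z) <= C} ->
  (forall i j, rintegrable mu (cylinder d T)
     (fun z => (H z.1 *: wt z + H' z.1 *: w z) i j)) ->
  constraint L T (fun z => H z.1 *: wt z + H' z.1 *: w z) (fun z => H z.1 *: G z).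
Proof.
move=> t1T sH sH' dH H0 H'0 mG GC Ei Psi stPsi symPsi Psi0.
have [sPsi pPsi] := stPsi.
have mC : measurable (cylinder d T : set ST) by exact: measurable_cylinder.
set E := (fun z => H z.1 *: wt z + H' z.1 *: w z) in Ei *.
pose B z := H z.1 *: G z.
pose K (k : nat) : R := k.+1%:R.
have K0 k : 0 < K k by rewrite ltr0n.
pose eta k (t : R) := cutoff (K k * t + -1).
pose eta' k (t : R) := K k * cutoff' (K k * t + -1).
have seta k : smooth (eta k) by exact: (smooth_comp (@smooth_cutoff R) (smooth_affine _ _)).
have deta k (t : R) : is_derive t 1 (eta k) (eta' k t).
  have di : derivable (id : R -> R) t 1 by exact: derivable_id.
  have [d1 e1] : is_derive t 1 (fun s : R => K k * s + -1) (K k).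
    have dm : derivable (fun s : R => K k * s) t 1.
      exact: (derivableM (derivable_cst _ _ _) di).
    split; first exact: (derivableD dm (derivable_cst _ _ _)).
    by rewrite (deriveD dm (derivable_cst _ _ _)) derive_cst addr0 (deriveMl _ di) derive_id mulr1.
  have [d2 e2] := is_derive_cutoff (K k * t + -1).
  by have := derive_comp d1 d2; rewrite e1 e2 mulrC.
have eta0 k t : t < (K k)^-1 -> eta k t = 0.
  move=> h; apply: cutoff_le0; rewrite subr_le0.
  by rewrite -(mulfV (lt0r_neq0 (K0 k))) ler_pM2l // ltW.
have eta'0 k t : t < (K k)^-1 -> eta' k t = 0.
  move=> h; rewrite /eta' cutoff'_le0 ?mulr0 // subr_le0.
  by rewrite -(mulfV (lt0r_neq0 (K0 k))) ler_pM2l // ltW.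
pose core z := mxdot (B z) (dt Psi z) + mxdot (E z) (op_st L Psi z).
have mB : mx_measurable (cylinder d T) B.
  move=> i j; rewrite /B; under eq_fun do rewrite mxE.
  apply: measurable_funM => //; apply: measurable_continuous_st => //.
  exact/smooth_continuous/smooth_time.
have mE : mx_measurable (cylinder d T) E.
  by move=> i j; exact: rintegrable_measurable (Ei i j).
have mcont m p (M : R * 'rV[R]_d -> 'M[R]_(m, p)) : smooth M ->
    mx_measurable (cylinder d T : set ST) M.
  move=> sM i j; apply: measurable_continuous_st => //.
  exact/smooth_continuous/smooth_entry.
have cyl_slab : cylinder d T `<=` slab 0 T.
  move=> [t x] [/= + tx]; rewrite in_itv /= => /andP[h1 h2]; split=> //=.
  by rewrite in_itv /= !ltW.
pose F k z := eta k z.1 * core z + eta' k z.1 * mxdot (B z) (Psi z).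
have F_eq0 k : (\int[mu]_(z in cylinder d T) (F k z)%:E = 0)%E.
  have a0 : 0 < (K k)^-1 by rewrite invr_gt0.
  have w1 : window (K k)^-1 t1 (fun t => eta k t * H t).
    by move=> t [h|h]; [rewrite eta0 // mul0r|rewrite H0 // mulr0].
  have w2 : window (K k)^-1 t1 (fun t => eta k t * H' t + H t * eta' k t).
    move=> t [h|h]; first by rewrite eta0 // eta'0 // mul0r mulr0 addr0.
    by rewrite H0 // H'0 // mulr0 mul0r addr0.
  have w3 : window (K k)^-1 t1 (fun t => eta k t * H' t).
    by move=> t [h|h]; [rewrite eta0 // mul0r|rewrite H'0 // mulr0].
  have d1 (t : R) : is_derive t 1 (fun t => eta k t * H t)
      (eta k t * H' t + H t * eta' k t).
    have [p1 q1] := deta k t; have [p2 q2] := dH t.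
    by split; [exact: derivableM|rewrite (deriveM p1 p2) q1 q2].
  have s1 := smoothM (seta k) sH; have s3 := smoothM (seta k) sH'.
  have I1 := test_dt stPsi symPsi a0 t1T s1 d1 w1 w2.
  have I2 := test_adjoint stPsi symPsi a0 t1T s3 w3.
  have [lw lwt _] := w_dt; have [_ lG _ _] := w_adj.
  have wint m p (g : R * 'rV[R]_d -> 'M[R]_(m, p)) (q : R -> R) (X : R * 'rV[R]_d -> 'M[R]_(m, p)) :
      loc_integrable T g -> smooth q -> window (K k)^-1 t1 q -> smooth X ->
      rintegrable mu (cylinder d T) (fun z => q z.1 * mxdot (g z) (X z)).
    move=> lg sq wq sX.
    apply: (@rintegrable_eq _ _ _ mu _ mC (fun z => mxdot (g z) (q z.1 *: X z))).
      by move=> z _; rewrite mxdotZr.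
    apply: (loc_integrable_dot lg a0 t1T).
      exact: smooth_continuous (smooth_scale (smooth_time sq) sX).
    by move=> z h; rewrite wq // scale0r.
  have seta'H : smooth (fun t => eta k t * H' t + H t * eta' k t).
    apply: smoothD => //; apply: smoothM => //; apply: smoothM; first exact: smooth_cst.
    exact: (smooth_comp (smooth_flat _) (smooth_affine _ _)).
  have sdt := smooth_derive ((1, 0) : R * 'rV[R]_d) sPsi.
  have sop := smooth_op_st L sPsi.
  have i1 := wint _ _ _ _ _ lG s1 w1 sdt.
  have i2 := wint _ _ _ _ _ lwt s1 w1 sop.
  have i3 := wint _ _ _ _ _ lG seta'H w2 sPsi.
  have i4 := wint _ _ _ _ _ lw s3 w3 sop.
  have i5 := wint _ _ _ _ _ lG s3 w3 sPsi.
  have j1 := rintegrableD mC (rintegrableD mC i1 i2) i3.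
  have j2 := rintegrableB mC i4 i5.
  have := integral_addr mC j1 j2.
  have -> : (\int[mu]_(z in cylinder d T) (eta k z.1 * H z.1 * mxdot (G z) (dt Psi z) +
     eta k z.1 * H z.1 * mxdot (wt z) (op_st L Psi z) +
     (eta k z.1 * H' z.1 + H z.1 * eta' k z.1) * mxdot (G z) (Psi z))%:E = 0)%E.
    rewrite -[RHS]I1; apply: eq_integral => z _; congr EFin; ring.
  have -> : (\int[mu]_(z in cylinder d T) (eta k z.1 * H' z.1 * mxdot (w z) (op_st L Psi z) -
     eta k z.1 * H' z.1 * mxdot (G z) (Psi z))%:E = 0)%E.
    rewrite -[RHS]I2; apply: eq_integral => z _; congr EFin; ring.
  rewrite adde0 => <-; apply: eq_integral => z _; congr EFin.
  rewrite /F /core /B /E mxdotDl !mxdotZl; ring.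
(* [Psi] vanishes at time [0], hence is of order [t] by the mean value theorem. *)
have [D D0 HD] : exists2 D, 0 <= D & forall z, cylinder d T z -> forall i j,
    `|Psi z i j| <= z.1 * D.
  have c i j : {D | 0 <= D & forall z, slab 0 T z -> `|dt Psi z i j| <= D}.
    apply/cid2/continuous_bounded/continuous_entry/smooth_continuous.
    exact: smooth_derive.
  exists (\sum_i \sum_j s2val (c i j)).
    apply: sumr_ge0 => i _; apply: sumr_ge0 => j _; exact: (s2valP (c i j)).
  move=> [t x] [/= + tx] i j; rewrite in_itv /= => /andP[t0 tT].
  have sij := smooth_entry i j sPsi.
  have [s st] := @increment_along _ _ (fun z => Psi z i j) (0, x) ((1, 0) : R * 'rV[R]_d) t t0
    (fun y => smooth_derivable y _ sij).
  have E1 r : (0, x) + r *: ((1, 0) : R * 'rV[R]_d) = (r, x).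
    by congr pair; rewrite /= ?scaler0 ?addr0 // add0r [r *: _]mulr1.
  rewrite !E1 Psi0 mxE subr0 => ->; rewrite normrM (gtr0_norm t0) ler_pM2l //.
  have -> : 'D_(1, 0) (fun z => Psi z i j) (s, x) = dt Psi (s, x) i j.
    by rewrite /dt derive_entry.
  have sS : slab 0 T (s, x).
    have /andP[s0 s1] := st; split=> //=; rewrite in_itv /= ltW //=.
    by rewrite ltW // (lt_trans s1 tT).
  apply: (le_trans (s2valP' (c i j) _ sS)).
  rewrite (bigD1 i) //= (bigD1 j) //= -addrA lerDl addr_ge0 //.
    by apply: sumr_ge0 => l _; exact: (s2valP (c i l)).
  by apply: sumr_ge0 => p _; apply: sumr_ge0 => l _; exact: (s2valP (c p l)).
have [D' D'0 HD'] : exists2 D', 0 <= D' & forall z, cylinder d T z ->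
    enorm (B z) <= C -> `|mxdot (B z) (Psi z)| <= z.1 * D'.
  exists (\sum_(i < N) \sum_(j < N) `|C| * D).
    by apply: sumr_ge0 => i _; apply: sumr_ge0 => j _; rewrite mulr_ge0.
  move=> z cz BC; rewrite /mxdot (le_trans (ler_norm_sum _ _ _)) // mulr_sumr.
  apply: ler_sum => i _; rewrite (le_trans (ler_norm_sum _ _ _)) // mulr_sumr.
  apply: ler_sum => j _; rewrite normrM mulrCA ler_pM //; last exact: HD.
  by rewrite (le_trans (entry_le_enorm _ _ _)) // (le_trans BC) // ler_norm.
have lim_inv (c t : R) : 0 < t -> c / (K k * t) @[k --> \oo] --> (0 : R).
  move=> t0; have -> : (fun k => c / (K k * t)) = (fun k => (c / t) * k.+1%:R^-1).
    by apply/funext => k; rewrite /K invfM; ring.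
  rewrite -(mulr0 (c / t)); apply: cvgM; first exact: cvg_cst.
  exact: cvg_harmonic.
have large (t : R) : 0 < t -> \forall k \near \oo, 2 < K k * t.
  move=> t0; have := lim_inv 2 t t0 => /cvgrPdist_lt /(_ 1 ltr01).
  apply: filterS => k; rewrite sub0r normrN gtr0_norm; last by rewrite divr_gt0 ?mulr_gt0.
  by rewrite ltr_pdivrMr ?mulr_gt0 // mul1r.
have eta_lim (t : R) : 0 < t -> eta k t @[k --> \oo] --> (1 : R).
  move=> t0; apply: (@squeeze_cvgr _ _ _ _ (fun k => 1 - 2 / (K k * t)) (cst 1)).
  - near=> k; rewrite /eta cutoff_le1 andbT.
    have h : 2 < K k * t by near: k; exact: large.
    set s := K k * t in h *; have s0 : 0 < s - 1 by lra.
    rewrite cutoffE; last lra.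
    rewrite (le_trans _ (expR_ge1Dx _)) // lerD2l lerN2.
    by rewrite ler_pdivlMr ?ler_pdivrMl; lra.
  - rewrite -[X in _ --> X](subr0 1); apply: cvgB; first exact: cvg_cst.
    exact: lim_inv.
  - exact: cvg_cst.
have eta'_lim (t : R) : 0 < t -> eta' k t @[k --> \oo] --> (0 : R).
  move=> t0; apply: (@squeeze_cvgr _ _ _ _ (cst 0) (fun k => (4 / t) / (K k * t))).
  - near=> k; rewrite /eta' mulr_ge0 ?cutoff'_ge0 ?(ltW (K0 k)) //=.
    have h : 2 < K k * t by near: k; exact: large.
    have KE : K k = (K k * t) / t by rewrite mulfK // gt_eqF.
    rewrite {1}KE; set s := K k * t in h *.
    have s1 : 0 < s + -1 by lra.
    have decay : s * cutoff' (s + -1) <= 4 / s.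
      have s2 : 0 < (s + -1) ^+ 2 by rewrite exprn_gt0.
      rewrite (le_trans (ler_wpM2l _ (cutoff'_le s1))) //; first lra.
      rewrite ler_pdivrMr // mulrAC ler_pdivlMr; last lra.
      nra.
    have ti : 0 <= t^-1 by rewrite invr_ge0 ltW.
    have := ler_wpM2l ti decay; congr (is_true (_ <= _)); ring.
  - exact: cvg_cst.
  - exact: lim_inv.
(* [core] is the integrand of the constraint; [F k] tends to it. *)
have core_i : rintegrable mu (cylinder d T) core.
  apply: rintegrableD => //.
    apply: rintegrable_sum => // i; apply: rintegrable_sum => // j.
    have cij :=
      continuous_entry i j (smooth_continuous (smooth_derive ((1, 0) : R * 'rV[R]_d) sPsi)).
    have [D1 D10 HD1] := continuous_bounded 0 T cij.
    apply: (@rintegrable_ae_le _ _ _ mu _ mC _ (fun=> `|C| * D1)).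
    - by apply: measurable_funM; [exact: mB|apply: measurable_continuous_st].
    - apply: (@rintegrable_finite _ _ _ mu _ mC (`|C| * D1)) => //.
        exact: cylinder_finite.
      by move=> z _; rewrite ger0_norm // mulr_ge0.
    - apply: filterS GC => z GC cz; rewrite normrM ler_pM //; last first.
        exact/HD1/cyl_slab.
      by rewrite (le_trans (entry_le_enorm _ _ _)) // (le_trans (GC cz)) // ler_norm.
  apply: rintegrable_sum => // i; apply: rintegrable_sum => // j.
  have cij := continuous_entry i j (smooth_continuous (smooth_op_st L sPsi)).
  have [D1 D10 HD1] := continuous_bounded 0 T cij.
  apply: (@rintegrable_eq _ _ _ mu _ mC (fun z => op_st L Psi z i j * E z i j)).
    by move=> z _; rewrite mulrC.
  apply: (@rintegrable_bounded_mul _ _ _ mu _ mC D1) => //.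
    exact: measurable_continuous_st.
  by move=> z cz; apply: HD1; exact: cyl_slab.
have mPsiB := measurable_mxdot mB (mcont _ _ _ sPsi).
apply: (@dominated_limit _ _ _ mu _ mC F _ (fun z => `|core z| + 8 * D')) => //.
- apply: rintegrableD => //; first exact: rintegrable_abs.
  apply: (@rintegrable_finite _ _ _ mu _ mC (8 * D')) => //.
    exact: cylinder_finite.
  by move=> z _; rewrite ger0_norm // mulr_ge0.
- move=> k; apply: measurable_funD; apply: measurable_funM => //.
  + apply: measurable_continuous_st => //.
    exact/smooth_continuous/smooth_time/seta.
  + exact: rintegrable_measurable core_i.
  + apply: measurable_continuous_st => //; apply: smooth_continuous.
    apply: (@smooth_time R d (eta' k)); apply: smoothM; first exact: smooth_cst.
    exact: (smooth_comp (smooth_flat _) (smooth_affine _ _)).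
- exact: rintegrable_measurable core_i.
- apply: filterS GC => z GC cz k.
  rewrite (le_trans (ler_normD _ _)) // lerD //.
    rewrite normrM ler_piMl // ger0_norm; first exact: cutoff_le1.
    exact: cutoff_ge0.
  rewrite normrM ger0_norm; last by rewrite mulr_ge0 ?cutoff'_ge0 // ltW.
  have eta'_ge0 : 0 <= eta' k z.1 by rewrite mulr_ge0 ?cutoff'_ge0 // ltW.
  rewrite (le_trans (ler_wpM2l eta'_ge0 (HD' z cz (GC cz)))) // mulrA ler_wpM2r //.
  have := cutoff'_shift_bounded (K k * z.1) => /andP[_].
  by rewrite /eta' mulrAC.
- move=> z [/= + _]; rewrite in_itv /= => /andP[t0 _].
  rewrite -[X in _ --> X](_ : 1 * core z + 0 * mxdot (B z) (Psi z) = _); last first.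
    by rewrite mul1r mul0r addr0.
  apply: cvgD; apply: cvgM; by [exact: eta_lim|exact: eta'_lim|exact: cvg_cst].
Unshelve. all: by end_near. Qed.

End parts.

(** * Strong solutions as test pairs *)

Section adjoint_values.
Context (R : realType) (d n N : nat) (L : diffop R d n N) (T : R).
Local Notation mu := ((@lebesgue_measure R) \x (lebesgue_rV R d))%E.
Local Notation ST := (measurableTypeR R * 'rV[R]_d)%type.

Lemma loc_integrable_measurable m p (g : R * 'rV[R]_d -> 'M[R]_(m, p)) :
  loc_integrable T g -> mx_measurable (cylinder d T : set ST) g.
Proof.
move=> gl i j.
have -> : cylinder d T = \bigcup_(k : nat) slab k.+1%:R^-1 (T - k.+1%:R^-1) :> set ST.
  apply/seteqP; split=> [[t x] [/= + tx]|z [k _]]; last first.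
    by apply: slab_cylinder; rewrite ?gtrBl invr_gt0.
  rewrite in_itv /= => /andP[t0 tT].
  have m0 : 0 < Num.min t (T - t) by rewrite lt_min t0 subr_gt0.
  have [k _ /(_ k (leqnn k)) /= hk] := near_infty_natSinv_lt (PosNum m0).
  exists k => //; split=> //=; rewrite in_itv /=.
  by move: hk; rewrite lt_min => /andP[h1 h2]; rewrite ltW //= lerBrDr -lerBrDl ltW.
apply/measurable_fun_bigcup => k; first exact: measurable_slab.
apply: rintegrable_measurable; apply: gl; first by rewrite invr_gt0.
by rewrite gtrBl invr_gt0.
Qed.

(** A weak value of [L^*] is orthogonal to every matrix that all smooth values
of [L^*] are orthogonal to. *)
Lemma weak_adjoint_Lambda (w : R * 'rV[R]_d -> 'rV[R]_n) (G : R * 'rV[R]_d -> 'M[R]_N) :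
  weak_adjoint L T w G -> {ae mu, forall z, cylinder d T z -> Lambda L (G z)}.
Proof.
move=> [lw lG sG HG]; have [A [sA AL AX]] := Lambda_equations L.
have H ij : {ae mu, forall z, cylinder d T z -> mxdot (A ij.1 ij.2) (G z) = 0}.
  set Aij := A ij.1 ij.2; apply: fundamental_lemma => [a b a0 bT|phi [sphi [a [b [a0 bT phi0]]]]].
    have mS := @measurable_slab R d a b.
    apply: rintegrable_sum => // i; apply: rintegrable_sum => // j.
    by apply: rintegrableZ => //; exact: lG.
  have sM : smooth_st (fun z => phi z *: Aij).
    have [s1 s2] := sphi; split=> [|t x i]; last by rewrite s2.
    by apply: smooth_scale => //; exact: smooth_cst_mx.
  have tM : test_st T (fun z => phi z *: Aij).
    by split=> //; exists a, b; split=> // t x h; rewrite phi0 // scale0r.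
  have symM z : symm (phi z *: Aij) by exact/symmZ/sA.
  have := HG _ tM symM.
  have int : rintegrable mu (cylinder d T) (fun z => mxdot (G z) (phi z *: Aij)).
    apply: (loc_integrable_dot lG a0 bT); first by have [/smooth_continuous] := sM.
    by move=> [t x] h; rewrite phi0 // scale0r.
  have mC : measurable (cylinder d T : set ST) by exact: measurable_cylinder.
  have E : (\int[mu]_(z in cylinder d T) (-1 * mxdot (G z) (phi z *: Aij))%:E =
      -1%:E * \int[mu]_(z in cylinder d T) (mxdot (G z) (phi z *: Aij))%:E)%E.
    exact: (integralZl mC int (-1)).
  have -> : (\int[st_measure d]_(z in cylinder d T) (mxdot (w z)
     (op_apply L (fun x => phi (z.1, x) *: Aij) z.2) - mxdot (G z) (phi z *: Aij))%:E =
     \int[mu]_(z in cylinder d T) (-1 * mxdot (G z) (phi z *: Aij))%:E)%E.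
    apply: eq_integral => z _; congr EFin.
    have := @op_st_orthogonal _ _ _ _ L Aij phi z (AL _ _) sphi.
    by rewrite /op_st => ->; rewrite mxdot0r; ring.
  rewrite E mulN1e => /eqP; rewrite oppe_eq0 => /eqP; rewrite -[X in _ -> _ = X]/0%E => <-.
  by apply: eq_integral => z _; rewrite mxdotZr mxdotC mulrC.
have : {ae mu, forall z, forall ij : 'I_N * 'I_N,
    cylinder d T z -> mxdot (A ij.1 ij.2) (G z) = 0}.
  by apply: filter_forall => ij; exact: H.
apply: filterS => z Hz cz.
by apply: AX; [exact: sG|move=> i j; exact: (Hz (i, j) cz)].
Qed.

End adjoint_values.

Section structure.
Context (R : realType) (d n N : nat) (F : 'rV[R]_n -> 'M[R]_N) (L : diffop R d n N).
Hypothesis FL : standing_assumptions F L.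
Local Notation K := (entropy F).
Implicit Types (v y z : 'rV[R]_n).

Lemma F_continuous : continuous F.
Proof. by have [_ H] := F_C2 FL [::]; exact: H. Qed.

Lemma F_derivable v y : derivable F v y.
Proof. by have [H _] := F_C2 FL [::]; exact: H. Qed.

Lemma trace_entropy v : mxdot (F v) 1%:M = 2 * K v + mxdot (F 0) 1%:M.
Proof. by rewrite /entropy !mxdot1r linearB /=; field. Qed.

Lemma entropyE v : K v = 2^-1 * mxdot (F v - F 0) 1%:M.
Proof. by rewrite mxdot1r. Qed.

Lemma is_derive_F (P : 'M[R]_N) v y :
  is_derive v y (fun z => mxdot (F z) P) (mxdot ('D_y F v) P).
Proof.
rewrite (mxdotC _ P) (_ : (fun z => _) = fun z => mxdot P (F z)).
  exact/derive_mxdotr/F_derivable.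
by apply/funext => z; rewrite mxdotC.
Qed.

Lemma is_derive_entropy v y : is_derive v y K (2^-1 * mxdot ('D_y F v) 1%:M).
Proof.
have [d1 e1] := is_derive_F 1%:M v y.
have -> : K = fun z => 2^-1 * (mxdot (F z) 1%:M - mxdot (F 0) 1%:M).
  by apply/funext => z; rewrite entropyE mxdotBl.
have d2 : derivable (fun z => mxdot (F z) 1%:M - mxdot (F 0) 1%:M) v y.
  exact: (derivableB d1 (derivable_cst _ _ _)).
split; first exact: (derivableM (derivable_cst _ _ _) d2).
by rewrite (deriveMl _ d2) (deriveB d1 (derivable_cst _ _ _)) derive_cst subr0 e1.
Qed.

Lemma entropy_continuous : continuous K.
Proof.
have -> : K = fun z => 2^-1 * (mxdot 1%:M (F z) - mxdot (F 0) 1%:M).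
  by apply/funext => z; rewrite entropyE mxdotBl mxdotC.
have cl : continuous (fun X : 'M[R]_N => 2^-1 * (mxdot 1%:M X - mxdot (F 0) 1%:M)).
  apply: smooth_continuous; apply: smoothM; first exact: smooth_cst.
  apply: (@smoothD _ _ _ (fun=> - mxdot (F 0) 1%:M)); last exact: smooth_cst.
  apply: smooth_mxdot; apply: smooth_mx => i j; apply: smooth_linear.
  - by move=> *; rewrite mxE.
  - by move=> *; rewrite mxE.
  - exact: coord_continuous.
move=> z; apply: (@continuous_comp _ _ _ F
  (fun X : 'M[R]_N => 2^-1 * (mxdot 1%:M X - mxdot (F 0) 1%:M))).
  exact: F_continuous.
exact: cl.
Qed.

Lemma entropy_derivable v y : derivable K v y.
Proof. by have [] := is_derive_entropy v y. Qed.

Lemma sharpE v l : sharp F v ord0 l = 2^-1 * mxdot ('D_(evec l) F v) 1%:M.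
Proof. by rewrite mxE; have [_ ->] := is_derive_entropy v (evec l). Qed.

Lemma grad_legendre_sharp v : grad (legendre K) (sharp F v) = v.
Proof.
exact: (grad_legendre_grad (entropy_Nfun FL) (entropy_strictly_convex FL)
  entropy_continuous entropy_derivable).
Qed.

Lemma F_gradient (P : 'M[R]_N) v z : Lambda L P -> nonneg_definite P ->
  mxdot (F v) P + \sum_l (z - v) ord0 l * mxdot ('D_(evec l) F v) P <= mxdot (F z) P.
Proof.
move=> LP P0; have dF l := @ex_derive _ _ _ _ _ _ _ (is_derive_F P v (evec l)).
have := convex_gradient z (F_Lambda_convex FL LP P0) dF.
congr (is_true (_ + _ <= _)); apply: eq_bigr => l _; congr (_ * _).
by have [_ ->] := is_derive_F P v (evec l).
Qed.

Lemma F_cone_ge0 (P : 'M[R]_N) v : Lambda L P -> nonneg_definite P ->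
  0 <= mxdot (F v) P.
Proof. by move=> LP P0; have [_] := F_Lambda_cone FL v; exact. Qed.

(** By the gradient inequality for [F : P], and since [P] lies between [0] and
[2^k I], the number [(z - v) . (- e)] is at most [2^k I : F z], which is
[2^(k+1) K z] up to a constant.  The supremum over [z] bounds the conjugate at
[e / 2^(k+1)], and the doubling condition removes the factor. *)
Lemma legendre_multiplier (k : nat) : exists2 C : R, 0 <= C &
  forall (P : 'M[R]_N) v (e : 'rV[R]_n),
    Lambda L P -> nonneg_definite P -> nonneg_definite (2 ^+ k *: 1%:M - P) ->
    (forall l, e ord0 l = - mxdot ('D_(evec l) F v) P) ->
    legendre K e <= C * (K v + 1).
Proof.
have KN := entropy_Nfun FL; have K0 := Nfun_ge0 KN.
have [D D0 HD] := Delta2_iter k.+1 (entropy_legendre_Delta2 FL) (legendre_ge0 KN).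
have [D1 D10 HD1] := Delta2_iter 1 (entropy_Delta2 FL) K0.
pose a0 := mxdot (F 0) 1%:M.
have a0_ge0 : 0 <= a0.
  apply: F_cone_ge0; first exact: Lambda1.
  by rewrite -[1%:M]addr0 -(scale1r 1%:M); apply: nonneg_definite_shift;
    [exact: trmx0|rewrite /enorm mxdot0l sqrtr0].
exists (D * (D1 + a0 + 1)) => [|P v e LP P0 cP eE]; first by rewrite mulr_ge0 // !addr_ge0.
have q0 : 0 < 2 ^+ k.+1 :> R by rewrite exprn_gt0.
have LcP : Lambda L (2 ^+ k *: 1%:M - P).
  by apply: LambdaD; [exact/LambdaZ/Lambda1|rewrite -scaleN1r; exact: LambdaZ].
have H y : mxdot (y - v) (- e) <= 2 ^+ k.+1 * K y + 2 ^+ k * a0.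
  have -> : mxdot (y - v) (- e) = \sum_l (y - v) ord0 l * mxdot ('D_(evec l) F v) P.
    by rewrite rv_mxdotE; apply: eq_bigr => l _; rewrite [(- e) _ _]mxE eE opprK.
  have := F_gradient v y LP P0; have := F_cone_ge0 v LP P0.
  have := F_cone_ge0 y LcP cP; rewrite mxdotBr mxdotZr trace_entropy -/a0 exprS; lra.
have := legendre_scaled_le KN q0 H; rewrite scalerN (legendreN KN).
have -> : 2 * (2 ^+ k * a0) / 2 ^+ k.+1 = a0.
  by rewrite mulrA -exprS mulrAC mulfV ?mul1r // gt_eqF.
move=> h1; have := HD ((2 ^+ k.+1)^-1 *: e).
rewrite scalerA mulfV ?gt_eqF // scale1r => h2; apply: (le_trans h2).
rewrite -mulrA ler_wpM2l //.
have := HD1 v; rewrite expr1 => h3; have := K0 v => h4.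
have h5 : 0 <= a0 * K v by rewrite mulr_ge0.
have h6 : 0 <= D1 * K v by rewrite mulr_ge0.
lra.
Qed.

End structure.

(** * Time weights and time slices *)

Section weights.
Context (R : realType).

Lemma weight_primitive_lower (T c C t : R) (h : R -> R) :
  measurable_fun `[0, T] h -> 0 < c -> (forall s, 0 <= s <= T -> c <= h s <= C) ->
  0 <= t <= T -> c * (T - t) <= weight_primitive T h t.
Proof.
move=> mh c0 hc /andP[t0 tT].
have sub : (`[t, T] : set R) `<=` `[0, T].
  move=> s /=; rewrite !in_itv /= => /andP[ts ->]; rewrite andbT.
  exact: le_trans ts.
have mD : measurable (`[t, T] : set (measurableTypeR R)) by exact: measurable_itv.
have muE : lebesgue_measure (`[t, T] : set R) = (T - t)%:E.
  rewrite lebesgue_measure_itv /= lte_fin.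
  by move: tT; rewrite le_eqVlt => /predU1P[->|->]; rewrite ?ltxx ?subrr // -EFinB.
have fin : (lebesgue_measure (`[t, T] : set R) < +oo)%E by rewrite muE ltry.
have mh' : measurable_fun (`[t, T] : set (measurableTypeR R)) h.
  by apply: (measurable_funS _ sub) => //; exact: measurable_itv.
have ih : rintegrable (@lebesgue_measure R) `[t, T] h.
  apply: (@rintegrable_finite _ _ _ (@lebesgue_measure R) _ mD C) => // s /sub /=.
  rewrite in_itv /= => /hc /andP[h1 h2]; rewrite ger0_norm //.
  exact: le_trans (ltW c0) h1.
have ic : rintegrable (@lebesgue_measure R) `[t, T] (cst c).
  apply: (@rintegrable_finite _ _ _ (@lebesgue_measure R) _ mD c) => // s _.
  by rewrite /= gtr0_norm.
have := le_Rintegral mD ic ih.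
have := @Rintegral_cst _ _ _ (@lebesgue_measure R) _ mD c.
rewrite [X in _ = c * fine X]muE /= => -> H; apply: H => s /sub /=.
by rewrite in_itv /= => /hc /andP[].
Qed.

(** A smooth weight that vanishes from [t1] on and whose relative rate of decay
is at least [r]. *)
Definition decay (t1 r t : R) := cutoff (-1 * t + t1) * expR (- r * t).

Definition decay_rate (t1 r t : R) :=
  cutoff' (-1 * t + t1) * expR (- r * t) + r * decay t1 r t.

Lemma smooth_expR_linear (r : R) : smooth (fun t : R => expR (- r * t)).
Proof.
apply: (smooth_comp (@smooth_expR R)).
by apply: smoothM; [exact: smooth_cst|exact: smooth_id].
Qed.

Lemma smooth_decay t1 r : smooth (decay t1 r).
Proof.
have s1 := smooth_comp (@smooth_cutoff R) (smooth_affine (-1) t1).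
by apply: smooth_eq (smoothM s1 (smooth_expR_linear r)) => t.
Qed.

Lemma smooth_decay_rate t1 r : smooth (decay_rate t1 r).
Proof.
have s1 := smooth_comp (smooth_flat 'X^2) (smooth_affine (-1) t1).
have s2 := smoothM (@smooth_cst R R r) (smooth_decay t1 r).
by apply: smooth_eq (smoothD (smoothM s1 (smooth_expR_linear r)) s2) => t.
Qed.

Lemma is_derive_affine (p q t : R) : is_derive t 1 (fun s : R => p * s + q) p.
Proof.
have di : derivable (id : R -> R) t 1 by exact: derivable_id.
have dm : derivable (fun s : R => p * s) t 1.
  exact: (derivableM (derivable_cst _ _ _) di).
split; first exact: (derivableD dm (derivable_cst _ _ _)).
by rewrite (deriveD dm (derivable_cst _ _ _)) derive_cst addr0 (deriveMl _ di)
  derive_id mulr1.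
Qed.

Lemma is_derive_decay (t1 r t : R) : is_derive t 1 (decay t1 r) (- decay_rate t1 r t).
Proof.
have [d1 e1] := is_derive_affine (-1) t1 t.
have [d2 e2] := is_derive_cutoff (-1 * t + t1).
have [d3 e3] := derive_comp d1 d2.
have [d4 e4] := is_derive_affine (- r) 0 t.
have dE : derivable (@expR R) (- r * t + 0) 1 by exact: derivable_expR.
have [d5 e5] := derive_comp d4 dE.
have E : (fun s : R => expR (- r * s + 0)) = (fun s => expR (- r * s)).
  by apply/funext => s; rewrite addr0.
rewrite E in d5 e5.
split; first exact: (derivableM d3 d5).
rewrite (deriveM d3 d5) e3 e5 e1 e2 e4 addr0.
rewrite (@derive_val _ _ _ _ _ _ _ (is_derive_expR _)) /decay_rate /decay /GRing.scale /=.
ring.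
Qed.

Lemma decay_ge t1 r t : t1 <= t -> decay t1 r t = 0.
Proof. by move=> h; rewrite /decay cutoff_le0 ?mul0r //; lra. Qed.

Lemma decay_rate_ge t1 r t : t1 <= t -> decay_rate t1 r t = 0.
Proof.
by move=> h; rewrite /decay_rate decay_ge // cutoff'_le0 ?mul0r ?mulr0 ?addr0 //; lra.
Qed.

Lemma decay_ge0 t1 r t : 0 <= decay t1 r t.
Proof. by rewrite mulr_ge0 ?cutoff_ge0 ?expR_ge0. Qed.

Lemma decay_le_rate t1 r t : r * decay t1 r t <= decay_rate t1 r t.
Proof. by rewrite lerDr mulr_ge0 ?cutoff'_ge0 ?expR_ge0. Qed.

Lemma decay_rate_gt0 t1 r t : 0 < r -> t < t1 -> 0 < decay_rate t1 r t.
Proof.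
move=> r0 tt1; apply: lt_le_trans (decay_le_rate t1 r t).
by rewrite mulr_gt0 // mulr_gt0 ?expR_gt0 // cutoff_gt0 //; lra.
Qed.

Lemma decay_rate_ge0 t1 r t : 0 <= r -> 0 <= decay_rate t1 r t.
Proof.
move=> r0; apply: le_trans (decay_le_rate t1 r t).
by rewrite mulr_ge0 ?decay_ge0.
Qed.

Lemma decay_rate_le t1 r t : 0 <= r -> 0 <= t -> decay_rate t1 r t <= 4 + r.
Proof.
move=> r0 t0.
have e1 : expR (- r * t) <= 1 by rewrite -expR0 ler_expR mulNr oppr_le0 mulr_ge0.
have e0 := expR_ge0 (- r * t).
rewrite /decay_rate /decay lerD //.
  by rewrite -[4]mulr1 ler_pM ?cutoff'_ge0 ?cutoff'_bounded.
by rewrite -[leRHS]mulr1 ler_wpM2l // -[1]mulr1 ler_pM ?cutoff_ge0 ?cutoff_le1.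
Qed.

End weights.

Section slices.
Context (R : realType) (d : nat) (T : R).
Local Notation leb := (@lebesgue_measure R).
Local Notation lebT := (lebesgue_rV R d).
Local Notation mu := (leb \x lebT)%E.
Local Notation ST := (measurableTypeR R * 'rV[R]_d)%type.

Lemma restrict_slice (m : ST -> R) t : 0 < t < T ->
  (fun x => ((EFin \o m) \_ (cylinder d T)) (t, x)) =
  (fun x => (m (t, x))%:E) \_ (torus d).
Proof.
move=> tT; apply/funext => x; rewrite !patchE /=.
by congr (if _ then _ else _); apply/idP/idP; rewrite !inE;
  [move=> []|move=> tx; split=> //=; rewrite in_itv].
Qed.

Lemma ae_integrable_slice (m : ST -> R) : rintegrable mu (cylinder d T) m ->
  {ae leb, forall t : R, 0 < t < T -> rintegrable lebT (torus d) (fun x => m (t, x))}.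
Proof.
move=> mi; have mC : measurable (cylinder d T : set ST) by exact: measurable_cylinder.
have := ae_integrable1 (proj1 (integrable_mkcond _ mC) mi).
apply: filterS => t it tT; rewrite restrict_slice // in it.
exact: (proj2 (integrable_mkcond _ (@measurable_torus R d)) it).
Qed.

(** By Fubini the weighted integral of [m - k] is the integral over time of a
nonpositive function; being nonnegative, it forces this function to vanish
almost everywhere. *)
Lemma weighted_slices (rho : R -> R) (m k : ST -> R) (t0 t1 : R) :
  rintegrable mu (cylinder d T) m -> rintegrable mu (cylinder d T) k ->
  rintegrable mu (cylinder d T) (fun z => rho z.1 * (m z - k z)) ->
  (0 <= \int[mu]_(z in cylinder d T) (rho z.1 * (m z - k z))%:E)%E ->
  0 <= t0 -> t0 < t1 -> t1 <= T ->
  (forall t, t1 <= t -> rho t = 0) -> (forall t, t < t1 -> 0 < rho t) ->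
  {ae leb, forall t : R, 0 < t < t1 ->
    (\int[lebT]_(x in torus d) (m (t, x))%:E <=
     \int[lebT]_(x in torus d) (k (t, x))%:E)%E} ->
  {ae leb, forall t : R, t0 < t < t1 ->
    (\int[lebT]_(x in torus d) (m (t, x))%:E <
     \int[lebT]_(x in torus d) (k (t, x))%:E)%E} -> False.
Proof.
move=> mi ki Zi Z_ge0 t00 t01 t1T rho0 rho_gt0 Hle Hlt.
have mC : measurable (cylinder d T : set ST) by exact: measurable_cylinder.
have mT := @measurable_torus R d.
pose Z (z : ST) := rho z.1 * (m z - k z).
have ZiT := proj1 (integrable_mkcond _ mC) Zi.
pose phi := fubini_F lebT ((EFin \o Z) \_ (cylinder d T)).
have phi_i : leb.-integrable setT phi := integrable_fubini_F ZiT.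
have phi_int : (\int[leb]_t phi t = \int[mu]_(z in cylinder d T) (Z z)%:E)%E.
  by rewrite [RHS]integral_mkcond -(fubini1 ZiT).
have phi_out t : ~~ (0 < t < T) -> phi t = 0%E.
  move=> tT; rewrite /phi /fubini_F integral0_eq // => x _.
  by rewrite patchE memNset // => -[/=]; rewrite in_itv /= (negPf tT).
have FF : Filter (almost_everywhere leb) by exact: ae_filter_ringOfSetsType.
have phi_in : {ae leb, forall t : R, 0 < t < T ->
    rintegrable lebT (torus d) (fun x => m (t, x)) /\
    rintegrable lebT (torus d) (fun x => k (t, x))}.
  have Hm := ae_integrable_slice mi; have Hk := ae_integrable_slice ki.
  by apply: filterS2 Hm Hk => t h1 h2 tT; split; [exact: h1|exact: h2].
have phiE : {ae leb, forall t : R, 0 < t < T ->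
    phi t = ((rho t)%:E * (\int[lebT]_(x in torus d) (m (t, x))%:E -
      \int[lebT]_(x in torus d) (k (t, x))%:E))%E /\
    (\int[lebT]_(x in torus d) (m (t, x))%:E)%E \is a fin_num /\
    (\int[lebT]_(x in torus d) (k (t, x))%:E)%E \is a fin_num}.
  apply: filterS phi_in => t H tT; have [im ik] := H tT; split; last first.
    by split; exact: integrable_fin_num.
  rewrite /phi /fubini_F restrict_slice // -integral_mkcond.
  rewrite -(integral_subr mT im ik) -(integralZl mT (rintegrableB mT im ik)).
  by apply: eq_integral => x _.
have phi_le0 : {ae leb, forall t : R, setT t -> (phi t <= 0)%E}.
  apply: filterS2 phiE Hle => t H1 H2 _.
  have [tT|tT] := boolP (0 < t < T); last by rewrite phi_out.
  have [-> [fm fk]] := H1 tT.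
  have [tt1|tt1] := leP t1 t; first by rewrite rho0 // mul0e.
  rewrite mule_ge0_le0 //; first by rewrite lee_fin ltW // rho_gt0.
  by rewrite sube_le0; apply: H2; have /andP[-> _] := tT.
have phi0 : ae_eq leb setT phi (cst 0%E).
  apply/(ae_eq_integral_abs leb measurableT (measurable_int _ phi_i)).
  have -> : (\int[leb]_t `|phi t| = \int[leb]_t - phi t)%E.
    apply: ae_eq_integral => //.
    - by apply: measurableT_comp => //; exact: measurable_int phi_i.
    - by apply: measurableT_comp => //; exact: measurable_int phi_i.
    - by apply: filterS phi_le0 => t H _; rewrite lee0_abs //; exact: H.
  apply/eqP; rewrite eq_le; apply/andP; split.
    by rewrite integralN ?oppe_le0 ?phi_int //; exact: integrable_add_def.
  have -> : (\int[leb]_t - phi t = \int[leb]_t `|phi t|)%E.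
    apply: ae_eq_integral => //.
    - by apply: measurableT_comp => //; exact: measurable_int phi_i.
    - by apply: measurableT_comp => //; exact: measurable_int phi_i.
    - by apply: filterS phi_le0 => t H _; rewrite lee0_abs //; exact: H.
  exact: integral_ge0.
have : leb.-negligible (`]t0, t1[ : set R).
  have [A [mA A0 sub]] := filterI (filterI phi0 phiE) Hlt.
  exists A; split=> // t /=; rewrite in_itv /= => t01'; apply: sub => -[[H0 H1] H2].
  have tT : 0 < t < T.
    by have /andP[a b] := t01'; rewrite (le_lt_trans t00 a) (lt_le_trans b t1T).
  have [E [fm fk]] := H1 tT; have := H2 t01'.
  rewrite -sube_lt0; last by rewrite fm.
  move=> neg.
  have : (phi t < 0)%E.
    rewrite E mule_gt0_lt0 // lte_fin rho_gt0 //.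
    by have /andP[] := t01'.
  by rewrite (H0 I) ltxx.
move/measure_negligible => /(_ (measurable_itv _)).
move=> null; have : (lebesgue_measure (`]t0, t1[%classic : set R) = 0)%E by exact: null.
rewrite lebesgue_measure_itv /= lte_fin t01 -EFinB => /eqP.
by rewrite eqe subr_eq0 gt_eqF.
Qed.

End slices.

(** * Orlicz fields on the cylinder *)

Section orlicz_fields.
Context (R : realType) (dS : measure_display) (S : measurableType dS).
Context (mu : {measure set S -> \bar R}) (D : set S) (mD : measurable D) (n : nat).

Lemma orlicz_rintegrable (g : 'rV[R]_n -> R) (f : S -> 'rV[R]_n) :
  (forall a, open [set y | a < g y]) -> (forall y, 0 <= g y) ->
  orlicz mu D g f -> rintegrable mu D (fun z => g (f z)).
Proof.
move=> og g0 [mf fi]; apply/integrableP; split.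
  by apply/measurable_EFinP; exact: measurable_lower_semicontinuous.
rewrite (eq_integral (fun z => (g (f z))%:E)) // => z _.
by rewrite /= ger0_norm.
Qed.

Lemma rintegrable_orlicz (g : 'rV[R]_n -> R) (f : S -> 'rV[R]_n) :
  (forall y, 0 <= g y) -> mx_measurable D f ->
  rintegrable mu D (fun z => g (f z)) -> orlicz mu D g f.
Proof.
move=> g0 mf /integrableP[_ fi]; split=> //.
rewrite (eq_integral (fun z => `|(EFin \o (fun z => g (f z))) z|)%E) // => z _.
by rewrite /= ger0_norm.
Qed.

(** Young's inequality for [x] and for [- x]. *)
Lemma rintegrable_young (K : 'rV[R]_n -> R) (x e : S -> 'rV[R]_n) : N_function K ->
  mx_measurable D x -> mx_measurable D e ->
  rintegrable mu D (fun z => K (x z)) ->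
  rintegrable mu D (fun z => legendre K (e z)) ->
  rintegrable mu D (fun z => mxdot (x z) (e z)).
Proof.
move=> KN mx me xi ei.
apply: (@rintegrable_le _ _ _ mu _ mD _ (fun z => K (x z) + legendre K (e z))).
- exact: measurable_mxdot.
- exact: rintegrableD.
- move=> z _; rewrite ler_norml; have := young_inequality KN (x z) (e z).
  have := young_inequality KN (- x z) (e z).
  by rewrite (Nfun_even KN) mxdotNl => h1 h2; apply/andP; split; lra.
Qed.

End orlicz_fields.

Section space_fields.
Context (R : realType) (d : nat) (T : R).
Local Notation leb := (@lebesgue_measure R).
Local Notation lebT := (lebesgue_rV R d).
Local Notation mu := (leb \x lebT)%E.
Local Notation ST := (measurableTypeR R * 'rV[R]_d)%type.

Lemma measurable_space (g : 'rV[R]_d -> R) : measurable_fun (torus d) g ->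
  measurable_fun (cylinder d T : set ST) (fun z => g z.2).
Proof.
move=> mg _ Y mY.
have -> : cylinder d T `&` (fun z : ST => g z.2) @^-1` Y =
    `]0, T[ `*` (torus d `&` g @^-1` Y).
  by apply/seteqP; split=> [[t x] [[h1 h2] h3]|[t x] [h1 [h2 h3]]].
apply: measurableX; first exact: measurable_itv.
by apply: mg => //; exact: measurable_torus.
Qed.

Lemma rintegrable_space (k : 'rV[R]_d -> R) : rintegrable lebT (torus d) k ->
  rintegrable mu (cylinder d T) (fun z => k z.2).
Proof.
move=> ki; have mC : measurable (cylinder d T : set ST) by exact: measurable_cylinder.
have mT := @measurable_torus R d.
apply: (proj2 (integrable_mkcond _ mC)).
set f := _ \_ _.
have mf : measurable_fun setT f.
  apply: (proj1 (measurable_restrictT _ mC)); apply/measurable_EFinP.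
  exact: measurable_space (rintegrable_measurable ki).
apply: (proj2 (@integrable12ltyP _ _ _ _ _ leb lebT f mf)).
have [_ c_fin] := integrableP _ _ _ ki.
set c := (\int[lebT]_(x in torus d) `|(EFin \o k) x|)%E in c_fin.
have E : (fun t => \int[lebT]_x `|f (t, x)|)%E = (cst c) \_ (`]0, T[ : set R).
  apply/funext => t; rewrite patchE.
  have fE x : f (t, x) = if (t, x) \in (cylinder d T : set ST) then (k x)%:E else 0%E.
    by rewrite /f patchE.
  case: ifPn => [|]; last first.
    rewrite notin_setE => nt; apply: integral0_eq => // x _.
    by rewrite fE memNset ?abse0 // => -[].
  rewrite inE => tT; rewrite /c [RHS]integral_mkcond; apply: eq_integral => x _.
  rewrite fE patchE; case: ifPn => [|]; case: ifPn => //.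
    by rewrite notin_setE inE => nx [].
    by rewrite inE notin_setE => tx; case; split.
  by rewrite abse0.
rewrite E -integral_mkcond integral_cst; last exact: measurable_itv.
have lT : (lebesgue_measure (`]0%R, T[%classic : set R) < +oo)%E.
  rewrite lebesgue_measure_itv /=.
  by case: ifP => // _; rewrite -EFinB ltry.
apply: lte_mul_pinfty => //; first by apply: integral_ge0.
by rewrite ge0_fin_numE //; apply: integral_ge0.
Qed.

End space_fields.

Lemma lower_semicontinuousW (R : realType) n (g : 'rV[R]_n -> R) (a : R) :
  continuous g -> open [set y | a < g y].
Proof.
move=> cg.
exact: (@open_comp _ _ g [set r | a < r] (fun y _ => cg y) (@open_gt R a)).
Qed.

(** * The relative entropy argument *)

Section relative_entropy.
Context (R : realType) (d n N : nat) (F : 'rV[R]_n -> 'M[R]_N) (L : diffop R d n N).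
Context (T : R) (h : R -> R) (v0 : 'rV[R]_d -> 'rV[R]_n).
Context (v u : R * 'rV[R]_d -> 'rV[R]_n) (M : R * 'rV[R]_d -> 'M[R]_N).
Hypothesis FL : standing_assumptions F L.
Hypothesis hP : is_weight T h.
Hypothesis v0P : orlicz (lebesgue_rV R d) (torus d) (entropy F) v0.
Hypothesis vP : strong_solution F L T v0 h v.
Hypothesis uMP : subsolution F L T v0 u M.
Local Notation leb := (@lebesgue_measure R).
Local Notation lebT := (lebesgue_rV R d).
Local Notation mu := (leb \x lebT)%E.
Local Notation ST := (measurableTypeR R * 'rV[R]_d)%type.
Local Notation K := (entropy F).
Local Notation cyl := (cylinder d T : set ST).

Let mC : measurable cyl. Proof. exact: measurable_cylinder. Qed.
Let KN : N_function K. Proof. exact: entropy_Nfun FL. Qed.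
Let K_ge0 y : 0 <= K y. Proof. exact: Nfun_ge0 KN y. Qed.
Let K_lsc a : open [set y | a < K y].
Proof. exact/lower_semicontinuousW/(entropy_continuous FL). Qed.
Let Kstar_lsc a : open [set y | a < legendre K y].
Proof. exact/(legendre_gt_open KN)/(entropy_continuous FL). Qed.

(** Before [t1] the weight is at least a multiple of [T - t1]. *)
Lemma adjoint_bounded (G : R * 'rV[R]_d -> 'M[R]_N) (t1 : R) : t1 < T ->
  Linfty_symm mu cyl (fun z => weight_primitive T h z.1 *: G z) ->
  exists2 C, 0 < C & {ae mu, forall z, cyl z -> z.1 < t1 -> enorm (G z) <= C}.
Proof.
move=> t1T [_ _ [C0 HC]]; have [mh [c [C [c0 hc]]]] := hP.
have cT : 0 < c * (T - t1) by rewrite mulr_gt0 // subr_gt0.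
exists ((`|C0| + 1) / (c * (T - t1))); first by rewrite divr_gt0 // ltr_wpDl.
apply: filterS HC => -[t x] HC cz /= tt1; have := HC cz.
have [/= + _] := cz; rewrite in_itv /= => /andP[t0 tT].
have t0T : 0 <= t <= T by rewrite !ltW.
have := weight_primitive_lower mh c0 hc t0T; set W := weight_primitive T h t => HW.
have W0 : c * (T - t1) <= W.
  by apply: le_trans HW; rewrite ler_pM2l //; lra.
have -> : enorm (W *: G (t, x)) = W * enorm (G (t, x)).
  rewrite /enorm mxdotZl mxdotZr mulrA -expr2 sqrtrM ?sqr_ge0 // sqrtr_sqr ger0_norm //.
  exact: ltW (lt_le_trans cT W0).
move=> H; rewrite ler_pdivlMr // mulrC.
apply: (le_trans (ler_wpM2r (enorm_ge0 _) W0)); apply: (le_trans H).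
by rewrite (le_trans (ler_norm _)) // lerDl.
Qed.

Section multiplier.
Variables (t1 : R) (t1T : t1 < T).
Variables (wt : R * 'rV[R]_d -> 'rV[R]_n) (G : R * 'rV[R]_d -> 'M[R]_N).
Hypothesis w_dt : weak_dt T (sharp F \o v) wt.
Hypothesis w_adj : weak_adjoint L T (sharp F \o v) G.
Hypothesis v_eq : {ae mu, forall z, cyl z -> forall l,
  wt z ord0 l + mxdot (G z) ('D_(evec l) F (grad (legendre K) (sharp F (v z)))) = 0}.
Variables (C : R) (C0 : 0 < C).
Hypothesis G_le : {ae mu, forall z, cyl z -> z.1 < t1 -> enorm (G z) <= C}.

Let H (t : R) := decay t1 (2 * C) t.
Let rho (t : R) := decay_rate t1 (2 * C) t.
Let r_gt0 : 0 < 2 * C. Proof. by rewrite mulr_gt0. Qed.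

(** The multiplier is half of the weight density plus the weighted adjoint
field; the decay rate makes it nonnegative. *)
Let P z := (2^-1 * rho z.1) *: 1%:M + H z.1 *: G z.
Let E z := H z.1 *: wt z + - rho z.1 *: sharp F (v z).

Let FFmu : Filter (almost_everywhere mu).
Proof. exact: ae_filter_ringOfSetsType. Qed.

Let weighted_G_le : {ae mu, forall z, cyl z -> enorm (H z.1 *: G z) <= 2^-1 * rho z.1}.
Proof.
apply: filterS G_le => z GC cz.
have [tt1|tt1] := leP t1 z.1.
  rewrite /H decay_ge // scale0r /enorm mxdot0l sqrtr0.
  by rewrite mulr_ge0 // decay_rate_ge0 // ltW.
have -> : enorm (H z.1 *: G z) = H z.1 * enorm (G z).
  rewrite /enorm mxdotZl mxdotZr mulrA -expr2 sqrtrM ?sqr_ge0 // sqrtr_sqr ger0_norm //.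
  exact: decay_ge0.
apply: (le_trans (ler_wpM2l (decay_ge0 _ _ _) (GC cz tt1))).
have := decay_le_rate t1 (2 * C) z.1; rewrite -/(H z.1) -/(rho z.1); lra.
Qed.

Let P_good : exists k : nat, {ae mu, forall z, cyl z ->
  [/\ Lambda L (P z), nonneg_definite (P z) & nonneg_definite (2 ^+ k *: 1%:M - P z)]}.
Proof.
have [k hk] : exists k : nat, 4 + 2 * C <= 2 ^+ k.
  have c1 : 0 <= 4 + 2 * C by rewrite addr_ge0 // ltW.
  exists (Num.bound (4 + 2 * C)); apply: ltW; apply: (lt_le_trans (archi_boundP c1)).
  by rewrite -natrX ler_nat ltnW // ltn_expl.
exists k; apply: filterS2 (weak_adjoint_Lambda w_adj) weighted_G_le => z LG GC cz.
have sG : symm (H z.1 *: G z) by apply: symmZ; have [_ _ + _] := w_adj; exact.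
have LHG : Lambda L (H z.1 *: G z) by exact/LambdaZ/LG.
split.
- by apply: LambdaD => //; exact/LambdaZ/Lambda1.
- by apply: nonneg_definite_shift => //; exact: GC.
- have -> : 2 ^+ k *: 1%:M - P z =
      (2 ^+ k - 2^-1 * rho z.1) *: 1%:M + (-1) *: (H z.1 *: G z).
    by rewrite /P opprD addrA -scalerBl scaleN1r.
  apply: nonneg_definite_shift; first exact: symmZ.
  have -> : enorm ((-1) *: (H z.1 *: G z)) = enorm (H z.1 *: G z).
    by rewrite scaleN1r /enorm mxdotNl mxdotNr opprK.
  have [/= + _] := cz; rewrite in_itv /= => /andP[/ltW z0 _].
  have := decay_rate_le t1 (ltW r_gt0) z0; rewrite -/(rho z.1).
  have := GC cz; lra.
Qed.

(** The equation, with [w_l = I : d_l F(v) / 2], says that [E] is minus the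
gradient of [F : P] at [v]. *)
Let E_eq : {ae mu, forall z, cyl z -> forall l,
  E z ord0 l = - mxdot ('D_(evec l) F (v z)) (P z)}.
Proof.
apply: filterS v_eq => z veq cz l; have := veq cz l.
have -> : E z ord0 l = H z.1 * wt z ord0 l + - rho z.1 * sharp F (v z) ord0 l.
  by rewrite /E 3!mxE.
rewrite (grad_legendre_sharp FL).
rewrite (sharpE FL) /P mxdotDr !mxdotZr.
rewrite (mxdotC (G z)) => /eqP; rewrite addr_eq0 => /eqP ->; ring.
Qed.

Let v_measurable : mx_measurable cyl v. Proof. by have [[[]]] := vP. Qed.
Let u_measurable : mx_measurable cyl u. Proof. by have [[]] := uMP. Qed.
Let iKv : rintegrable mu cyl (fun z => K (v z)).
Proof. by have [[Lv _] _ _ _] := vP; exact: orlicz_rintegrable. Qed.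
Let iKu : rintegrable mu cyl (fun z => K (u z)).
Proof. by have [Lu _ _ _] := uMP; exact: orlicz_rintegrable. Qed.

Let mE : mx_measurable cyl E.
Proof.
have [lw lwt _] := w_dt.
have mw := loc_integrable_measurable lw; have mwt := loc_integrable_measurable lwt.
have sc (g : R -> R) : smooth g -> measurable_fun cyl (fun z : ST => g z.1).
  by move=> sg; apply: measurable_continuous_st => //; exact/smooth_continuous/smooth_time.
move=> i j; rewrite /E; under eq_fun do rewrite 3!mxE.
apply: measurable_funD; apply: measurable_funM.
- exact: sc (smooth_decay t1 (2 * C)).
- exact: mwt.
- have s1 := smoothM (@smooth_cst R R (-1)) (smooth_decay_rate t1 (2 * C)).
  have := sc _ s1; apply: eq_measurable_fun => z _; by rewrite mulN1r.
- exact: mw.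
Qed.

Let iKE : rintegrable mu cyl (fun z => legendre K (E z)).
Proof.
have [k Pk] := P_good; have [D D0 HD] := legendre_multiplier FL k.
apply: (@rintegrable_ae_le _ _ _ mu _ mC _ (fun z => D * (K (v z) + 1))).
- exact: measurable_lower_semicontinuous.
- apply: rintegrableZ => //; apply: rintegrableD => //.
  by apply: (@rintegrable_finite _ _ _ mu _ mC 1) => // [|z _];
    [exact: cylinder_finite|rewrite normr1].
- apply: filterS2 Pk E_eq => z Pz Ez cz; have [P1 P2 P3] := Pz cz.
  rewrite ger0_norm ?legendre_ge0 //; apply: HD P1 P2 P3 _.
  exact: Ez.
Qed.

Let iE i j : rintegrable mu cyl (fun z => E z i j).
Proof.
rewrite (ord1 i).
have -> : (fun z => E z ord0 j) = (fun z => mxdot (evec j) (E z)).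
  by apply/funext => z; rewrite mxdotC mxdot_delta.
apply: (rintegrable_young mC KN) => //.
by apply: (@rintegrable_finite _ _ _ mu _ mC `|K (evec j)|) => //; exact: cylinder_finite.
Qed.

Let mG : mx_measurable cyl G.
Proof. by have [_ lG _ _] := w_adj; exact: loc_integrable_measurable. Qed.

Let mB : mx_measurable cyl (fun z => H z.1 *: G z).
Proof.
move=> i j; under eq_fun do rewrite mxE.
apply: measurable_funM => //; apply: measurable_continuous_st => //.
exact/smooth_continuous/smooth_time/smooth_decay.
Qed.

Let B_le : {ae mu, forall z, cyl z -> enorm (H z.1 *: G z) <= 2 + C}.
Proof.
apply: filterS weighted_G_le => z HG cz; apply: (le_trans (HG cz)).
have [/= + _] := cz; rewrite in_itv /= => /andP[/ltW z0 _].
have := decay_rate_le t1 (ltW r_gt0) z0; rewrite -/(rho z.1); lra.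
Qed.

Let pair_constraint : constraint L T E (fun z => H z.1 *: G z).
Proof.
apply: (@weighted_constraint _ _ _ _ L T _ _ _ w_dt w_adj t1 (2 + C) H
  (fun t => - rho t)) => //.
- exact: smooth_decay.
- have := smoothM (@smooth_cst R R (-1)) (smooth_decay_rate t1 (2 * C)).
  by apply: smooth_eq => t; rewrite mulN1r.
- by move=> t; exact: is_derive_decay.
- by move=> t /ltW; exact: decay_ge.
- by move=> t /ltW h1; rewrite /rho decay_rate_ge // oppr0.
Qed.

Let m z := 2^-1 * mxdot (M z - F 0) 1%:M.
Let k z := K (v z).

Let M_int i j : rintegrable mu cyl (fun z => M z i j).
Proof. by have [_ [_ MI] _ _] := uMP; exact: MI. Qed.

Let cst_int (c : R) : rintegrable mu cyl (cst c).
Proof.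
by apply: (@rintegrable_finite _ _ _ mu _ mC `|c|) => //; exact: cylinder_finite.
Qed.

Let m_int : rintegrable mu cyl m.
Proof.
apply: rintegrableZ => //; apply: rintegrable_sum => // i; apply: rintegrable_sum => // j.
apply: (@rintegrable_eq _ _ _ mu _ mC (fun z => (1%:M : 'M[R]_N) i j * (M z i j - F 0 i j))).
  by move=> z _; rewrite !mxE mulrC.
apply: (@rintegrableZ _ _ _ mu _ mC ((1%:M : 'M[R]_N) i j) (fun z => M z i j - F 0 i j)).
exact: (rintegrableB mC (M_int i j) (cst_int (F 0 i j))).
Qed.

Let rho_mul_int (g : ST -> R) : rintegrable mu cyl g ->
  rintegrable mu cyl (fun z => rho z.1 * g z).
Proof.
move=> gi; apply: (@rintegrable_bounded_mul _ _ _ mu _ mC (4 + 2 * C)) => //.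
  apply: measurable_continuous_st => //.
  exact/smooth_continuous/smooth_time/smooth_decay_rate.
move=> z [/= + _]; rewrite in_itv /= => /andP[/ltW z0 _].
rewrite ger0_norm; first exact: decay_rate_le (ltW r_gt0) z0.
exact: decay_rate_ge0 (ltW r_gt0).
Qed.

Let MB_int : rintegrable mu cyl (fun z => mxdot (M z) (H z.1 *: G z)).
Proof.
apply: rintegrable_sum => // i; apply: rintegrable_sum => // j.
apply: (@rintegrable_ae_le _ _ _ mu _ mC _ (fun z => (2 + C) * `|M z i j|)).
- by apply: measurable_funM; [exact: rintegrable_measurable (M_int i j)|exact: mB].
- by apply: rintegrableZ => //; exact: rintegrable_abs.
- apply: filterS B_le => z HB cz; rewrite normrM mulrC ler_wpM2r //.
  exact: le_trans (entry_le_enorm _ _ _) (HB cz).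
Qed.

Let mF : mx_measurable cyl (fun z => F (v z)).
Proof.
move=> i j; apply: (@measurable_continuous _ _ _ _ _ v (fun y => F y i j)) => //.
exact: (continuous_entry i j (F_continuous FL)).
Qed.

(** The sign of [F(v) : P] and the bound [P <= 2^q I] make [F(v) : P] integrable;
[B] differs from [P] by a bounded multiple of [I]. *)
Let FB_int : rintegrable mu cyl (fun z => mxdot (F (v z)) (H z.1 *: G z)).
Proof.
have FIi : rintegrable mu cyl (fun z => mxdot (F (v z)) 1%:M).
  apply: (@rintegrable_eq _ _ _ mu _ mC (fun z => 2 * K (v z) + mxdot (F 0) 1%:M)).
    by move=> z _; rewrite -trace_entropy.
  exact: (rintegrableD mC (rintegrableZ mC 2 iKv) (cst_int (mxdot (F 0) 1%:M))).
have mFP : measurable_fun cyl (fun z => mxdot (F (v z)) (P z)).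
  apply: measurable_mxdot => // i j; rewrite /P; under eq_fun do rewrite mxE.
  apply: measurable_funD; last exact: mB.
  under eq_fun do rewrite mxE.
  apply: measurable_funM; last exact: measurable_cst.
  apply: measurable_continuous_st => //; apply: smooth_continuous.
  apply: smoothM; first exact: smooth_cst.
  exact/smooth_time/smooth_decay_rate.
have [q Pq] := P_good.
have FPi : rintegrable mu cyl (fun z => mxdot (F (v z)) (P z)).
  apply: (@rintegrable_ae_le _ _ _ mu _ mC _ (fun z => 2 ^+ q * mxdot (F (v z)) 1%:M)) => //.
    exact: rintegrableZ.
  apply: filterS Pq => z Pz cz; have [P1 P2 P3] := Pz cz.
  rewrite ger0_norm; last exact: F_cone_ge0 FL _ _ P1 P2.
  have LP : Lambda L (2 ^+ q *: 1%:M - P z).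
    by apply: LambdaD; [exact/LambdaZ/Lambda1|rewrite -scaleN1r; exact: LambdaZ].
  by have := F_cone_ge0 FL (v z) LP P3; rewrite mxdotBr mxdotZr subr_ge0.
have := rintegrableB mC FPi (rintegrableZ mC 2^-1 (rho_mul_int FIi)).
apply: rintegrable_eq => // z _; rewrite /P mxdotDr !mxdotZr; ring.
Qed.

Let dot_int (y : R * 'rV[R]_d -> 'rV[R]_n) : mx_measurable cyl y ->
  rintegrable mu cyl (fun z => K (y z)) ->
  rintegrable mu cyl (fun z => mxdot (y z) (E z)).
Proof. by move=> my iy; exact: (rintegrable_young mC KN). Qed.

Let v0_int : rintegrable mu cyl (fun z => mxdot (v0 z.2) (E z)).
Proof.
have mT := @measurable_torus R d.
apply: (@dot_int (fun z => v0 z.2)).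
  by move=> i j; have [mv0 _] := v0P;
    exact: (@measurable_space R d T (fun x => v0 x i j) (mv0 i j)).
apply: (@rintegrable_space R d T (fun x => K (v0 x))).
exact: orlicz_rintegrable v0P.
Qed.

(** Testing both weak identities with the same pair and comparing pointwise by
convexity of [F : P]. *)
Lemma weighted_entropy_ge0 :
  (0 <= \int[mu]_(z in cyl) (rho z.1 * (m z - k z))%:E)%E.
Proof.
have EK : orlicz (st_measure d) (cylinder d T) (legendre K) E.
  by apply: rintegrable_orlicz => //; exact: legendre_ge0.
have BL : Linfty_symm (st_measure d) (cylinder d T) (fun z => H z.1 *: G z).
  split=> //; last by exists (2 + C).
  by move=> z cz; apply: symmZ; have [_ _ + _] := w_adj; exact.
have [_ _ sub Hu] := uMP; have [[_ Hv] _ _ _] := vP.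
have Iu := Hu _ _ EK BL pair_constraint.
have Iv := Hv _ _ EK BL pair_constraint.
pose a z := mxdot (u z - v0 z.2) (E z) + mxdot (M z) (H z.1 *: G z).
pose b z := mxdot (v z - v0 z.2) (E z) + mxdot (F (v z)) (H z.1 *: G z).
have iu : rintegrable mu cyl a.
  apply: rintegrableD => //.
  apply: (@rintegrable_eq _ _ _ mu _ mC (fun z => mxdot (u z) (E z) - mxdot (v0 z.2) (E z))).
    by move=> z _; rewrite mxdotBl.
  by apply: rintegrableB => //; exact: dot_int.
have iv : rintegrable mu cyl b.
  apply: rintegrableD => //.
  apply: (@rintegrable_eq _ _ _ mu _ mC (fun z => mxdot (v z) (E z) - mxdot (v0 z.2) (E z))).
    by move=> z _; rewrite mxdotBl.
  by apply: rintegrableB => //; exact: dot_int.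
have iZ : rintegrable mu cyl (fun z => rho z.1 * (m z - k z)).
  by apply: rho_mul_int; exact: rintegrableB.
have I0 := integral_subr mC iu iv.
rewrite [X in (_ = X - _)%E]Iu [X in (_ = _ - X)%E]Iv sube0 in I0.
pose f z := rho z.1 * (m z - k z) + (a z - b z).
(* The integrand is nonnegative almost everywhere only, so it is compared with
   its positive part. *)
pose g z := Num.max (f z) 0.
have fi : rintegrable mu cyl f by exact: (rintegrableD mC iZ (rintegrableB mC iu iv)).
have mf := rintegrable_measurable fi.
have <- : (\int[mu]_(z in cyl) (f z)%:E =
    \int[mu]_(z in cyl) (rho z.1 * (m z - k z))%:E)%E.
  by rewrite /f (integral_addr mC iZ (rintegrableB mC iu iv)) I0 adde0.
suff fg : {ae mu, forall z, cyl z -> f z = g z}.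
  have mg : measurable_fun cyl g.
    by apply: measurable_maxr => //; exact: measurable_cst.
  rewrite (integral_ae_eq0 mC mf mg fg).
  by apply: integral_ge0 => z _; rewrite lee_fin le_max lexx orbT.
have [q Pq] := P_good.
apply: filterS2 (filterI Pq E_eq) sub => z [Pz Ez] Mz cz.
have [P1 P2 _] := Pz cz; have [_ cone] := Mz cz.
rewrite /g max_l // /f /a /b.
have h1 := cone _ P1 P2; rewrite mxdotBl in h1.
have h2 := F_gradient FL (v z) (u z) P1 P2.
have h3 : \sum_l (u z - v z) ord0 l * mxdot ('D_(evec l) F (v z)) (P z) =
    - mxdot (u z - v z) (E z).
  by rewrite rv_mxdotE -sumrN; apply: eq_bigr => l _; rewrite (Ez cz) mulrN opprK.
rewrite h3 in h2.
have h4 : m z - k z = 2^-1 * (mxdot (M z) 1%:M - mxdot (F (v z)) 1%:M).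
  by rewrite /m /k (entropyE F (v z)) !mxdotBl; ring.
rewrite h4; move: h1 h2; rewrite /P !mxdotDr !mxdotZr !mxdotBl; lra.
Qed.

Lemma entropy_deficit_false (t0 : R) : 0 <= t0 -> t0 < t1 ->
  {ae leb, forall t : R, 0 < t < t1 ->
    (sub_total_entropy F M t <= total_entropy F v t)%E} ->
  {ae leb, forall t : R, t0 < t < t1 ->
    (sub_total_entropy F M t < total_entropy F v t)%E} -> False.
Proof.
move=> t00 t01 Hle Hlt.
apply: (@weighted_slices R d T rho m k t0 t1) => //.
- by apply: rho_mul_int; exact: rintegrableB.
- exact: weighted_entropy_ge0.
- exact: ltW.
- by move=> t; exact: decay_rate_ge.
- by move=> t; exact: decay_rate_gt0.
Qed.

End multiplier.

End relative_entropy.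

Theorem theorem4p3 (R : realType) (d n N : nat)
    (F : 'rV[R]_n -> 'M[R]_N) (L : diffop R d n N)
    (T : R) (h : R -> R)
    (v0 : 'rV[R]_d -> 'rV[R]_n) (v u : R * 'rV[R]_d -> 'rV[R]_n)
    (M : R * 'rV[R]_d -> 'M[R]_N)
    (T_gt0 : 0 < T)
    (FL : standing_assumptions F L)
    (hP : is_weight T h)
    (v0P : orlicz (lebesgue_rV R d) (torus d) (entropy F) v0)
    (vP : strong_solution F L T v0 h v)
    (uMP : subsolution F L T v0 u M) :
  (forall t0 t1 : R, 0 <= t0 -> t0 < t1 -> t1 <= T ->
    ~ ({ae lebesgue_measure, forall t : R, 0 < t < t1 ->
          (sub_total_entropy F M t <= total_entropy F v t)%E} /\
       {ae lebesgue_measure, forall t : R, t0 < t < t1 ->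
          (sub_total_entropy F M t < total_entropy F v t)%E})) /\
  (forall eps : R, 0 < eps -> eps <= T ->
    ~ {ae lebesgue_measure, forall t : R, 0 < t < eps ->
          (sub_total_entropy F M t < total_entropy F v t)%E}).

Proof.
have FF : Filter (almost_everywhere (@lebesgue_measure R)).
  exact: ae_filter_ringOfSetsType.
have first_part t0 t1 : 0 <= t0 -> t0 < t1 -> t1 <= T ->
    ~ ({ae lebesgue_measure, forall t : R, 0 < t < t1 ->
          (sub_total_entropy F M t <= total_entropy F v t)%E} /\
       {ae lebesgue_measure, forall t : R, t0 < t < t1 ->
          (sub_total_entropy F M t < total_entropy F v t)%E}).
  move=> t00 t01 t1T [Hle Hlt].
  have [wt [G [w_dt w_adj Ginf v_eq]]] := strong_eq vP.
  (* The adjoint field is bounded only away from the final time. *)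
  have [s s0 s1] : exists2 s, t0 < s & s < t1 by exists ((t0 + t1) / 2); lra.
  have sT : s < T by exact: lt_le_trans t1T.
  have [C C0 GC] := adjoint_bounded hP sT Ginf.
  have le_s : {ae lebesgue_measure, forall t : R, 0 < t < s ->
      (sub_total_entropy F M t <= total_entropy F v t)%E}.
    by apply: filterS Hle => t H /andP[t0' ts]; apply: H; rewrite t0' (lt_trans ts).
  have lt_s : {ae lebesgue_measure, forall t : R, t0 < t < s ->
      (sub_total_entropy F M t < total_entropy F v t)%E}.
    by apply: filterS Hlt => t H /andP[t0' ts]; apply: H; rewrite t0' (lt_trans ts).
  exact: (entropy_deficit_false FL v0P vP uMP sT w_dt w_adj v_eq C0 GC t00 s0 le_s lt_s).
split=> // eps eps0 epsT H; apply: (first_part 0 eps) => //; split=> //.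
by apply: filterS H => t H te; exact: ltW (H te).
Qed.
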